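(* Let $\alpha\in(1/3,1/2)$ and $p\in(1,+\infty)$ with $\alpha>1/p$, and let $(B_t)_{t\in[0,1]}$ be a $d$-dimensional Brownian motion on a probability space $(\Omega,\mathcal{F},\mathbb{P})$. For almost all $\omega\in\Omega$, the Stratonovich rough path lift $\mathbf{B}^s(\omega)=(1,B(\omega),\mathbb{B}^{s}(\omega))\in W^\alpha_p([0,1];G^2(\mathbb{R}^d))$ is the unique minimizer of $$\min_{\mathbf{X}\in\mathcal{A}(B(\omega))}F(\mathbf{X}),\qquad F(\mathbf{X})=\limsup_{m\to\infty}\hat\rho_{W^\alpha_p}\big(\mathbf{X},S(B^m(\omega))\big).$$
   Context: $G^2(\mathbb{R}^d)=\exp(\mathbb{R}^d\oplus[\mathbb{R}^d,\mathbb{R}^d])\subset\mathbb{R}\oplus\mathbb{R}^d\oplus(\mathbb{R}^d)^{\otimes2}$ is the step-2 free nilpotent group with truncated tensor product $\otimes$ (bracket $[a,b]=a\otimes b-b\otimes a$); $\pi_k$ is the projection onto level $k$. It carries the Carnot–Carathéodory norm $\|g\|$ (infimum of the lengths of bounded variation paths in $\mathbb{R}^d$ whose step-2 signature is $g$) and metric $d_{cc}(g,h)=\|g^{-1}\otimes h\|$. For a metric space $(E,d)$, $W^\alpha_p([0,1];E)$ is the set of paths $f:[0,1]\to E$ (continuous, since $\alpha>1/p$) with $\iint_{[0,1]^2}\frac{d(f(s),f(t))^p}{|t-s|^{\alpha p+1}}\,ds\,dt<\infty$. For group-valued paths, $\mathbf{X}_{s,t}=\mathbf{X}_s^{-1}\otimes\mathbf{X}_t$.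 Brownian motion starts at $0$ as usual, and its sample paths lie in $W^\alpha_p([0,1];\mathbb{R}^d)$ almost surely. $\mathbf{B}^s=(1,B,\mathbb{B}^s)$ is its lift by Stratonovich integration, $\mathbf{B}^s_t=(1,B_t,\int_0^t B_r\otimes\circ\,dB_r)$. For a path $X:[0,1]\to\mathbb{R}^d$, the dyadic interpolation $X^m$ is given by $X^m_t=X_{\frac{k-1}{2^m}}+2^m\big(t-\frac{k-1}{2^m}\big)\big(X_{\frac{k}{2^m}}-X_{\frac{k-1}{2^m}}\big)$ for $t\in[\frac{k-1}{2^m},\frac{k}{2^m}]$, $k=1,\dots,2^m$, and $S(X^m)$ is its canonical lift to $G^2(\mathbb{R}^d)$, with increments $(1,X^m_t-X^m_s,\int_s^t(X^m_r-X^m_s)\otimes dX^m_r)$. For a path $X\in W^\alpha_p([0,1];\mathbb{R}^d)$, the admissible set is $\mathcal{A}(X)=\{\mathbf{X}\in W^\alpha_p([0,1];G^2(\mathbb{R}^d)):\pi_1(\mathbf{X})=X\}$. The discrete inhomogeneous Sobolev distance is $\hat\rho_{W^\alpha_p}(\mathbf{X}^1,\mathbf{X}^2)=\sum_{k=1}^2\hat\rho^{(k)}_{W^\alpha_p}(\mathbf{X}^1,\mathbf{X}^2)$, where $$\hat\rho^{(k)}_{W^\alpha_p}(\mathbf{X}^1,\mathbf{X}^2)=\Big(\sum_{j\ge0}2^{j(\alpha p-1)}\sum_{i=1}^{2^j}\big|\pi_k\big(\mathbf{X}^1_{(i-1)2^{-j},i2^{-j}}-\mathbf{X}^2_{(i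-1)2^{-j},i2^{-j}}\big)\big|^{p/k}\Big)^{k/p}.$$
   Formalization: Uniqueness is proved as equality of all increments X_{s,t} of minimizers (so of paths starting at the unit): for d≥2, left translation of B^s by a constant (1,0,a), a antisymmetric, is another admissible path with the same F, so pointwise uniqueness fails. *)

(* Defs.v *)
From HB Require Import structures.
From mathcomp Require Import all_boot all_order all_algebra.
From mathcomp Require Import all_classical all_reals all_analysis.
From mathcomp Require Import ring.

Set Implicit Arguments.
Unset Strict Implicit.
Unset Printing Implicit Defensive.

Import Order.TTheory GRing.Theory Num.Theory.
Import numFieldNormedType.Exports.

Local Open Scope classical_set_scope.
Local Open Scope ring_scope.

(* Paths on [0,1] are represented by total functions on R, of which only the
   restriction to `[0, 1] is ever constrained or compared. *)

(* The canonical norm of 'M[R]_(m, n) is the sup norm; this is the Euclidean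
   one (for rows) and the Frobenius one (for square matrices). *)
Definition enorm (R : realType) (m n : nat) (A : 'M[R]_(m, n)) : R :=
  Num.sqrt (\sum_i \sum_j A i j ^+ 2).

Section Algebra.
Variables (R : realType) (d : nat).

Definition tensor2 : Type := (R * 'rV[R]_d * 'M[R]_d)%type.

Implicit Types (x y : 'rV[R]_d) (g h v : tensor2).

Definition pi0 g : R := g.1.1.
Definition pi1 g : 'rV[R]_d := g.1.2.
Definition pi2 g : 'M[R]_d := g.2.

(* (x (x) y)_(i, j) = x_i * y_j *)
Definition tens x y : 'M[R]_d := x^T *m y.

Definition tbracket x y : 'M[R]_d := tens x y - tens y x.

Definition tone : tensor2 := (1, 0, 0).

Definition tadd g h : tensor2 :=
  (pi0 g + pi0 h, pi1 g + pi1 h, pi2 g + pi2 h).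

Definition tscale (c : R) g : tensor2 := (c * pi0 g, c *: pi1 g, c *: pi2 g).

Definition tsub g h : tensor2 := tadd g (tscale (-1) h).

Definition tmul g h : tensor2 :=
  (pi0 g * pi0 h,
   pi0 g *: pi1 h + pi0 h *: pi1 g,
   pi0 g *: pi2 h + tens (pi1 g) (pi1 h) + pi0 h *: pi2 g).

(* Neumann series 1 - (g - 1) + (g - 1)^2, the inverse when pi0 g = 1. *)
Definition tinv g : tensor2 :=
  let u := tsub g tone in tadd (tsub tone u) (tmul u u).

(* 1 + v + v^2 / 2, the exponential when pi0 v = 0. *)
Definition texp v : tensor2 :=
  tadd (tadd tone v) (tscale 2^-1 (tmul v v)).

(* [R^d, R^d], the linear span of the brackets; scalars are absorbed in the
   left arguments. *)
Definition lie2 : set 'M[R]_d :=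
  [set w | exists n (a b : 'I_n -> 'rV[R]_d),
     w = \sum_(i < n) tbracket (a i) (b i)].

Definition G2 : set tensor2 :=
  [set g | exists x w, lie2 w /\ g = texp (0, x, w)].

Definition incr (X : R -> tensor2) (s t : R) : tensor2 :=
  tmul (tinv (X s)) (X t).

Lemma tmulKV g h : pi0 g = 1 -> tmul g (tmul (tinv g) h) = h.
Proof.
case: g => [[g0 g1] g2]; case: h => [[h0 h1] h2]; rewrite /pi0 /= => ->.
rewrite /tmul /tinv /tadd /tsub /tadd /tscale /tone /tmul /pi0 /pi1 /pi2 /tens /=.
rewrite !(mulr1, mulN1r, subrr, oppr0, addr0, add0r, scale0r, scale1r, scaler0,
  scaleN1r, mul0r, mulmxDr, mulmxDl, mulmxN, mulNmx, trmx0, mul0mx, mulmx0,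
  mul1r, linearN, scalerDr, scalerN) /=.
congr (_, _, _); first by rewrite subrK.
rewrite -scalemxAr.
rewrite !(addrA, addrN, addNr, add0r, mulNmx, scalerN).
by apply/matrixP=> i j; rewrite !mxE; ring.
Qed.

End Algebra.

Section Integrals.
Variable R : realType.
Implicit Types (a b : R) (s : seq R) (f g : R -> R).

(* The points of the partition s of [a, b] are nth b (a :: s) k, k <= size s *)

Definition mesh_lt (delta a b : R) s : Prop :=
  forall k, (k < size s)%N ->
    nth b (a :: s) k.+1 - nth b (a :: s) k < delta.

Definition fine_partitions a b : set_system (seq R) :=
  [set A | exists2 delta : R, 0 < delta &
     forall s, itv_partition a b s -> mesh_lt delta a b s -> A s].

Definition tags_of a b s (xi : nat -> R) : Prop :=
  forall k, (k < size s)%N ->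
    nth b (a :: s) k <= xi k <= nth b (a :: s) k.+1.

Definition fine_tagged_partitions a b : set_system (seq R * (nat -> R)) :=
  [set A | exists2 delta : R, 0 < delta &
     forall s xi, itv_partition a b s -> mesh_lt delta a b s ->
       tags_of a b s xi -> A (s, xi)].

Definition rs_sum f g a b (p : seq R * (nat -> R)) : R :=
  \sum_(0 <= k < size p.1)
    f (p.2 k) * (g (nth b (a :: p.1) k.+1) - g (nth b (a :: p.1) k)).

(* Total via lim, so meaningful only when the limit exists, e.g. for f and g
   continuous with g of bounded variation. *)
Definition rs_integral f g a b : R :=
  lim (rs_sum f g a b @ fine_tagged_partitions a b).

Definition stratonovich_sum f g a b s : R :=
  \sum_(0 <= k < size s)
    ((f (nth b (a :: s) k) + f (nth b (a :: s) k.+1)) / 2) *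
    (g (nth b (a :: s) k.+1) - g (nth b (a :: s) k)).

End Integrals.

Section Paths.
Variables (R : realType) (d : nat).
Implicit Types (x : R -> 'rV[R]_d) (X : R -> tensor2 R d).

Definition path_length x : \bar R :=
  ereal_sup [set (\sum_(0 <= k < size s)
                    enorm (x (nth 1 (0 :: s) k.+1) - x (nth 1 (0 :: s) k)))%:E
            | s in itv_partition 0 1].

(* Also used for the increments over [s, t] of the canonical lift of x. *)
Definition signature2 x (s t : R) : tensor2 R d :=
  (1, x t - x s,
   \matrix_(i, j) rs_integral (fun r => x r 0 i - x s 0 i)
                              (fun r => x r 0 j) s t).

Definition cc_norm (g : tensor2 R d) : \bar R :=
  ereal_inf [set path_length x | x in
    [set x : R -> 'rV[R]_d | [/\ {within `[0, 1], continuous x}, (path_length x < +oo)%E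
               & signature2 x 0 1 = g]]].

Definition cc_dist (g h : tensor2 R d) : \bar R := cc_norm (tmul (tinv g) h).

(* For 0 <= t < 1 the dyadic interval [k / 2^m, (k + 1) / 2^m] containing t is
   given by k = floor (2^m t); for t = 1 the second summand vanishes. *)
Definition dyadic_interp x (m : nat) (t : R) : 'rV[R]_d :=
  let k := Num.truncn (2 ^+ m * t) in
  x (k%:R / 2 ^+ m) +
  (2 ^+ m * (t - k%:R / 2 ^+ m)) *:
    (x (k.+1%:R / 2 ^+ m) - x (k%:R / 2 ^+ m)).

End Paths.

(* Continuity is part of the definition. The integrand takes the irrelevant
   value dist * 0 on the (null) diagonal. *)
Definition sobolev (R : realType) (T : Type) (dist : T -> T -> \bar R)
    (E : set T) (alpha p : R) : set (R -> T) :=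
  [set f | [/\ forall t : R, 0 <= t <= 1 -> E (f t),
    forall t : R, 0 <= t <= 1 -> forall e : R, 0 < e ->
      exists2 delta : R, 0 < delta &
        forall s : R, 0 <= s <= 1 -> `|s - t| < delta ->
          (dist (f s) (f t) < e%:E)%E
  & (\int[lebesgue_measure \x lebesgue_measure]_(z in `[0%R, 1%R] `*` `[0%R, 1%R])
       (dist (f z.1) (f z.2) `^ p *
        ((`|z.2 - z.1| `^ (alpha * p + 1))^-1)%:E) < +oo)%E]].

Section RoughPaths.
Variables (R : realType) (d : nat) (alpha p : R).

Definition admissible (x : R -> 'rV[R]_d) : set (R -> tensor2 R d) :=
  [set X | sobolev (@cc_dist R d) (@G2 R d) alpha p X /\
           forall t : R, 0 <= t <= 1 -> pi1 (X t) = x t].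

Definition level_norm (k : nat) (g : tensor2 R d) : R :=
  match k with
  | 0 => `|pi0 g|
  | 1 => enorm (pi1 g)
  | 2 => enorm (pi2 g)
  | _ => 0
  end.

(* The two arguments are the increments (s, t) |-> X_{s,t} of the paths. *)
Definition rho_level (k : nat) (X Y : R -> R -> tensor2 R d) : \bar R :=
  ((\sum_(0 <= j <oo)
     (2 `^ (j%:R * (alpha * p - 1)) *
      \sum_(1 <= i < (2 ^ j).+1)
        level_norm k (tsub (X (i.-1%:R / 2 ^+ j) (i%:R / 2 ^+ j))
                           (Y (i.-1%:R / 2 ^+ j) (i%:R / 2 ^+ j)))
          `^ (p / k%:R))%:E) `^ (k%:R / p))%E.

Definition rho_hat (X Y : R -> R -> tensor2 R d) : \bar R :=
  (\sum_(1 <= k < 3) rho_level k X Y)%E.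

Definition lift_functional (x : R -> 'rV[R]_d) (X : R -> tensor2 R d) : \bar R :=
  limn_esup (fun m => rho_hat (incr X) (signature2 (dyadic_interp x m))).

End RoughPaths.

Definition minimizer (R : realType) (T : Type) (A : set T) (F : T -> \bar R)
    (x : T) : Prop :=
  A x /\ forall y, A y -> (F x <= F y)%E.

(* Equality as rough paths on [0,1], i.e. of all increments. Both admissible x and
   lift_functional x are invariant under left translation by a constant (1, 0, a)
   with a in lie2, so minimizers can be unique only in this sense. *)
Definition eq_rough (R : realType) (d : nat) (X Y : R -> tensor2 R d) : Prop :=
  forall s t : R, 0 <= s <= 1 -> 0 <= t <= 1 -> incr X s t = incr Y s t.

Lemma eq_rough_start (R : realType) (d : nat) (X Y : R -> tensor2 R d) :
  eq_rough X Y -> pi0 (X 0) = 1 -> X 0 = Y 0 ->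
  forall t : R, 0 <= t <= 1 -> X t = Y t.
Proof.
move=> XY X01 X0 t t01.
have := XY 0 t; rewrite lexx ler01 /incr -X0 => /(_ isT t01) e.
by rewrite -(tmulKV (X t) X01) e tmulKV.
Qed.

Section Stochastic.
Variables (R : realType) (disp : measure_display) (Omega : measurableType disp).
Variable P : probability Omega R.

Definition mutually_independent (I : finType) (X : I -> Omega -> R) : Prop :=
  forall A : I -> set R, (forall i, measurable (A i)) ->
    P (\bigcap_(i in [set: I]) (X i @^-1` A i)) =
    (\prod_(i : I) P (X i @^-1` A i))%E.

(* The last clause takes independence jointly over the time steps and the
   coordinates, so that the coordinates are independent processes. *)
Definition brownian_motion (d : nat) (B : R -> Omega -> 'rV[R]_d) : Prop :=
  [/\ forall (t : R) (i : 'I_d), 0 <= t <= 1 ->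
        measurable_fun [set: Omega] (fun w => B t w 0 i),
      {ae P, forall w, B 0 w = 0},
      {ae P, forall w, {within `[0, 1], continuous (B ^~ w)}},
      forall (s t : R) (i : 'I_d), 0 <= s -> s < t -> t <= 1 ->
        forall A : set R, measurable A ->
          P [set w | A (B t w 0 i - B s w 0 i)] =
          normal_prob 0 (Num.sqrt (t - s)) A
    & forall (n : nat) (u : nat -> R), 0 <= u 0%N -> u n <= 1 ->
        (forall k, (k < n)%N -> u k < u k.+1) ->
        mutually_independent (fun (ki : 'I_n * 'I_d) w =>
          B (u ki.1.+1) w 0 ki.2 - B (u ki.1) w 0 ki.2)].

(* I is a continuous version of t |-> int_0^t X o dY on [0,1], the limit in
   probability of the symmetric Riemann sums as the mesh tends to 0. *)
Definition stratonovich_integral (X Y I : R -> Omega -> R) : Prop :=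
  [/\ forall t : R, 0 <= t <= 1 -> measurable_fun [set: Omega] (I t),
      {ae P, forall w, {within `[0, 1], continuous (I ^~ w)}}
    & forall t : R, 0 <= t <= 1 -> forall e : R, 0 < e ->
        (fun s => P [set w | e <= `|stratonovich_sum (X ^~ w) (Y ^~ w) 0 t s
                                     - I t w|])
          @ fine_partitions 0 t --> 0%E].

End Stochastic.

(* Main.v *)
Require Import Defs.
From HB Require Import structures.
From mathcomp Require Import all_boot all_order all_algebra.
From mathcomp Require Import all_classical all_reals all_analysis.
From mathcomp Require Import measurable_realfun.
From mathcomp Require Import ring lra zify.

(** Fix a sample path [x] of [B] and the corresponding path [Y] of [BB], and put
    [Bs = (1, x, Y)]. The functional [F] is nonnegative. The theorem holds because,
    almost surely, [F Bs = 0] and [Bs] is admissible: minimizers are then exactly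
    the admissible zeros of [F], and a zero is determined by its limits at dyadic
    points. Indeed [F X = 0] forces each dyadic increment of the second level of
    [X] to be the limit of the second levels of [S(x^m)], and so to agree with
    that of [Bs]; the first levels agree since both lifts lie over [x]; and the
    second level of an admissible path is continuous, so that dyadic times
    suffice ([lift_functional_unique_minimizer]).

    Besides continuity and the value 0 at time 0, the argument for a single path
    uses three properties, which hold almost surely:
    - an increment over a dyadic interval of generation [m] is at most
      [C (m + 1) 2^(-m/2)] ([ae_dyadic_incr_bound]);
    - the areas spanned by the two halves of the dyadic cells of generation [m],
      summed over a dyadic interval of generation [j <= m], add up to at most
      [C (m + 1) 2^(-(m + j)/2)] ([ae_dyadic_area_bound]);
    - over a dyadic interval, the increment of [Y] is a limit point of the
      trapezoid sums of [x] along the dyadic grids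
      ([ae_stratonovich_dyadic_approx]).

    Passing from [x^m] to [x^(m+1)] changes the second level over a dyadic interval
    by one half of the sum of areas in the second property
    ([trapezoid_sum_refine]). These second levels thus form a Cauchy sequence,
    whose limit is identified by the third property, and for every [beta < 1/2]
    they approach it at the rate [C 2^(-2 beta j) rho^m] with [rho < 1]
    ([interp_area_decay]). Over dyadic intervals shorter than [2^(-m)] the
    interpolation is straight and both lifts have small increments. Altogether the
    increments of level [k] differ by at most [C theta^m 2^(-k gam j)] for some
    [gam > alpha] and [theta < 1]; the series defining the distance is then
    geometric and the distance is [O(theta^m)] ([lift_functional_enhanced_path]).

    For admissibility, chaining along dyadic points turns the same bounds into
    Hoelder continuity of exponent [beta > alpha] ([sample_path_hoelder]), and the
    integration by parts satisfied by trapezoid sums passes to the limit, so that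
    [Bs] takes values in the group ([second_level_symmetric]). An explicit polygon
    bounds the Carnot-Caratheodory norm by the sizes of the two levels
    ([cc_norm_le]); hence [Bs] is Hoelder for the metric of the group and has
    finite Sobolev energy ([hoelder_sobolev_finite]).

    The first two almost sure bounds are union bounds over the dyadic intervals
    ([ae_uniform_log_bound]), given uniformly bounded exponential moments of the
    normalised variables. For the areas these come from the exponential moment of
    a product of two independent centred normal variables, since a sum of areas
    splits into products over independent pairs of increments
    ([brownian_area_mgf]). The third property is the convergence in probability of
    the Stratonovich sums, read along the dyadic partitions. *)

Set Implicit Arguments.
Unset Strict Implicit.
Unset Printing Implicit Defensive.

Import Order.TTheory GRing.Theory Num.Theory.
Import numFieldNormedType.Exports.
Import HBNNSimple.

Local Open Scope classical_set_scope.
Local Open Scope ring_scope.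

(** * Geometric series and norms of matrices *)

Lemma geometric_nneseries_le (R : realType) (a q : R) : 0 <= a -> 0 <= q < 1 ->
  (\sum_(0 <= j <oo) (a * q ^+ j)%:E <= (a / (1 - q))%:E)%E.
Proof.
move=> a0 /andP[q0 q1]; apply: lime_le.
  by apply: is_cvg_nneseries => n _ _; rewrite lee_fin mulr_ge0// exprn_ge0.
apply: nearW => n; rewrite sumEFin lee_fin.
have := @geometric_seriesE R a q; rewrite lt_eqF// => /(_ isT).
move=> /(congr1 (fun f => f n)); rewrite /series /= => ->.
apply: ler_wpM2r; first by rewrite invr_ge0 subr_ge0 ltW.
by rewrite -[leRHS]mulr1 ler_wpM2l// gerBl exprn_ge0.
Qed.

Section matrix_norms.
Context (R : realType).

Lemma normr_coord_le (m n : nat) (A : 'M[R]_(m, n)) i j : `|A i j| <= `|A|.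
Proof.
rewrite [leRHS]/Num.norm /= mx_normrE.
by apply/bigmax_geP; right => /=; exists (i, j).
Qed.

Lemma normr_mx_le (m n : nat) (A : 'M[R]_(m, n)) (e : R) : 0 <= e ->
  (forall i j, `|A i j| <= e) -> `|A| <= e.
Proof.
move=> e0 h; rewrite [leLHS]/Num.norm /= mx_normrE.
by apply/bigmax_leP; split => // -[i j] _ /=.
Qed.

Lemma normr_tens_le (d : nat) (x y : 'rV[R]_d) : `|tens x y| <= `|x| * `|y|.
Proof.
apply: normr_mx_le => [|i j]; first by rewrite mulr_ge0.
rewrite /tens mxE big_ord1 mxE normrM.
by apply: ler_pM => //; exact: normr_coord_le.
Qed.

Lemma normr_coord_le_enorm (m n : nat) (A : 'M[R]_(m, n)) i j : `|A i j| <= enorm A.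
Proof.
rewrite /enorm -sqrtr_sqr ler_wsqrtr// (bigD1 i)//= (bigD1 j)//=.
rewrite -addrA lerDl addr_ge0//; first by apply: sumr_ge0 => k _; rewrite sqr_ge0.
by apply: sumr_ge0 => k _; apply: sumr_ge0 => l _; rewrite sqr_ge0.
Qed.

Lemma enorm_le (m n : nat) (A : 'M[R]_(m, n)) :
  enorm A <= Num.sqrt (m * n)%:R * `|A|.
Proof.
rewrite -[X in _ * X]ger0_norm// -sqrtr_sqr -sqrtrM// ler_wsqrtr//.
apply: (@le_trans _ _ (\sum_(i < m) \sum_(j < n) `|A| ^+ 2)).
  apply: ler_sum => i _; apply: ler_sum => j _.
  by rewrite -[leLHS]real_normK ?num_real// lerXn2r ?nnegrE ?normr_coord_le.
by rewrite !sumr_const !card_ord -mulrnA mulnC mulr_natl.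
Qed.

Lemma enorm_ge0 (m n : nat) (A : 'M[R]_(m, n)) : 0 <= enorm A.
Proof. exact: sqrtr_ge0. Qed.

End matrix_norms.

(** * Exponential moments of normal variables *)

Section density.
Context (d : measure_display) (T : measurableType d) (R : realType).
Variable m : {measure set T -> \bar R}.
Variable w : T -> R.
Hypothesis w0 : forall x, 0 <= w x.
Hypothesis mw : measurable_fun setT w.

Definition density_measure (A : set T) : \bar R := (\int[m]_(x in A) (w x)%:E)%E.

Let dens0 : density_measure set0 = 0%E.
Proof. by rewrite /density_measure integral_set0. Qed.

Let dens_ge0 A : (0 <= density_measure A)%E.
Proof. by apply: integral_ge0 => x _; rewrite lee_fin. Qed.

Let dens_sigma_additive : semi_sigma_additive density_measure.
Proof.
move=> A mA tA mUA; rewrite /density_measure ge0_integral_bigcup//=; last 2 first.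
- by apply/measurable_EFinP; exact: measurable_funTS.
- by move=> x _; rewrite lee_fin.
by apply: is_cvg_ereal_nneg_natsum_cond => n _ _; apply: dens_ge0.
Qed.

HB.instance Definition _ := isMeasure.Build _ _ _
  density_measure dens0 dens_ge0 dens_sigma_additive.

(** Simple functions approximate [f] from below, and both sides commute with
    monotone limits. *)
Lemma integral_density (f : T -> \bar R) : measurable_fun setT f ->
  (forall x, 0 <= f x)%E ->
  (\int[density_measure]_x f x = \int[m]_x (f x * (w x)%:E))%E.
Proof.
move=> mf f0.
pose f_ := nnsfun_approx measurableT mf.
have mwE : measurable_fun setT (EFin \o w) by exact/measurable_EFinP.
have cf x : (f_ n x)%:E @[n --> \oo] --> f x by apply: cvg_nnsfun_approx.
transitivity (limn (fun n => \int[density_measure]_x (f_ n x)%:E)%E).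
  rewrite -monotone_convergence//.
  - by apply: eq_integral => y _; apply/esym/cvg_lim.
  - by move=> n; exact/measurable_EFinP/measurable_funP.
  - by move=> n y _; rewrite lee_fin.
  - by move=> y _ n k nk; rewrite lee_fin; exact/lefP/nd_nnsfun_approx.
rewrite [X in limn X](_ : _ = (fun n => \int[m]_x ((f_ n x)%:E * (w x)%:E)))%E.
  rewrite -monotone_convergence//.
  - apply: eq_integral => y _; apply/cvg_lim => //.
    rewrite muleC; under eq_fun do rewrite muleC.
    by apply: cvgeZl.
  - move=> n; apply: emeasurable_funM => //.
    exact/measurable_EFinP/measurable_funP.
  - by move=> n y _; rewrite -EFinM lee_fin mulr_ge0.
  - move=> y _ n k nk; rewrite -!EFinM lee_fin ler_wpM2r//.
    exact/lefP/nd_nnsfun_approx.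
apply/funext => n.
transitivity (\sum_(k \in range (f_ n))
    \int[density_measure]_x (k * \1_(f_ n @^-1` [set k]) x)%:E)%E.
  under eq_integral do rewrite fimfunE -fsumEFin//.
  rewrite ge0_integral_fsum//.
  - by move=> y; exact/measurable_EFinP/measurable_funM.
  - by move=> y x _; rewrite nnfun_muleindic_ge0.
transitivity (\sum_(k \in range (f_ n))
    \int[m]_x ((k * \1_(f_ n @^-1` [set k]) x)%:E * (w x)%:E))%E.
  apply: eq_fsbigr => r; rewrite inE => -[x0 _ <-].
  set r0 := f_ n x0.
  have r00 : 0 <= r0 by [].
  rewrite integralZl_indic_nnsfun// integral_indic//= setIT.
  transitivity (\int[m]_x (r0%:E * ((\1_(f_ n @^-1` [set r0]) x)%:E * (w x)%:E)))%E;
    last by apply: eq_integral => x _; rewrite EFinM muleA.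
  rewrite ge0_integralZl_EFin//; last 2 first.
  - by move=> x _; rewrite -EFinM lee_fin mulr_ge0.
  - by apply: emeasurable_funM => //; exact/measurable_EFinP.
  congr (_ * _)%E; rewrite /density_measure [LHS]integral_mkcond.
  apply: eq_integral => x _; rewrite patchE indicE.
  by case: ifPn => _ ; rewrite ?mul1e ?mul0e.
rewrite -ge0_integral_fsum//.
- apply: eq_integral => x _; rewrite fimfunE -fsumEFin// ge0_mule_fsuml// => k.
  by rewrite EFinM nnfun_muleindic_ge0.
- move=> r; apply: emeasurable_funM => //.
  by apply/measurable_EFinP; apply: measurable_funM.
- by move=> r x _; rewrite mule_ge0// ?lee_fin// -lee_fin EFinM nnfun_muleindic_ge0.
Qed.

Lemma ex_density_measure : exists mu : {measure set T -> \bar R},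
  (forall A, mu A = \int[m]_(x in A) (w x)%:E)%E /\
  (forall f : T -> \bar R, measurable_fun setT f -> (forall x, 0 <= f x)%E ->
    \int[mu]_x f x = \int[m]_x (f x * (w x)%:E))%E.
Proof. by exists density_measure; split => //; exact: integral_density. Qed.

End density.

Section joint_law.
Context (d : measure_display) (T : measurableType d) (R : realType).
Context (d1 d2 : measure_display) (U1 : measurableType d1) (U2 : measurableType d2).
Variable m : {measure set T -> \bar R}.

(** The hypothesis on rectangles says that the image under [(X, Y)] of the measure
    of density [W] agrees on rectangles with [c] times a product of probabilities,
    and a finite measure is determined by its values there. The weight [W] allows
    independent factors to be integrated out one at a time. *)
Lemma integral_joint (W : T -> R) (X : T -> U1) (Y : T -> U2)
    (nu1 : probability U1 R) (nu2 : probability U2 R) (c : R) :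
  0 <= c -> (forall x, 0 <= W x) -> measurable_fun setT W ->
  measurable_fun setT X -> measurable_fun setT Y ->
  (forall A B, measurable A -> measurable B ->
    \int[m]_(x in X @^-1` A `&` Y @^-1` B) (W x)%:E =
    c%:E * (nu1 A * nu2 B))%E ->
  forall F : U1 * U2 -> R, measurable_fun setT F -> (forall z, 0 <= F z) ->
  (\int[m]_x (F (X x, Y x) * W x)%:E =
    c%:E * \int[nu1]_x \int[nu2]_y (F (x, y))%:E)%E.
Proof.
move=> c0 W0 mW mX mY rect F mF F0.
have [mu [muE intmu]] := @ex_density_measure _ _ _ m _ W0 mW.
pose phi x := (X x, Y x).
have mphi : measurable_fun setT phi by apply/measurable_fun_pair.
have [mu' mu'E] : exists mu' : {measure set (U1 * U2) -> \bar R},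
    (mu' : set (U1 * U2) -> \bar R) = pushforward mu phi.
  by exists (measure_function_pushforward__canonical__measure_function_Measure
    mu mphi).
have cE A B : measurable A -> measurable B ->
    mu' (A `*` B) = (mscale (NngNum c0) nu1 A * nu2 B)%E.
  by move=> mA mB; rewrite mu'E /pushforward muE /mscale/= -muleA -rect.
have mFE : measurable_fun setT (EFin \o F) by apply/measurable_EFinP.
transitivity (\int[mu]_x ((EFin \o F) \o phi) x)%E.
  rewrite intmu//=; last 2 first.
    exact: measurableT_comp mFE mphi.
    by move=> x; rewrite lee_fin.
transitivity (\int[mu']_z (EFin \o F) z)%E.
  rewrite mu'E [RHS](ge0_integral_pushforward mphi)//=.
  by move=> z _; rewrite lee_fin.
transitivity (\int[(mscale (NngNum c0) nu1) \x nu2]_z (EFin \o F) z)%E.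
  apply: eq_measure_integral => A mA _.
  apply/esym/product_measure_unique => //.
rewrite fubini_tonelli1//.
rewrite ge0_integral_mscale//=.
- by apply: measurable_fun_fubini_tonelli_F => // z; rewrite lee_fin.
- by move=> x _; apply: integral_ge0 => y _; rewrite lee_fin.
Qed.

End joint_law.

Section gaussian_exponential_moments.
Context (R : realType).
Implicit Types (s t c lam : R).

Lemma integral_normal_prob m s (f : R -> R) : measurable_fun setT f ->
  (forall x, 0 <= f x) ->
  (\int[normal_prob m s]_x (f x)%:E =
   \int[lebesgue_measure]_x (f x * normal_pdf m s x)%:E)%E.
Proof.
move=> mf f0.
have [mu [muE intmu]] := @ex_density_measure _ _ _ lebesgue_measure _
  (normal_pdf_ge0 m s) (measurable_normal_pdf m s).
transitivity (\int[mu]_x (f x)%:E)%E.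
  by apply: eq_measure_integral => A mA _; rewrite [RHS]muE.
rewrite intmu//; first exact/measurable_EFinP.
Qed.

Let integral_scaled_pdf m s c : 0 <= c ->
  (\int[lebesgue_measure]_x (c%:E * (normal_pdf m s x)%:E) = c%:E)%E.
Proof.
move=> c0; rewrite ge0_integralZl_EFin//.
- by rewrite -[RHS]mule1; congr (_ * _)%E; exact: integral_normal_pdf.
- by move=> x _; rewrite lee_fin normal_pdf_ge0.
- by apply/measurable_EFinP; exact: measurable_normal_pdf.
Qed.

(** Completing the square shifts the mean to [t s^2]. *)
Lemma normal_mgf s t : s != 0 ->
  (\int[normal_prob 0 s]_x (expR (t * x))%:E = (expR (t ^+ 2 * s ^+ 2 / 2))%:E)%E.
Proof.
move=> s0; rewrite integral_normal_prob; last 2 first.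
- by apply: measurableT_comp => //; exact: measurable_funM.
- by move=> x; exact: expR_ge0.
transitivity (\int[lebesgue_measure]_x
    ((expR (t ^+ 2 * s ^+ 2 / 2))%:E * (normal_pdf (t * s ^+ 2) s x)%:E))%E.
  apply: eq_integral => x _; rewrite -EFinM; congr _%:E.
  rewrite !normal_pdfE//= mulrCA [RHS]mulrCA; congr (_ * _).
  rewrite /normal_fun -!expRD; congr expR.
  by field.
by apply: integral_scaled_pdf; exact: expR_ge0.
Qed.

(** The exponential only changes the variance, to [s^2 / (1 - 2 c s^2)]. *)
Lemma normal_mgf_sqr s c : s != 0 -> c * s ^+ 2 < 2^-1 ->
  (\int[normal_prob 0 s]_x (expR (c * x ^+ 2))%:E =
   ((Num.sqrt (1 - 2 * c * s ^+ 2))^-1)%:E)%E.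
Proof.
move=> s0 cs; rewrite integral_normal_prob; last 2 first.
- apply: measurableT_comp => //; apply: measurable_funM => //.
- by move=> x; exact: expR_ge0.
have r0 : 0 < 1 - 2 * c * s ^+ 2 by lra.
set r := 1 - _ in r0 *.
have sr0 : 0 < Num.sqrt r by rewrite sqrtr_gt0.
have srN : Num.sqrt r != 0 by rewrite gt_eqF.
pose s' := s / Num.sqrt r.
have s'0 : s' != 0 by rewrite mulf_neq0// invr_eq0.
have s'2 : s' ^+ 2 = s ^+ 2 / r by rewrite expr_div_n sqr_sqrtr// ltW.
transitivity (\int[lebesgue_measure]_x
    (((Num.sqrt r)^-1)%:E * (normal_pdf 0 s' x)%:E))%E.
  apply: eq_integral => x _; rewrite -EFinM; congr _%:E.
  rewrite !normal_pdfE//= mulrCA [RHS]mulrA; congr (_ * _); last first.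
    rewrite /normal_fun -!expRD; congr expR; rewrite s'2 /r !subr0.
    by field; rewrite s0 /= gt_eqF.
  rewrite /normal_peak s'2.
  have -> : s ^+ 2 / r * pi *+ 2 = (s ^+ 2 * pi *+ 2) / r.
    by ring.
  rewrite sqrtrM; last by rewrite mulrn_wge0// mulr_ge0// ?sqr_ge0 ?pi_ge0.
  by rewrite sqrtrV ?ltW// invfM invrK mulrCA mulVf// mulr1.
by apply: integral_scaled_pdf; rewrite invr_ge0 ltW.
Qed.

(** Integrating out [y] leaves the exponential of a square, so that the left-hand
    side is [(1 - u)^(-1/2)] with [u = lam^2 s^4], and [exp (- 2 u) <= 1 - u] for
    [0 <= u <= 1/2]. *)
Lemma normal_mgf_prod s lam : s != 0 -> lam ^+ 2 * s ^+ 4 <= 2^-1 ->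
  (\int[normal_prob 0 s]_x \int[normal_prob 0 s]_y (expR (lam * (x * y)))%:E <=
   (expR (lam ^+ 2 * s ^+ 4))%:E)%E.
Proof.
move=> s0 ls.
have s20 : 0 < s ^+ 2 by rewrite exprn_even_gt0.
have s4E : s ^+ 4 = s ^+ 2 * s ^+ 2 by ring.
under eq_integral.
  move=> x _.
  under eq_integral do rewrite mulrA.
  rewrite normal_mgf// exprMn.
  rewrite (_ : _ / 2 = lam ^+ 2 * s ^+ 2 / 2 * x ^+ 2); last by ring.
  over.
rewrite normal_mgf_sqr//; last first.
  rewrite (_ : _ * _ = lam ^+ 2 * s ^+ 4 / 2); last by rewrite s4E; field.
  by lra.
rewrite lee_fin.
have -> : 1 - 2 * (lam ^+ 2 * s ^+ 2 / 2) * s ^+ 2 = 1 - lam ^+ 2 * s ^+ 4.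
  by rewrite s4E; field.
set u := lam ^+ 2 * s ^+ 4 in ls *.
have u0 : 0 <= u by rewrite mulr_ge0 ?exprn_even_ge0.
have h1 : 0 < 1 - u by lra.
rewrite -[leRHS]invrK lef_pV2 ?posrE ?invr_gt0 ?expR_gt0 ?sqrtr_gt0// -expRN.
rewrite -[leLHS](ger0_norm (expR_ge0 _)) -sqrtr_sqr.
rewrite ler_wsqrtr//.
have h2 := expR_ge1Dx (u + u).
have h3 := expR_gt0 (u + u).
rewrite expr2 -expRD -opprD expRN -[leRHS]mulr1.
rewrite -(ler_pM2r h3) mulVf ?gt_eqF// mulr1.
apply: (@le_trans _ _ ((1 - u) * (1 + (u + u)))); last by rewrite ler_wpM2l// ltW.
have : 0 <= u * (1 - 2 * u) by rewrite mulr_ge0//; lra.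
by rewrite mulrBr mulrCA; nra.
Qed.

End gaussian_exponential_moments.

(** * Products over independent pairs and sums of Brownian areas *)

Section independent_pairs.
Context (d : measure_display) (T : measurableType d) (R : realType).
Context (d1 d2 : measure_display) (U1 : measurableType d1) (U2 : measurableType d2).
Variables (P : probability T R) (nu1 : probability U1 R) (nu2 : probability U2 R).
Variables (K : nat) (X : nat -> T -> U1) (Y : nat -> T -> U2).
Hypothesis mX : forall k, (k < K)%N -> measurable_fun setT (X k).
Hypothesis mY : forall k, (k < K)%N -> measurable_fun setT (Y k).
Hypothesis XY_indep : forall (A : nat -> set U1) (B : nat -> set U2),
  (forall k, measurable (A k)) -> (forall k, measurable (B k)) ->
  (P (\bigcap_(k in `I_K) (X k @^-1` A k `&` Y k @^-1` B k)) =
   \prod_(0 <= k < K) (nu1 (A k) * nu2 (B k)))%E.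
Variables (F : nat -> U1 * U2 -> R) (c : nat -> R).
Hypothesis mF : forall k, measurable_fun setT (F k).
Hypothesis F0 : forall k z, 0 <= F k z.
Hypothesis Fc : forall k, (k < K)%N ->
  (\int[nu1]_x \int[nu2]_y (F k (x, y))%:E = (c k)%:E)%E.

Let c0 k : (k < K)%N -> 0 <= c k.
Proof.
move=> kK; rewrite -lee_fin -Fc//; apply: integral_ge0 => x _.
by apply: integral_ge0 => y _; rewrite lee_fin.
Qed.

(** Interpolates between the product of indicators of the independence hypothesis
    ([n = 0]) and the product whose expectation is sought ([n = K]). *)
Let G n (A : nat -> set U1) (B : nat -> set U2) w : R :=
  (\prod_(0 <= k < n) F k (X k w, Y k w)) *
  \prod_(n <= k < K) (\1_(A k) (X k w) * \1_(B k) (Y k w)).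

Let mFXY k : (k < K)%N -> measurable_fun setT (fun w => F k (X k w, Y k w)).
Proof.
move=> kK; apply: (measurableT_comp (mF k)).
by apply/measurable_fun_pair; [exact: mX|exact: mY].
Qed.

Let mind (e : measure_display) (U : measurableType e) (A : set U) (Z : T -> U) :
  measurable A -> measurable_fun setT Z ->
  measurable_fun setT (fun w => \1_A (Z w) : R).
Proof. by move=> mA mZ; apply: (measurableT_comp _ mZ); exact: measurable_indic. Qed.

(** The [n]-th pair is independent of all the others jointly, in the form that
    [integral_joint] requires: the weight is the product of all the other
    factors, and the induction hypothesis is used with the [n]-th sets varying. *)
Let G_integral n A B : (n <= K)%N ->
  (forall k, measurable (A k)) -> (forall k, measurable (B k)) ->
  (\int[P]_w (G n A B w)%:E =
   (\prod_(0 <= k < n) c k *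
    \prod_(n <= k < K) (fine (nu1 (A k)) * fine (nu2 (B k))))%:E)%E.
Proof.
elim: n A B => [|n ih] A B nK mA mB.
  rewrite big_geq// mul1r.
  transitivity (P (\bigcap_(k in `I_K) (X k @^-1` A k `&` Y k @^-1` B k))).
    rewrite -[X in P X]setIT -integral_indic//; last first.
      apply: fin_bigcap_measurable => // k kK; apply: measurableI.
        by rewrite -[X in measurable X]setTI; exact: (mX kK).
      by rewrite -[X in measurable X]setTI; exact: (mY kK).
    apply: eq_integral => w _; rewrite /G big_geq// mul1r; congr _%:E.
    rewrite indicE; case: (boolP (w \in _)) => [/set_mem wA|/negP wA].
      rewrite big_nat big1// => k kK; rewrite !indicE.
      by have [/= wAk wBk] := wA k kK; rewrite !mem_set// mulr1.
    have [k kK kw] : exists2 k, (k < K)%N & ~ (A k (X k w) /\ B k (Y k w)).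
      apply: contrapT => h; apply: wA; apply/mem_set => k /= kK.
      by apply: contrapT => h'; apply: h; exists k.
    apply/eqP; rewrite big_mkord; apply/prodf_eq0.
    exists (Ordinal kK) => //=; rewrite !indicE.
    case: (boolP (_ \in A k)) => [/set_mem hA|]; last by rewrite mul0r.
    case: (boolP (_ \in B k)) => [/set_mem hB|]; last by rewrite mulr0.
    by exfalso; apply: kw.
  rewrite XY_indep// -prodEFin; apply: eq_bigr => k _.
  by rewrite EFinM !fineK ?fin_num_measure.
set W := fun w => (\prod_(0 <= k < n) F k (X k w, Y k w)) *
  \prod_(n.+1 <= k < K) (\1_(A k) (X k w) * \1_(B k) (Y k w)).
have W0 w : 0 <= W w.
  by rewrite mulr_ge0// prodr_ge0// => k _; rewrite mulr_ge0.
have mW : measurable_fun setT W.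
  apply: measurable_funM.
    apply: measurable_prod => k; rewrite mem_index_iota => /andP[_ kn].
    by apply: mFXY; exact: ltn_trans kn nK.
  apply: measurable_prod => k; rewrite mem_index_iota => /andP[_ kn].
  by apply: measurable_funM; apply: mind => //; [exact: mX|exact: mY].
pose cc := \prod_(0 <= k < n) c k *
    \prod_(n.+1 <= k < K) (fine (nu1 (A k)) * fine (nu2 (B k))).
have cc0 : 0 <= cc.
  rewrite mulr_ge0//.
    rewrite big_nat; apply: prodr_ge0 => k /andP[_ kn].
    by apply: c0; exact: ltn_trans kn nK.
  by apply: prodr_ge0 => k _; rewrite mulr_ge0// fine_ge0.
have key A' B' : measurable A' -> measurable B' ->
    (\int[P]_(x in X n @^-1` A' `&` Y n @^-1` B') (W x)%:E =
     cc%:E * (nu1 A' * nu2 B'))%E.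
  move=> mA' mB'.
  pose upd U (S : nat -> set U) S' k := if k == n then S' else S k.
  have updE U (S : nat -> set U) S' k : (n < k)%N -> upd U S S' k = S k.
    by move=> nk; rewrite /upd gtn_eqF.
  have mupd e (U : measurableType e) (S : nat -> set U) S' :
      (forall k, measurable (S k)) -> measurable S' ->
      forall k, measurable (upd U S S' k).
    by move=> mS mS' k; rewrite /upd; case: ifP.
  have mem_pre U (Z : T -> U) S w : (w \in Z @^-1` S) = (Z w \in S).
    by apply/idP/idP; rewrite !inE.
  transitivity (\int[P]_w (G n (upd _ A A') (upd _ B B') w)%:E)%E.
    rewrite integral_mkcond; apply: eq_integral => w _.
    rewrite patchE /G (big_ltn nK) /W.
    rewrite [in RHS](_ : \prod_(n.+1 <= k < K) _ =
      \prod_(n.+1 <= k < K) (\1_(A k) (X k w) * \1_(B k) (Y k w))); last first.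
      by apply: eq_big_nat => k /andP[nk _]; rewrite !updE.
    rewrite /upd eqxx !indicE in_setI.
    rewrite !mem_pre.
    by case: (_ \in _); case: (_ \in _); rewrite /= ?(mul0r, mul1r, mulr0).
  rewrite ih//; last 3 first.
  - exact: ltnW.
  - exact: mupd.
  - exact: mupd.
  rewrite (big_ltn nK) {1 2}/upd eqxx /cc.
  rewrite (_ : \prod_(n.+1 <= k < K) _ =
      \prod_(n.+1 <= k < K) (fine (nu1 (A k)) * fine (nu2 (B k)))); last first.
    by apply: eq_big_nat => k /andP[nk _]; rewrite !updE.
  rewrite mulrCA mulrC EFinM; congr (_ * _)%E.
  by rewrite EFinM !fineK ?fin_num_measure.
have := integral_joint cc0 W0 mW (mX nK) (mY nK) key (@mF n) (@F0 n).
rewrite Fc// => GE.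
transitivity (\int[P]_x (F n (X n x, Y n x) * W x)%:E)%E.
  apply: eq_integral => w _; congr _%:E.
  by rewrite /G /W big_nat_recr//= mulrCA !mulrA.
rewrite GE big_nat_recr//= /cc -EFinM; congr _%:E; ring.
Qed.

Lemma expectation_prod_pairs :
  (\int[P]_w (\prod_(0 <= k < K) F k (X k w, Y k w))%:E =
   (\prod_(0 <= k < K) c k)%:E)%E.
Proof.
have := @G_integral K (fun=> setT) (fun=> setT) (leqnn _)
  (fun=> measurableT) (fun=> measurableT).
rewrite (big_geq (leqnn K)) mulr1 => <-; apply: eq_integral => w _.
by rewrite /G (big_geq (leqnn K)) mulr1.
Qed.

End independent_pairs.

Section brownian_area.
Context (R : realType) (disp : measure_display) (T : measurableType disp).
Variables (P : probability T R) (d : nat) (B : R -> T -> 'rV[R]_d).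
Hypothesis hB : brownian_motion P B.

Lemma brownian_increment_law (s t : R) (i : 'I_d) : 0 <= s -> s < t -> t <= 1 ->
  forall A : set R, measurable A ->
    P ((fun w => B t w 0 i - B s w 0 i) @^-1` A) = normal_prob 0 (Num.sqrt (t - s)) A.
Proof. by case: hB => _ _ _ h _; exact: h. Qed.

Lemma measurable_brownian (t : R) (i : 'I_d) : 0 <= t <= 1 ->
  measurable_fun setT (fun w => B t w 0 i).
Proof. by case: hB => h _ _ _ _; exact: h. Qed.

(** The area of a pair of consecutive steps multiplies an increment in one
    coordinate over one step by an increment in the other coordinate over the
    other step of the pair; [partner] exchanges the two steps. *)
Definition partner (k : nat) : nat := if odd k then k.-1 else k.+1.

Lemma partnerK : involutive partner.
Proof.
move=> k; rewrite /partner; case: (boolP (odd k)) => ok /=; last by rewrite (negbTE ok).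
by case: k ok => [//|k] /= /negbTE ->.
Qed.

Lemma partner_lt N k : (k < N.*2)%N -> (partner k < N.*2)%N.
Proof.
rewrite /partner; case: ifPn => ok; first by move=> h; apply: leq_ltn_trans h; exact: leq_pred.
move=> h; rewrite ltn_neqAle h andbT; apply/eqP => e.
by move: ok; rewrite -[odd k]negbK -/(odd k.+1) e odd_double.
Qed.

Variables (N : nat) (u : nat -> R) (h : R) (a b : 'I_d).
Hypotheses (h0 : 0 < h) (u0 : 0 <= u 0%N) (uN : u N.*2 <= 1).
Hypothesis uS : forall k, u k.+1 - u k = h.
Hypothesis ab : a != b.

Let inc k (i : 'I_d) w := B (u k.+1) w 0 i - B (u k) w 0 i.

Let u_homo : {homo u : j k / (j <= k)%N >-> j <= k}.
Proof.
apply: homo_leq => // [x y z|k]; first exact: le_trans.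
by rewrite -subr_ge0 uS ltW.
Qed.

Let u01 k : (k <= N.*2)%N -> 0 <= u k <= 1.
Proof.
by move=> kN; rewrite (le_trans u0 (u_homo (leq0n k))) (le_trans (u_homo kN) uN).
Qed.

Let m_inc k i : (k < N.*2)%N -> measurable_fun setT (inc k i).
Proof.
move=> kN; apply: measurable_funB; apply: measurable_brownian; apply: u01 => //.
exact: ltnW.
Qed.

Let nu : probability (measurableTypeR R) R := normal_prob 0 (Num.sqrt h).

Let inc_law k i (A : set R) : (k < N.*2)%N -> measurable A ->
  P (inc k i @^-1` A) = nu A.
Proof.
move=> kN mA; rewrite /nu -(uS k).
have /andP[uk0 _] := u01 (ltnW kN).
have /andP[_ uk1] := u01 kN.
have uk : u k < u k.+1 by rewrite -subr_gt0 uS.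
exact: (brownian_increment_law i uk0 uk uk1 mA).
Qed.

Let indep (A C : nat -> set R) :
  (forall k, measurable (A k)) -> (forall k, measurable (C k)) ->
  (P (\bigcap_(k in `I_N.*2) (inc k a @^-1` A k `&` inc (partner k) b @^-1` C k)) =
   \prod_(0 <= k < N.*2) (nu (A k) * nu (C k)))%E.
Proof.
move=> mA mC.
pose S (ki : 'I_N.*2 * 'I_d) : set R :=
  if ki.2 == a then A ki.1 else if ki.2 == b then C (partner ki.1) else setT.
have mS ki : measurable (S ki) by rewrite /S; case: ifP => // _; case: ifP.
case: hB => _ _ _ _ ind.
have u_lt k : (k < N.*2)%N -> u k < u k.+1 by rewrite -subr_gt0 uS.
have := ind N.*2 u u0 uN u_lt S mS.
have -> : \bigcap_(ki in [set: 'I_N.*2 * 'I_d])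
    (fun w => B (u ki.1.+1) w 0 ki.2 - B (u ki.1) w 0 ki.2) @^-1` S ki =
  \bigcap_(k in `I_N.*2) (inc k a @^-1` A k `&` inc (partner k) b @^-1` C k).
  apply/seteqP; split => w /= hw.
    move=> k /= kN; split.
      by have := hw (Ordinal kN, a) I; rewrite /S /= eqxx.
    have := hw (Ordinal (partner_lt kN), b) I; rewrite /S /= eq_sym (negbTE ab) eqxx.
    by rewrite partnerK.
  move=> [k i] _ /=; rewrite /S /=; case: ifPn => [/eqP->|_].
    by have [] := hw k (ltn_ord k).
  case: ifPn => // /eqP ->.
  by have [_] := hw _ (partner_lt (ltn_ord k)); rewrite partnerK.
move=> ->.
rewrite -(pair_bigA _ (fun (k : 'I_N.*2) (i : 'I_d) => P (inc k i @^-1` S (k, i))))/=.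
transitivity (\prod_(k < N.*2) (nu (A k) * nu (C (partner k))))%E.
  apply: eq_bigr => k _.
  rewrite (bigD1 a)//= (bigD1 b)/=; last by rewrite eq_sym.
  rewrite big1 ?mule1 => [|i /andP[ia ib]]; last first.
    by rewrite /S/= (negbTE ia) (negbTE ib) preimage_setT probability_setT.
  by rewrite /S/= eqxx eq_sym (negbTE ab) eqxx !inc_law.
rewrite big_mkord !big_split/=; congr (_ * _)%E.
pose sig (k : 'I_N.*2) := Ordinal (partner_lt (ltn_ord k)).
have sigK : involutive sig by move=> k; apply: val_inj; rewrite /= partnerK.
by rewrite (reindex_inj (inv_inj sigK))/=; apply: eq_bigr => k _; rewrite partnerK.
Qed.

Let sum_pairs (f : nat -> R) :
  \sum_(0 <= k < N.*2) f k = \sum_(0 <= l < N) (f l.*2 + f l.*2.+1).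
Proof.
by elim: N => [|n ih]; rewrite ?doubleS ?big_nil// !big_nat_recr//= ih addrA.
Qed.

(** The sum of areas is a signed sum over all steps [k] of the products of the
    [a]-increment over [k] and the [b]-increment over [partner k]. These pairs are
    independent and so are the two members of each, whence the expectation is a
    product of integrals bounded by [normal_mgf_prod]. *)
Lemma brownian_area_mgf (lam : R) : lam ^+ 2 * h ^+ 2 <= 2^-1 ->
  (\int[P]_w (expR (lam * \sum_(0 <= l < N)
      (inc l.*2 a w * inc l.*2.+1 b w - inc l.*2.+1 a w * inc l.*2 b w)))%:E
   <= (expR (lam ^+ 2 * h ^+ 2) ^+ N.*2)%:E)%E.
Proof.
move=> lamh.
have s0 : Num.sqrt h != 0 by rewrite gt_eqF// sqrtr_gt0.
have s4 : Num.sqrt h ^+ 4 = h ^+ 2.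
  by rewrite (_ : 4 = 2 * 2)%N// exprM sqr_sqrtr// ltW.
pose F k (z : R * R) : R := expR (lam * (-1) ^+ k * (z.1 * z.2)).
have mF k : measurable_fun setT (F k).
  apply: measurableT_comp => //; apply: measurable_funM => //.
  exact: measurable_funM.
have F0 k z : 0 <= F k z by exact: expR_ge0.
have Fle k : (\int[nu]_x \int[nu]_y (F k (x, y))%:E <=
    (expR (lam ^+ 2 * h ^+ 2))%:E)%E.
  apply: le_trans (normal_mgf_prod _ _) _ => //.
    by rewrite s4 exprMn sqrr_sign mulr1.
  by rewrite s4 exprMn sqrr_sign mulr1.
have Fge k : (0 <= \int[nu]_x \int[nu]_y (F k (x, y))%:E)%E.
  by apply: integral_ge0 => x _; apply: integral_ge0 => y _; rewrite lee_fin.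
have Ffin k : (\int[nu]_x \int[nu]_y (F k (x, y))%:E)%E \is a fin_num.
  by rewrite ge0_fin_numE//; apply: le_lt_trans (Fle k) (ltry _).
have mY k : (k < N.*2)%N -> measurable_fun setT (inc (partner k) b).
  by move=> kN; apply: m_inc; exact: partner_lt.
have Fc k : (k < N.*2)%N -> (\int[nu]_x \int[nu]_y (F k (x, y))%:E =
    (fine (\int[nu]_x \int[nu]_y (F k (x, y))%:E))%:E)%E.
  by move=> _; rewrite fineK.
have E := @expectation_prod_pairs _ T R _ _ (measurableTypeR R) (measurableTypeR R)
  P nu nu N.*2 (inc ^~ a) (fun k => inc (partner k) b) (fun k => @m_inc k a) mY
  indep F _ mF F0 Fc.
apply: le_trans (_ : _ <= (\prod_(0 <= k < N.*2)
    fine (\int[nu]_x \int[nu]_y (F k (x, y))%:E))%:E)%E _.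
  rewrite -E le_eqVlt; apply/orP; left; apply/eqP; apply: eq_integral => w _.
  rewrite /F -expR_sum; congr (expR _)%:E.
  rewrite mulr_sumr sum_pairs; apply: eq_bigr => l _.
  rewrite -signr_odd -[(-1) ^+ l.*2.+1]signr_odd /partner /= odd_double /= expr1 expr0.
  ring.
have -> : expR (lam ^+ 2 * h ^+ 2) ^+ N.*2 =
    \prod_(0 <= k < N.*2) expR (lam ^+ 2 * h ^+ 2).
  by rewrite prodr_const_nat subn0.
rewrite lee_fin.
apply: ler_prod => k _; rewrite fine_ge0//=.
by rewrite -lee_fin fineK.
Qed.

End brownian_area.

(** * Almost sure bounds on the dyadic grid *)

(** Weighting the exponentials of generation [m] by [8^(-m)] makes their total
    expectation finite, as there are at most [C0 4^m] of them. Hence almost surely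
    the weighted sum is finite, so that each exponential is at most a random
    constant times [8^m]; the logarithm of this bound is linear in [m]. *)
Lemma ae_uniform_log_bound (d : measure_display) (T : measurableType d)
    (R : realType) (P : probability T R) (J : nat -> finType)
    (Q : forall m, J m -> T -> R) (C0 c : R) :
  0 <= C0 -> 0 <= c ->
  (forall m, (#|J m|%:R <= C0 * 4 ^+ m :> R)) ->
  (forall m i, measurable_fun setT (@Q m i)) ->
  (forall m i, (\int[P]_w (expR (Q m i w))%:E <= c%:E)%E) ->
  (forall m i, (\int[P]_w (expR (- Q m i w))%:E <= c%:E)%E) ->
  {ae P, forall w, exists2 C : R, 0 <= C &
    forall m (i : J m), `|Q m i w| <= C * m.+1%:R}.
Proof.
move=> C00 c0 cardJ mQ Q1 Q2.
pose f m w : R := 8^-1 ^+ m * \sum_(i : J m) (expR (Q m i w) + expR (- Q m i w)).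
have f0 m w : 0 <= f m w.
  by rewrite mulr_ge0// sumr_ge0// => i _; rewrite addr_ge0// expR_ge0.
have mexp m i : measurable_fun setT (fun w => expR (Q m i w)).
  exact: measurableT_comp.
have mexpN m i : measurable_fun setT (fun w => expR (- Q m i w)).
  by apply: measurableT_comp => //; exact: measurableT_comp.
have mf m : measurable_fun setT (f m).
  apply: measurable_funM => //; apply: measurable_sum => i.
  exact: measurable_funD.
have intf m : (\int[P]_w (f m w)%:E <= (C0 * (c + c) * 2^-1 ^+ m)%:E)%E.
  rewrite /f; under eq_integral do rewrite EFinM -sumEFin.
  rewrite ge0_integralZl_EFin//; last 2 first.
  - by move=> w _; rewrite sume_ge0// => i _; rewrite lee_fin addr_ge0// expR_ge0.
  - by apply: emeasurable_sum => i; apply/measurable_EFinP; exact: measurable_funD.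
  rewrite ge0_integral_sum//; last first.
    by move=> i; apply/measurable_EFinP; exact: measurable_funD.
  apply: (@le_trans _ _ ((8^-1 ^+ m)%:E * \sum_(i : J m) (c + c)%:E)%E).
    rewrite lee_wpmul2l ?lee_fin//; apply: lee_sum => i _.
    under eq_integral do rewrite EFinD.
    rewrite ge0_integralD//; [|exact/measurable_EFinP|exact/measurable_EFinP].
    by rewrite EFinD leeD.
  rewrite sumEFin -EFinM lee_fin.
  have -> : \sum_(i : J m) (c + c) = #|J m|%:R * (c + c).
    by rewrite sumr_const mulr_natl.
  have -> : (2^-1 : R) ^+ m = 8^-1 ^+ m * 4 ^+ m.
    by rewrite -exprMn; congr (_ ^+ _); lra.
  rewrite [leRHS]mulrCA; apply: ler_wpM2l => //.
  by rewrite mulrAC ler_wpM2r ?addr_ge0.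
pose S w := (\sum_(0 <= m <oo) (f m w)%:E)%E.
have mfE m : measurable_fun setT (fun w => (f m w)%:E) by exact/measurable_EFinP.
have S0 w : (0 <= S w)%E by apply: nneseries_ge0 => m _ _; rewrite lee_fin.
have intS : (\int[P]_w S w < +oo)%E.
  rewrite /S integral_nneseries//; last by move=> m w _; rewrite lee_fin.
  apply: le_lt_trans (ltry (C0 * (c + c) / (1 - 2^-1))).
  apply: le_trans (geometric_nneseries_le _ _); last 2 first.
  - by rewrite mulr_ge0// addr_ge0.
  - by lra.
  apply: lee_nneseries => m _; last exact: intf.
  by move=> _; apply: integral_ge0 => w _; rewrite lee_fin.
have Sint : P.-integrable setT S.
  apply/integrableP; split; first by apply: ge0_emeasurable_sum => // m w _ _; rewrite lee_fin.
  by under eq_integral do rewrite gee0_abs//.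
apply: filterS (integrable_ae measurableT Sint) => w /(_ I) Sfin.
pose C := fine (S w).
have C0' : 0 <= C by rewrite fine_ge0.
pose L := ln (C + 1) + ln 8.
have ln8 : 0 <= ln (8 : R) by rewrite ln_ge0//; lra.
have lnC : 0 <= ln (C + 1) by rewrite ln_ge0// lerDr.
exists L; first by rewrite addr_ge0.
move=> m i.
have fC : f m w <= C.
  rewrite -lee_fin /C fineK//.
  apply: le_trans (nneseries_lim_ge m.+1 _); last by move=> k _ _; rewrite lee_fin.
  rewrite big_nat_recr//= leeDr// sume_ge0// => k _; exact: f0.
have exp_le x : expR x <= expR (Q m i w) + expR (- Q m i w) ->
    x <= L * m.+1%:R.
  move=> xQ.
  have h : expR x <= 8 ^+ m * (C + 1).
    apply: le_trans xQ _.
    apply: (@le_trans _ _ (8 ^+ m * C)); last by rewrite ler_wpM2l ?exprn_ge0// lerDl.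
    rewrite -ler_pdivrMl ?exprn_gt0// -exprVn; apply: le_trans fC.
    rewrite /f; apply: ler_wpM2l; first by rewrite exprn_ge0.
    rewrite (bigD1 i)//= lerDl; apply: sumr_ge0 => k _.
    by rewrite addr_ge0 ?expR_ge0.
  rewrite -[x]expRK; apply: (@le_trans _ _ (ln (8 ^+ m * (C + 1)))).
    by rewrite ler_ln ?posrE ?expR_gt0// mulr_gt0 ?exprn_gt0// ltr_wpDl.
  rewrite lnM ?posrE ?exprn_gt0 ?ltr_wpDl// lnXn//.
  rewrite /L -[_ *+ m]mulr_natr -[m.+1%:R]natr1.
  have : 0 <= m%:R :> R by [].
  move=> m0; have := mulr_ge0 m0 lnC; nra.
rewrite ler_norml; apply/andP; split.
  by rewrite lerNl exp_le// lerDr expR_ge0.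
by rewrite exp_le// lerDl expR_ge0.
Qed.

Section brownian_dyadic_bounds.
Context (R : realType) (disp : measure_display) (T : measurableType disp).
Variables (P : probability T R) (d : nat) (B : R -> T -> 'rV[R]_d).
Hypothesis hB : brownian_motion P B.

Definition dyadic_incr (x : R -> 'rV[R]_d) (m k : nat) (a : 'I_d) : R :=
  x (k.+1%:R / 2 ^+ m) 0 a - x (k%:R / 2 ^+ m) 0 a.

Let dyadic01 m k : (k <= 2 ^ m)%N -> 0 <= (k%:R / 2 ^+ m : R) <= 1.
Proof.
move=> km; rewrite divr_ge0//= ler_pdivrMr ?exprn_gt0// mul1r -natrX ler_nat.
exact: km.
Qed.

Let measurable_dyadic_incr m k a : (k < 2 ^ m)%N ->
  measurable_fun setT (fun w => dyadic_incr (B ^~ w) m k a).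
Proof.
move=> km; apply: measurable_funB; apply: (measurable_brownian hB); apply: dyadic01 => //.
exact: ltnW.
Qed.

(** The normalised increments are standard normal. *)
Lemma ae_dyadic_incr_bound : {ae P, forall w, exists2 C : R, 0 <= C &
  forall m k a, (k < 2 ^ m)%N ->
    `|dyadic_incr (B ^~ w) m k a| <= C * m.+1%:R * Num.sqrt (2^-1 ^+ m)}.
Proof.
pose J (m : nat) : finType := ('I_(2 ^ m) * 'I_d)%type.
pose s m : R := Num.sqrt (2^-1 ^+ m).
have s0 m : 0 < s m by rewrite sqrtr_gt0 exprn_gt0.
have s2 m : s m ^+ 2 = 2^-1 ^+ m by rewrite sqr_sqrtr// exprn_ge0.
pose Q m (ka : J m) w := (s m)^-1 * dyadic_incr (B ^~ w) m ka.1 ka.2.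
have mQ m ka : measurable_fun setT (@Q m ka).
  by apply: measurable_funM => //; exact: measurable_dyadic_incr.
have expQ (t : R) m ka : t ^+ 2 = 1 ->
    (\int[P]_w (expR (t * @Q m ka w))%:E <= (expR 1)%:E)%E.
  move=> t1; case: ka => k a; rewrite /Q /=.
  have mX := @measurable_dyadic_incr m k a (ltn_ord k).
  pose X w := dyadic_incr (B ^~ w) m k a.
  have kS : (k.+1%:R / 2 ^+ m - k%:R / 2 ^+ m = 2^-1 ^+ m :> R).
    by rewrite -mulrBl -natrB// subSnn mul1r exprVn.
  have kS0 : (k%:R / 2 ^+ m < k.+1%:R / 2 ^+ m :> R).
    by rewrite -subr_gt0 kS exprn_gt0.
  have [/andP[k0 _] /andP[_ k1]] := (dyadic01 (ltnW (ltn_ord k)), dyadic01 (ltn_ord k)).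
  under eq_integral do rewrite mulrA.
  pose f (x : measurableTypeR R) := (expR (t / s m * x))%:E.
  have mf : measurable_fun setT f.
    by apply/measurable_EFinP; apply: measurableT_comp => //; exact: measurable_funM.
  have := @ge0_integral_pushforward _ _ _ (measurableTypeR R) R X mX P setT f
    measurableT mf (fun x _ => expR_ge0 _).
  rewrite preimage_setT => <-.
  rewrite (@eq_measure_integral _ _ _ setT (normal_prob 0 (s m))); last first.
    move=> A mA _; have := brownian_increment_law hB a k0 kS0 k1 mA.
    by rewrite kS.
  rewrite normal_mgf ?gt_eqF// lee_fin ler_expR exprMn t1 mul1r exprVn.
  by rewrite mulVf ?expf_neq0 ?gt_eqF//; lra.
have Qbound : {ae P, forall w, exists2 C : R, 0 <= C &
    forall m (q : J m), `|Q m q w| <= C * m.+1%:R}.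
  apply: (@ae_uniform_log_bound _ _ _ P J Q d%:R (expR 1)) => //.
  - move=> m; rewrite card_prod !card_ord natrM mulrC; apply: ler_wpM2l => //.
    by rewrite -natrX ler_nat (_ : 4 = 2 * 2)%N// expnMn leq_pmulr ?expn_gt0.
  - by move=> m q; under eq_integral do rewrite -[Q _ _ _]mul1r; rewrite expQ// expr1n.
  - by move=> m q; under eq_integral do rewrite -mulN1r; rewrite expQ// sqrrN expr1n.
apply: filterS Qbound => w [C C0 CQ]; exists C => // m k a km.
have := CQ m (Ordinal km, a); rewrite /Q/= normrM gtr0_norm ?invr_gt0//.
by rewrite ler_pdivrMl// [leRHS]mulrC.
Qed.

(** The signed area of the parallelogram spanned by the two halves of the [l]-th
    dyadic cell of generation [m]. *)
Definition cell_area (x : R -> 'rV[R]_d) (m l : nat) (a b : 'I_d) : R :=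
  dyadic_incr x m.+1 l.*2 a * dyadic_incr x m.+1 l.*2.+1 b -
  dyadic_incr x m.+1 l.*2.+1 a * dyadic_incr x m.+1 l.*2 b.

(** Over an interval of generation [j] there are [2^(m - j)] areas, each a sum of
    two products of independent increments of variance [2^(-m - 1)], so the sum has
    the order of magnitude [2^(-m) 2^((m - j)/2) = 2^(-(m + j)/2)]. *)
Lemma ae_dyadic_area_bound : {ae P, forall w, exists2 C : R, 0 <= C &
  forall m j i a b, (j <= m)%N -> (i < 2 ^ j)%N ->
    `|\sum_(i * 2 ^ (m - j) <= l < i.+1 * 2 ^ (m - j))
        cell_area (B ^~ w) m l a b| <= C * m.+1%:R * Num.sqrt (2^-1 ^+ (m + j))}.
Proof.
pose J (m : nat) : finType := ('I_m.+1 * 'I_(2 ^ m) * 'I_d * 'I_d)%type.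
pose S m j i a b w := \sum_(i * 2 ^ (m - j) <= l < i.+1 * 2 ^ (m - j))
  cell_area (B ^~ w) m l a b.
pose N m j := (2 ^ (m - j))%N.
pose h m : R := 2^-1 ^+ m.+1.
pose s m j : R := h m * Num.sqrt (N m j).*2%:R.
have N0 m j : (0 < (N m j).*2)%N by rewrite double_gt0 expn_gt0.
have h0 m : 0 < h m by rewrite exprn_gt0.
have s0 m j : 0 < s m j by rewrite mulr_gt0// sqrtr_gt0 ltr0n.
have sle m j : (j <= m)%N -> s m j <= Num.sqrt (2^-1 ^+ (m + j)).
  move=> jm; rewrite -[leLHS](ger0_norm (ltW (s0 _ _))) -sqrtr_sqr ler_wsqrtr//.
  rewrite exprMn sqr_sqrtr// /h -muln2 natrM natrX /N.
  have xy : 2 ^+ (m - j) * 2^-1 ^+ (m - j) = 1 :> R.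
    by rewrite -exprMn divff// expr1n.
  rewrite -{1 3}(subnK jm); move: (m - j)%N xy => k.
  rewrite -addnA -[(k + j).+1]addnS !exprD [2^-1 ^+ j.+1]exprS.
  set x := 2 ^+ k; set y := 2^-1 ^+ k; set z := 2^-1 ^+ j => xy.
  have -> : (y * (2^-1 * z)) ^+ 2 * (x * 2) = (x * y) * (y * z ^+ 2 / 2) by field.
  rewrite xy mul1r.
  have -> : y * (z * z) = y * z ^+ 2 by ring.
  by apply: ler_piMr; [rewrite mulr_ge0 ?sqr_ge0 ?exprn_ge0|lra].
(* Indices outside the range, or with equal coordinates, get the value 0, so that
   the index set is a plain product of cardinal at most [d^2 4^m]. *)
pose good j i (a b : 'I_d) := (i < 2 ^ j)%N && (a != b).
pose Q m (q : J m) w : R := let: (j, i, a, b) := q in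
  if good j i a b then (s m j)^-1 * S m j i a b w else 0.
have Sshift m j i a b w : S m j i a b w = \sum_(0 <= l < N m j)
    cell_area (B ^~ w) m (i * N m j + l) a b.
  rewrite /S -/(N m j) -{1}[(i * _)%N]add0n big_addn mulSn addnK.
  by apply: eq_bigr => l _; rewrite addnC.
have Nle m j i l : (j <= m)%N -> (i < 2 ^ j)%N -> (l <= (N m j).*2)%N ->
    ((i * N m j).*2 + l <= 2 ^ m.+1)%N.
  move=> jm ij lN; apply: (@leq_trans ((i * N m j).*2 + (N m j).*2)%N).
    by rewrite leq_add2l.
  rewrite -doubleD addnC -mulSn expnS -mul2n leq_mul2l /=.
  have -> : (2 ^ m = 2 ^ j * N m j)%N by rewrite /N -expnD subnKC.
  by rewrite leq_mul2r ij orbT.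
have mS m j i a b : (j <= m)%N -> (i < 2 ^ j)%N -> measurable_fun setT (S m j i a b).
  move=> jm ij.
  have mlt l c : (l < (N m j).*2)%N -> measurable_fun setT
      (fun w => dyadic_incr (B ^~ w) m.+1 ((i * N m j).*2 + l) c).
    by move=> lN; apply: measurable_dyadic_incr; rewrite -addnS; exact: Nle.
  rewrite (_ : S m j i a b = fun w => \sum_(l < N m j)
     cell_area (B ^~ w) m (i * N m j + l) a b); last first.
    by apply/funext => w; rewrite Sshift big_mkord.
  apply: measurable_sum => l.
  rewrite /cell_area !doubleD -!addnS.
  by apply: measurable_funB; apply: measurable_funM; apply: mlt;
    rewrite ?ltn_Sdouble ?ltn_double.
have mQ m q : measurable_fun setT (@Q m q).
  case: q => [[[j i] a] b]; rewrite /Q /=.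
  rewrite (_ : good j i a b = (i < 2 ^ j)%N && (a != b))//.
  have [/andP[ij _]|_] := boolP (_ && _); last exact: measurable_cst.
  by apply: measurable_funM => //; apply: mS => //; rewrite -ltnS.
have expQ (t : R) m q : t ^+ 2 = 1 ->
    (\int[P]_w (expR (t * @Q m q w))%:E <= (expR 1)%:E)%E.
  move=> t1; case: q => [[[j i] a] b]; rewrite /Q /=.
  rewrite (_ : good j i a b = (i < 2 ^ j)%N && (a != b))//.
  have [/andP[ij ab]|_] := boolP (_ && _); last first.
    under eq_integral do rewrite mulr0 expR0.
    rewrite integral_cst//= probability_setT mule1 lee_fin.
    by rewrite -[leLHS]expR0 ler_expR.
  have jm : (j <= m)%N by rewrite -ltnS.
  pose u k : R := ((i * N m j).*2 + k)%:R / 2 ^+ m.+1.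
  have uS k : u k.+1 - u k = h m.
    by rewrite /u -mulrBl -natrB ?leq_add2l// addnS subSnn mul1r /h exprVn.
  have u0 : 0 <= u 0%N by rewrite divr_ge0.
  have u1 : u (N m j).*2 <= 1.
    by have /andP[_] := dyadic01 (Nle m j i _ jm ij (leqnn _)).
  pose lam := t / s m j.
  have lamh : lam ^+ 2 * h m ^+ 2 = (N m j).*2%:R^-1.
    have s2 : s m j ^+ 2 = h m ^+ 2 * (N m j).*2%:R by rewrite exprMn sqr_sqrtr.
    rewrite /lam exprMn t1 mul1r exprVn s2 invfM mulrAC mulVf ?mul1r//.
    by rewrite expf_neq0// gt_eqF.
  have := @brownian_area_mgf _ _ _ P d B hB (N m j) u (h m) a b (h0 m) u0 u1 uS ab lam.
  rewrite lamh lef_pV2 ?posrE ?ltr0n// ler_nat -[in (2 <= _)%N]/(1.*2)%N leq_double.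
  rewrite expn_gt0 /= => /(_ isT) H.
  apply: le_trans (le_trans _ H) _; last first.
    rewrite lee_fin -expRM_natl divff// pnatr_eq0 -lt0n; exact: N0.
  rewrite le_eqVlt; apply/orP; left; apply/eqP; apply: eq_integral => w _.
  rewrite mulrA -/lam Sshift; congr (expR (_ * _))%:E; apply: eq_bigr => l _.
  by rewrite /cell_area /dyadic_incr /u doubleD !addnS.
have Qbound : {ae P, forall w, exists2 C : R, 0 <= C &
    forall m (q : J m), `|Q m q w| <= C * m.+1%:R}.
  apply: (@ae_uniform_log_bound _ _ _ P J Q (d ^ 2)%:R (expR 1)) => //.
  - move=> m; rewrite !card_prod !card_ord -natrX -natrM ler_nat.
    rewrite -mulnA mulnC mulnn leq_mul2l; apply/orP; right.
    rewrite (_ : 4 = 2 * 2)%N// expnMn leq_mul2r; apply/orP; right.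
    exact: ltn_expl.
  - by move=> m q; under eq_integral do rewrite -[Q _ _ _]mul1r; rewrite expQ// expr1n.
  - by move=> m q; under eq_integral do rewrite -mulN1r; rewrite expQ// sqrrN expr1n.
apply: filterS Qbound => w [C C0 CQ]; exists C => // m j i a b jm ij.
rewrite -/(S m j i a b w).
have C1 : 0 <= C * m.+1%:R by rewrite mulr_ge0.
have [->|ab] := eqVneq a b.
  rewrite /S big1 ?normr0 => [|l _]; first by rewrite mulr_ge0// sqrtr_ge0.
  by rewrite /cell_area mulrC subrr.
have jm' : (j < m.+1)%N by [].
have im : (i < 2 ^ m)%N by apply: leq_trans ij _; rewrite leq_pexp2l.
have := CQ m (Ordinal jm', Ordinal im, a, b); rewrite /Q/= /good ij ab/=.
rewrite normrM gtr0_norm ?invr_gt0// ler_pdivrMl// [leRHS]mulrC => /le_trans; apply.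
by apply: ler_wpM2l => //; exact: sle.
Qed.

End brownian_dyadic_bounds.

(** * Hoelder paths have finite Sobolev energy *)

Lemma powR_expn (R : realType) (a g : R) n : 0 <= a -> (a ^+ n) `^ g = (a `^ g) ^+ n.
Proof.
move=> a0; elim: n => [|n ih]; first by rewrite !expr0 powR1.
by rewrite !exprS powRM ?exprn_ge0// ih.
Qed.

Lemma half_powR_lt1 (R : realType) (g : R) : 0 < g -> 0 < (2^-1 : R) `^ g < 1.
Proof.
move=> g0; rewrite powR_gt0 ?invr_gt0//= -[ltRHS](_ : 1 `^ g = 1); last by rewrite powR1.
by apply: gt0_ltr_powR => //; rewrite ?nnegrE//; lra.
Qed.

Lemma dyadic_bracket (R : realType) (u : R) : 0 < u -> u <= 1 ->
  exists k, 2^-1 ^+ k.+1 < u <= 2^-1 ^+ k.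
Proof.
move=> u0 u1.
have ex : exists n, 2^-1 ^+ n < u.
  have [n _ hn] := near_infty_natSinv_expn_lt (PosNum u0).
  by exists n; rewrite exprVn -div1r; have := hn n (leqnn n).
case: (ex_minnP ex) => -[|k] hk hmin.
  by move: hk; rewrite expr0 ltNge u1.
exists k; rewrite hk /= leNgt; apply/negP => /hmin.
by rewrite ltnn.
Qed.

(** The integral of a nonnegative function is by definition a supremum over the
    simple functions below it, whence monotonicity for arbitrary functions. It is
    meant for the distance between two points of a path, whose measurability for
    the Carnot-Caratheodory metric would call for an argument of its own. *)
Lemma ge0_le_integral_nonmeasurable (d : measure_display) (T : measurableType d)
    (R : realType) (mu : {measure set T -> \bar R}) (D : set T) (f1 f2 : T -> \bar R) :
  (forall x, D x -> 0 <= f1 x)%E -> (forall x, D x -> f1 x <= f2 x)%E ->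
  (\int[mu]_(x in D) f1 x <= \int[mu]_(x in D) f2 x)%E.
Proof.
move=> f10 f12; rewrite !ge0_integralE//; last first.
  by move=> x Dx; exact: le_trans (f10 x Dx) (f12 x Dx).
apply: ereal_sup_le => _ [h hf1 <-]; exists h => // x; apply: le_trans (hf1 x) _; rewrite !patchE.
by case: ifPn => // /set_mem; exact: f12.
Qed.

Section hoelder_sobolev.
Context (R : realType).
Let mu := @lebesgue_measure R.

(** The neighbourhood of width [h] of the diagonal. *)
Let strip (h : R) : set (measurableTypeR R * measurableTypeR R) :=
  (`[0, 1] `*` `[0, 1]) `&` [set z | `|z.2 - z.1| <= h].

Let mstrip h : measurable (strip h).
Proof.
apply: measurableI; first exact: measurableX.
rewrite -[X in measurable X]setTI.
pose f (z : measurableTypeR R * measurableTypeR R) : R := `|z.2 - z.1|.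
have mf : measurable_fun setT f.
  apply: measurableT_comp => //; apply: measurable_funB => //.
have := mf measurableT `]-oo, h]%classic (measurable_itv _).
by congr measurable; apply/seteqP; split => z /=; rewrite in_itv.
Qed.

Let strip_measure h : 0 <= h -> ((mu \x mu) (strip h) <= (2 * h)%:E)%E.
Proof.
move=> h0; rewrite /product_measure1.
apply: (@le_trans _ _ (\int[mu]_(x in `[0%R, 1%R]) (2 * h)%:E)%E); last first.
  by rewrite integral_cst//= lebesgue_measure_itv/= lte_fin ltr01 oppr0 adde0 mule1.
rewrite [leRHS]integral_mkcond; apply: ge0_le_integral_nonmeasurable => // x _.
rewrite patchE; case: ifPn => [_|/negP x01].
  apply: (@le_trans _ _ (mu `[x - h, x + h]%classic)).
    apply: le_measure; rewrite ?inE//.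
      by apply: measurable_xsection; exact: mstrip.
    move=> y; rewrite /xsection /= => /set_mem [_ /=].
    by rewrite in_itv/= -ler_distlC distrC.
  rewrite /mu lebesgue_measure_itv/= lte_fin; case: ifP => _; last by rewrite lee_fin mulr_ge0.
  by rewrite -EFinD lee_fin; lra.
suff e : xsection (strip h) x = set0 by rewrite /= e /mu measure0.
apply/seteqP; split => // y; rewrite /xsection /= => /set_mem [[/= xx _] _].
by apply: x01; apply/mem_set.
Qed.

(** Where [2^(-k-1) < |t - s| <= 2^(-k)] the integrand is at most a constant times
    [2^k 2^(-k (beta - alpha) p)], and this region has measure at most
    [2 2^(-k)]: the integral is dominated by a geometric series. *)
Lemma hoelder_sobolev_finite (T : Type) (dist : T -> T -> \bar R) (f : R -> T)
    (C beta alpha p : R) :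
  (forall x y, 0 <= dist x y)%E -> 0 <= C -> 0 < beta -> 0 < p -> alpha < beta ->
  (forall s t : R, 0 <= s <= 1 -> 0 <= t <= 1 ->
    (dist (f s) (f t) <= (C * `|t - s| `^ beta)%:E)%E) ->
  (\int[mu \x mu]_(z in `[0%R, 1%R] `*` `[0%R, 1%R])
    (dist (f z.1) (f z.2) `^ p *
      ((`|z.2 - z.1| `^ (alpha * p + 1))^-1)%:E) < +oo)%E.
Proof.
move=> dist0 C0 b0 p0 ab hf.
pose g := (beta - alpha) * p.
have g0 : 0 < g by rewrite mulr_gt0// subr_gt0.
pose q : R := 2^-1 `^ g.
have /andP[q0 q1] : 0 < q < 1 by exact: half_powR_lt1.
pose c k : R := C `^ p * (2 ^+ k.+1 * q ^+ k).
have c0 k : 0 <= c k by rewrite mulr_ge0 ?powR_ge0// mulr_ge0 ?exprn_ge0// ltW.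
pose G z : \bar R := (\sum_(0 <= k <oo) (c k * \1_(strip (2^-1 ^+ k)) z)%:E)%E.
have cG0 k z : (0 <= (c k * \1_(strip (2^-1 ^+ k)) z)%:E)%E.
  by rewrite lee_fin mulr_ge0.
have main z : (`[0%R, 1%R] `*` `[0%R, 1%R])%classic z ->
    (dist (f z.1) (f z.2) `^ p * ((`|z.2 - z.1| `^ (alpha * p + 1))^-1)%:E <= G z)%E.
  case: z => s t [/=]; rewrite !in_itv/= => s01 t01.
  have dle : (dist (f s) (f t) `^ p <= ((C * `|t - s| `^ beta) `^ p)%:E)%E.
    rewrite -poweR_EFin; apply: gt0_ler_poweR; rewrite ?(ltW p0)//.
    - by rewrite in_itv/= dist0 leey.
    - by rewrite in_itv/= leey andbT lee_fin mulr_ge0 ?powR_ge0.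
    - exact: hf.
  have G0 : (0 <= G (s, t))%E by apply: nneseries_ge0 => k _ _; exact: cG0.
  (* On the diagonal the distance is 0 by the Hoelder bound. *)
  have [st|st] := eqVneq s t.
    rewrite -st in dle G0 *.
    suff -> : (dist (f s) (f s) `^ p = 0)%E by rewrite mul0e.
    apply/le_anti; rewrite poweR_ge0 andbT; move: dle.
    by rewrite subrr normr0 (powR0 (lt0r_neq0 b0)) mulr0 powR0// lt0r_neq0.
  set u := `|t - s| in dle *.
  have u0 : 0 < u by rewrite normr_gt0 subr_eq0 eq_sym.
  have u1 : u <= 1.
    by move/andP: s01 => [? ?]; move/andP: t01 => [? ?]; rewrite ler_norml; apply/andP; split; lra.
  have [k /andP[uk1 uk2]] := dyadic_bracket u0 u1.
  apply: (@le_trans _ _ ((C * u `^ beta) `^ p * (u `^ (alpha * p + 1))^-1)%:E).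
    by rewrite EFinM; apply: lee_wpmul2r => //; rewrite lee_fin invr_ge0 powR_ge0.
  apply: (@le_trans _ _ (c k * \1_(strip (2^-1 ^+ k)) (s, t))%:E); last first.
    apply: le_trans (nneseries_lim_ge k.+1 _); last by move=> n _ _; exact: cG0.
    by rewrite big_nat_recr//= leeDr// sume_ge0.
  rewrite indicE mem_set ?mulr1 ?lee_fin; last first.
    by split => //=; rewrite !in_itv.
  rewrite powRM ?powR_ge0// -mulrA /c; apply: ler_wpM2l; first exact: powR_ge0.
  rewrite -powRrM -powRB ?(gt_eqF u0) ?implybT//.
  rewrite (_ : beta * p - (alpha * p + 1) = g - 1); last by rewrite /g; ring.
  rewrite powRB ?(gt_eqF u0) ?implybT// powRr1 ?(ltW u0)// mulrC.
  apply: ler_pM; rewrite ?invr_ge0 ?powR_ge0 ?(ltW u0)//.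
    rewrite -[leRHS]invrK -exprVn lef_pV2 ?posrE ?exprn_gt0//; exact: ltW.
  rewrite /q -powR_expn; last by rewrite invr_ge0.
  by apply: ge0_ler_powR; rewrite ?nnegrE ?exprn_ge0 ?(ltW g0) ?(ltW u0).
apply: (@le_lt_trans _ _ (\int[mu \x mu]_z G z)%E).
  rewrite integral_mkcond; apply: ge0_le_integral_nonmeasurable => z _.
    by rewrite patchE; case: ifP => // _; rewrite mule_ge0 ?poweR_ge0// lee_fin invr_ge0 powR_ge0.
  rewrite patchE; case: ifPn => [/set_mem/main//|_].
  by apply: nneseries_ge0 => k _ _; exact: cG0.
rewrite /G integral_nneseries//; last first.
  move=> k; apply/measurable_EFinP; apply: measurable_funM => //.
apply: le_lt_trans (ltry (C `^ p * 4 / (1 - q))).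
apply: le_trans (geometric_nneseries_le _ _); last 2 first.
- by rewrite mulr_ge0// powR_ge0.
- by rewrite (ltW q0).
apply: lee_nneseries => k _; first by move=> _; apply: integral_ge0.
under eq_integral do rewrite EFinM.
rewrite ge0_integralZl_EFin//; last first.
  by apply/measurable_EFinP; have := mstrip (2^-1 ^+ k).
rewrite integral_indic// setIT.
apply: (@le_trans _ _ ((c k)%:E * (2 * 2^-1 ^+ k)%:E)%E).
  by apply: lee_wpmul2l; [rewrite lee_fin|apply: strip_measure; rewrite exprn_ge0].
rewrite -EFinM lee_fin /c exprS le_eqVlt; apply/orP; left; apply/eqP.
have : 2 ^+ k * 2^-1 ^+ k = 1 :> R by rewrite -exprMn divff// expr1n.
set x := 2 ^+ k; set y := 2^-1 ^+ k => xy.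
transitivity (C `^ p * 4 * q ^+ k * (x * y)); first by ring.
by rewrite xy mulr1.
Qed.

End hoelder_sobolev.

(** * Partitions and Riemann-Stieltjes integrals *)

Section continuity_epsilon_delta.
Context (R : realType).

Lemma within_itv_continuousP (V : normedModType R) (a b : R) (f : R -> V) :
  {within `[a, b], continuous f} <->
  forall x, a <= x <= b -> forall e, 0 < e ->
    exists2 del : R, 0 < del & forall y, a <= y <= b -> `|y - x| < del ->
      `|f y - f x| < e.
Proof.
split.
  move=> /subspace_continuousP fc x xab e e0.
  have /fc : `[a, b]%classic x by rewrite /= in_itv.
  move=> /cvgrPdist_lt/(_ e e0); rewrite near_withinE => /nbhs_ballP[del /= del0 h].
  exists del => // y yab yx; rewrite distrC; apply: h => /=.
    by rewrite /ball/= distrC.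
  by rewrite in_itv.
move=> h; apply/subspace_continuousP => x; rewrite /= in_itv /= => xab.
apply/cvgrPdist_lt => e e0; rewrite near_withinE.
have [del del0 hd] := h x xab e e0.
apply/nbhs_ballP; exists del => // y; rewrite /ball/= => xy; rewrite in_itv/= => yab.
by rewrite distrC; apply: hd => //; rewrite distrC.
Qed.

(** Compactness of the segment, in its covering form for the variables [x] and [del]. *)
Lemma heine_itv (V : normedModType R) (a b : R) (f : R -> V) :
  {within `[a, b], continuous f} -> forall e : R, 0 < e ->
  exists2 del : R, 0 < del & forall x y, a <= x <= b -> a <= y <= b ->
    `|y - x| < del -> `|f y - f x| < e.
Proof.
move=> /within_itv_continuousP fc e e0.
have := @segment_compact R a b; rewrite compact_near_coveringP.
pose Q (del x : R) := a <= x <= b -> forall y, a <= y <= b -> `|y - x| < del ->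
  `|f y - f x| < e.
move=> /(_ R (0^'+) Q _)[].
  move=> x; rewrite /= in_itv/= => xab.
  have [eta eta0 h] := fc x xab (e / 2) (divr_gt0 e0 (ltr0Sn _ _)).
  have eta2 : 0 < eta / 2 by rewrite divr_gt0.
  exists (ball x (eta / 2), [set del | del < eta / 2]).
    by split => /=; [exact: nbhsx_ballx|exact: nbhs_right_lt].
  move=> [x' del] /= [xx' del_eta] x'ab y yab yx'.
  rewrite /ball/= in xx'.
  have -> : f y - f x' = (f y - f x) - (f x' - f x) by rewrite opprB addrA subrK.
  rewrite (le_lt_trans (ler_normB _ _))// [ltRHS]splitr ltrD// h//.
    have -> : y - x = (y - x') - (x - x') by rewrite opprB addrA subrK.
    rewrite (le_lt_trans (ler_normB _ _))// [ltRHS]splitr ltrD//.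
    exact: lt_trans del_eta.
  by rewrite distrC (lt_le_trans xx')//; lra.
move=> del /= del0 hdel.
have del2 : 0 < del / 2 by rewrite divr_gt0.
exists (del / 2) => // x y xab yab yx.
apply: (hdel (del / 2)) => //=.
  by rewrite /ball/= sub0r normrN gtr0_norm//; lra.
Qed.

End continuity_epsilon_delta.

Section partitions.
Context (R : realType).
Implicit Types (a b : R) (s : seq R) (f g G H V : R -> R).

Lemma itv_partition_ltS a b s k : itv_partition a b s -> (k < size s)%N ->
  nth b (a :: s) k < nth b (a :: s) k.+1.
Proof. by move=> [/(pathP b) h _] ks; exact: h. Qed.

Lemma itv_partition_bounds a b s k : itv_partition a b s -> (k <= size s)%N ->
  a <= nth b (a :: s) k <= b.
Proof.
move=> abs ks; rewrite itv_partition_nth_ge //=.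
exact: itv_partition_nth_le.
Qed.

(** Summing only the parts of the cells that lie to the left of [y]. Differences of
    two such sums cut the cells of one partition along those of another one. *)
Lemma partition_clamp_sum G a b s y : itv_partition a b s -> a <= y <= b ->
  \sum_(0 <= i < size s)
    (G (Num.max (nth b (a :: s) i) (Num.min y (nth b (a :: s) i.+1)))
     - G (nth b (a :: s) i)) = G y - G a.
Proof.
move=> abs /andP[ay yb].
have h n : (n <= size s)%N -> \sum_(0 <= i < n)
    (G (Num.max (nth b (a :: s) i) (Num.min y (nth b (a :: s) i.+1)))
     - G (nth b (a :: s) i)) = G (Num.min y (nth b (a :: s) n)) - G a.
  elim: n => [_|n ih ns].
    by rewrite big_geq// /= (min_idPr ay) subrr.
  rewrite big_nat_recr//= ih ?(ltnW ns)//.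
  have tS := ltW (itv_partition_ltS abs ns).
  set t := nth b (a :: s) n in tS *; set t' := nth b (a :: s) n.+1 in tS *.
  have [yt|ty] := leP y t.
    by rewrite (min_idPl (le_trans yt tS)) (max_idPl yt) subrr addr0.
  rewrite (_ : Num.max t _ = Num.min y t'); first by rewrite addrC addrA subrK.
  by apply/max_idPr; rewrite le_min (ltW ty).
by rewrite h// (itv_partition_nth_size _ abs) (min_idPl yb).
Qed.

Lemma partition_telescope G a b s : itv_partition a b s ->
  \sum_(0 <= i < size s) (G (nth b (a :: s) i.+1) - G (nth b (a :: s) i)) = G b - G a.
Proof.
move=> abs; rewrite telescope_sumr//=.
by rewrite -[b in RHS](itv_partition_nth_size b abs).
Qed.

Lemma uniform_partition a h n : 0 < h ->
  let s := mkseq (fun k => a + h * k.+1%:R) n in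
  itv_partition a (a + h * n%:R) s /\
  forall def k, (k <= n)%N -> nth def (a :: s) k = a + h * k%:R.
Proof.
move=> h0 /=.
have nthE def k : (k <= n)%N ->
    nth def (a :: mkseq (fun k => a + h * k.+1%:R) n) k = a + h * k%:R.
  by case: k => [_|k kn] /=; [rewrite mulr0 addr0|rewrite nth_mkseq].
split => //; split; last first.
  rewrite (last_nth a) size_mkseq nthE//.
apply/(pathP a) => k; rewrite size_mkseq => kn.
rewrite nthE ?(ltnW kn)// nth_mkseq// ltrD2l ltr_pM2l// ltr_nat//.
Qed.

#[global] Instance fine_tagged_partitions_filter a b : Filter (fine_tagged_partitions a b).
Proof.
split.
- by exists 1.
- move=> A B [dA dA0 hA] [dB dB0 hB]; exists (Num.min dA dB); first by rewrite lt_min dA0.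
  move=> s xi abs ms ts; split.
    by apply: hA => // k ks; have := ms k ks; rewrite lt_min => /andP[].
  by apply: hB => // k ks; have := ms k ks; rewrite lt_min => /andP[].
- by move=> A B AB [dA dA0 hA]; exists dA => // s xi abs ms ts; apply/AB/hA.
Qed.

Lemma fine_partition_exists a b del : a < b -> 0 < del ->
  exists2 s, itv_partition a b s & mesh_lt del a b s.
Proof.
move=> ab del0; have ba0 : 0 < b - a by rewrite subr_gt0.
pose n := Num.bound ((b - a) / del).
have hn : (b - a) / n.+1%:R < del.
  rewrite ltr_pdivrMr// -ltr_pdivrMl// mulrC.
  have /ltW/archi_boundP h : 0 < (b - a) / del by rewrite divr_gt0.
  by rewrite (lt_trans h)// ltr_nat.
set h := (b - a) / n.+1%:R in hn.
have h0 : 0 < h by rewrite divr_gt0 ?subr_gt0.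
have [abs nthE] := uniform_partition a n.+1 h0.
have bE : a + h * n.+1%:R = b by rewrite /h divfK// addrC subrK.
rewrite bE in abs.
exists (mkseq (fun k => a + h * k.+1%:R) n.+1) => // k; rewrite size_mkseq => kn.
rewrite !nthE// ?(ltnW kn)//.
by rewrite [_ - _](_ : _ = h)//; rewrite -[k.+1%:R]natr1; ring.
Qed.

Lemma fine_tagged_partitions_proper a b : a < b ->
  ProperFilter (fine_tagged_partitions a b).
Proof.
move=> ab; apply: Build_ProperFilter_ex => A [del del0 hA].
have [s abs ms] := fine_partition_exists ab del0.
exists (s, nth b (a :: s)); apply: hA => // k ks.
by rewrite lexx ltW//; exact: itv_partition_ltS.
Qed.

End partitions.

Section riemann_stieltjes.
Context (R : realType).
Implicit Types (a b c : R) (s : seq R) (f g H V : R -> R).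

(** If the increments of [H] are those of the integrand up to a quadratic error,
    the errors over a partition add up to at most [K (b - a)] times its mesh. This
    yields the existence of the limit together with its value. *)
Lemma rs_integral_primitive f g H a b K : a < b -> 0 <= K ->
  (forall u xi v, a <= u -> u <= xi -> xi <= v -> v <= b ->
    `|H v - H u - f xi * (g v - g u)| <= K * (v - u) ^+ 2) ->
  rs_integral f g a b = H b - H a.
Proof.
move=> ab K0 hH.
have PF := fine_tagged_partitions_proper ab.
apply: cvg_lim => //; apply/cvgrPdist_le => e e0.
have ba0 : 0 < b - a by rewrite subr_gt0.
have KK : 0 < K * (b - a) + 1 by rewrite ltr_wpDl// mulr_ge0// ltW.
exists (e / (K * (b - a) + 1)); first by rewrite divr_gt0.
move=> s xi abs ms ts.
rewrite /rs_sum /= -(partition_telescope H abs) -sumrB.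
apply: (le_trans (ler_norm_sum _ _ _)).
apply: (@le_trans _ _ (\sum_(0 <= k < size s)
    K * (e / (K * (b - a) + 1)) * (nth b (a :: s) k.+1 - nth b (a :: s) k))).
  rewrite !big_nat; apply: ler_sum => k /andP[_ ks].
  have /andP[t1 t2] := ts k ks.
  have /andP[ta _] := itv_partition_bounds abs (ltnW ks).
  have /andP[_ tb] := itv_partition_bounds abs ks.
  apply: le_trans (hH _ _ _ ta t1 t2 tb) _.
  rewrite -mulrA; apply: ler_wpM2l => //; rewrite expr2; apply: ler_wpM2r.
    by rewrite subr_ge0 (le_trans t1).
  exact/ltW/ms.
rewrite -mulr_sumr (partition_telescope idfun abs) /=.
rewrite [leLHS](_ : _ = e * (K * (b - a)) / (K * (b - a) + 1)); last by ring.
by rewrite ler_pdivrMr// ler_pM2l// lerDl.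
Qed.

Section bounded_variation_integrator.
Variables (f g V : R -> R) (a b : R).
Hypothesis ab : a < b.
Hypothesis f_unif : forall e : R, 0 < e -> exists2 del : R, 0 < del &
  forall x y, a <= x <= b -> a <= y <= b -> `|y - x| < del -> `|f y - f x| < e.
Hypothesis gV : forall x y, a <= x -> x <= y -> y <= b -> `|g y - g x| <= V y - V x.

Let V_homo x y : a <= x -> x <= y -> y <= b -> V x <= V y.
Proof. by move=> ax xy yb; rewrite -subr_ge0 (le_trans _ (gV ax xy yb)). Qed.

Let clamp_bounds l r y : a <= l -> l <= r -> r <= b ->
  l <= Num.max l (Num.min y r) <= r.
Proof. by move=> al lr rb; rewrite le_max lexx/= ge_max lr ge_min lexx orbT. Qed.

(** Both sums are rewritten over the cells [[c i (t k), c i (t k.+1)]] of the common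
    refinement, indexed by all pairs of cells, most of which are degenerate. In a
    nondegenerate one the two tags are within [del] of each other. *)
Let rs_sum_close e del s xi s' xi' : 0 <= e ->
  (forall x y, a <= x <= b -> a <= y <= b -> `|y - x| < del -> `|f y - f x| <= e) ->
  itv_partition a b s -> mesh_lt (del / 2) a b s -> tags_of a b s xi ->
  itv_partition a b s' -> mesh_lt (del / 2) a b s' -> tags_of a b s' xi' ->
  `|rs_sum f g a b (s, xi) - rs_sum f g a b (s', xi')| <= e * (V b - V a).
Proof.
move=> e0 fe abs ms ts abs' ms' ts'.
pose t k := nth b (a :: s) k; pose t' i := nth b (a :: s') i.
pose c i y := Num.max (t' i) (Num.min y (t' i.+1)).
have tb k : (k <= size s)%N -> a <= t k <= b by exact: itv_partition_bounds.
have tb' k : (k <= size s')%N -> a <= t' k <= b by exact: itv_partition_bounds.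
have tS k : (k < size s)%N -> t k < t k.+1 by exact: itv_partition_ltS.
have tS' k : (k < size s')%N -> t' k < t' k.+1 by exact: itv_partition_ltS.
have split_k (G : R -> R) i : (i < size s')%N ->
    \sum_(0 <= k < size s) (G (c i (t k.+1)) - G (c i (t k))) = G (t' i.+1) - G (t' i).
  move=> is'; have /andP[a1 b1] := tb' _ (ltnW is').
  have /andP[a2 b2] := tb' _ is'; have tt := ltW (tS' _ is').
  rewrite (partition_telescope (G \o c i) abs) /= /c.
  rewrite (min_idPr b2) (max_idPr tt) (min_idPl _); last exact: le_trans a1 tt.
  by rewrite (max_idPl a1).
have split_i (G : R -> R) k : (k < size s)%N ->
    \sum_(0 <= i < size s') (G (c i (t k.+1)) - G (c i (t k))) = G (t k.+1) - G (t k).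
  move=> ks; have e1 := partition_clamp_sum G abs' (tb _ ks).
  have e2 := partition_clamp_sum G abs' (tb _ (ltnW ks)).
  transitivity ((G (t k.+1) - G a) - (G (t k) - G a)).
    rewrite -e1 -e2 -sumrB; apply: eq_bigr => i _.
    by rewrite /c /t'; ring.
  by ring.
have -> : rs_sum f g a b (s, xi) = \sum_(0 <= k < size s) \sum_(0 <= i < size s')
    f (xi k) * (g (c i (t k.+1)) - g (c i (t k))).
  rewrite /rs_sum /= !big_nat; apply: eq_bigr => k /andP[_ ks].
  by rewrite -mulr_sumr split_i.
have -> : rs_sum f g a b (s', xi') = \sum_(0 <= k < size s) \sum_(0 <= i < size s')
    f (xi' i) * (g (c i (t k.+1)) - g (c i (t k))).
  rewrite exchange_big /rs_sum /= !big_nat; apply: eq_bigr => i /andP[_ is'].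
  by rewrite -mulr_sumr split_k.
rewrite -(partition_telescope V abs) mulr_sumr -sumrB.
apply: (le_trans (ler_norm_sum _ _ _)); rewrite !big_nat; apply: ler_sum => k /andP[_ ks].
rewrite -(split_i V k ks) mulr_sumr -sumrB.
apply: (le_trans (ler_norm_sum _ _ _)); rewrite !big_nat; apply: ler_sum => i /andP[_ is'].
rewrite -mulrBl normrM.
have /andP[a1 b1] := tb' _ (ltnW is'); have /andP[a2 b2] := tb' _ is'.
have tt' := ltW (tS' _ is'); have tt := ltW (tS _ ks).
have /andP[c1 c2] := clamp_bounds (t k.+1) a1 tt' b2.
have /andP[c3 c4] := clamp_bounds (t k) a1 tt' b2.
have cc : c i (t k) <= c i (t k.+1).
  by rewrite /c ge_max le_max lexx/= le_max le_min !ge_min tt lexx !orbT.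
have gc : `|g (c i (t k.+1)) - g (c i (t k))| <= V (c i (t k.+1)) - V (c i (t k)).
  by apply: gV => //; [exact: le_trans a1 c3|exact: le_trans c2 b2].
have [cE|cN] := eqVneq (c i (t k)) (c i (t k.+1)).
  by rewrite cE !subrr normr0 !mulr0.
apply: ler_pM => //.
have /andP[x1 x2] := ts k ks; have /andP[y1 y2] := ts' i is'.
rewrite -/(t k) -/(t k.+1) in x1 x2; rewrite -/(t' i) -/(t' i.+1) in y1 y2.
have m1 := ms k ks; have m2 := ms' i is'.
rewrite -/(t k) -/(t k.+1) in m1; rewrite -/(t' i) -/(t' i.+1) in m2.
have /andP[a3 b3] := tb _ (ltnW ks); have /andP[a4 b4] := tb _ ks.
have o1 : t' i < t k.+1.
  rewrite ltNge; apply/negP => h; move/eqP: cN; apply.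
  rewrite /c (max_idPl _); last by rewrite ge_min (le_trans tt h).
  by rewrite (max_idPl _)// ge_min h.
have o2 : t k < t' i.+1.
  rewrite ltNge; apply/negP => h; move/eqP: cN; apply.
  by rewrite /c (min_idPr h) (min_idPr (le_trans h tt)).
apply: fe; [by apply/andP; split; lra|by apply/andP; split; lra|].
rewrite ltr_norml; apply/andP; split; lra.
Qed.

Lemma rs_integral_bv_cvg : cvg (rs_sum f g a b @ fine_tagged_partitions a b).
Proof.
have PF := fine_tagged_partitions_proper ab.
apply/cauchy_cvgP/cauchy_exP => e e0.
have V0 : 0 <= V b - V a by rewrite subr_ge0; apply: V_homo => //; exact: ltW.
have V1 : 0 < V b - V a + 1 by rewrite ltr_wpDl.
have e'0 : 0 < e / (V b - V a + 1) by rewrite divr_gt0.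
have [del del0 hf] := f_unif e'0.
have del2 : 0 < del / 2 by rewrite divr_gt0.
have [s abs ms] := fine_partition_exists ab del2.
pose xi := nth b (a :: s).
have ts : tags_of a b s xi.
  by move=> k ks; rewrite /xi lexx ltW// itv_partition_ltS.
exists (rs_sum f g a b (s, xi)), (del / 2) => // s' xi' abs' ms' ts'.
rewrite /ball /=; apply: le_lt_trans (rs_sum_close (ltW e'0) _ abs ms ts abs' ms' ts') _.
  by move=> x y xab yab xy; apply/ltW/hf.
by rewrite mulrAC ltr_pdivrMr// ltr_pM2l// ltrDl.
Qed.

Lemma rs_integral_bv_le M : (forall x, a <= x <= b -> `|f x| <= M) ->
  `|rs_integral f g a b| <= M * (V b - V a).
Proof.
move=> fM; have PF := fine_tagged_partitions_proper ab.
have near_bound : \forall p \near fine_tagged_partitions a b,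
    `|rs_sum f g a b p| <= M * (V b - V a).
  exists 1 => // s xi abs _ ts; rewrite /rs_sum/=.
  rewrite -(partition_telescope V abs) mulr_sumr.
  apply: (le_trans (ler_norm_sum _ _ _)); rewrite !big_nat.
  apply: ler_sum => k /andP[_ ks]; rewrite normrM.
  have /andP[t1 t2] := ts k ks.
  have /andP[a1 b1] := itv_partition_bounds abs (ltnW ks).
  have /andP[a2 b2] := itv_partition_bounds abs ks.
  apply: ler_pM => //; first by apply: fM; rewrite (le_trans a1)//= (le_trans t2).
  by apply: gV => //; exact: le_trans t2.
rewrite ler_norml; apply/andP; split.
  apply: limr_ge; first exact: rs_integral_bv_cvg.
  by apply: filterS near_bound => p; rewrite ler_norml => /andP[].
apply: limr_le; first exact: rs_integral_bv_cvg.
by apply: filterS near_bound => p; rewrite ler_norml => /andP[].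
Qed.

End bounded_variation_integrator.
End riemann_stieltjes.

(** * The Carnot-Caratheodory norm dominates the second level *)

Section cc_lower_bound.
Context (R : realType) (d : nat).
Implicit Types (x : R -> 'rV[R]_d).

Lemma total_variation_le_path_length x (j : 'I_d) :
  (total_variation 0 1 (fun t => x t 0%R j) <= path_length x)%E.
Proof.
apply: ub_ereal_sup => _ [_ [s s01 <-] <-].
apply: le_trans (ereal_sup_ubound _); last by exists s.
rewrite lee_fin /variation; apply: ler_sum => k _ /=.
by apply: le_trans (normr_coord_le_enorm _ 0 j); rewrite !mxE.
Qed.

(** The entry is a Stieltjes integral along a path of length less than [L]: the
    integrand is bounded by [L] since it vanishes at time [0], and the integrator
    has variation at most [L]. *)
Lemma cc_norm_lt_coord (g : tensor2 R d) (L : R) (i j : 'I_d) :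
  (cc_norm g < L%:E)%E -> `|pi2 g i j| <= L ^+ 2.
Proof.
move=> /ereal_inf_lt[_ [x [cx xfin <-] <-] xL].
rewrite /signature2 /pi2 /= mxE.
have L0 : 0 <= L.
  rewrite -lee_fin; apply: le_trans (ltW xL).
  apply: le_trans (total_variation_le_path_length x i).
  exact: total_variation_ge0.
have TVfin c : (total_variation 0 1 (fun t => x t 0 c)) \is a fin_num.
  rewrite ge0_fin_numE ?total_variation_ge0//.
  exact: le_lt_trans (total_variation_le_path_length x c) xfin.
have BV c : bounded_variation 0 1 (fun t => x t 0 c) by apply/bounded_variationP.
pose V c t := fine (total_variation 0 t (fun t => x t 0 c)).
have Vfin c t : 0 <= t <= 1 -> total_variation 0 t (fun t => x t 0 c) \is a fin_num.
  move=> /andP[t0 t1]; apply/bounded_variationP => //.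
  exact: bounded_variationl (BV c).
have xV c u v : 0 <= u -> u <= v -> v <= 1 -> `|x v 0 c - x u 0 c| <= V c v - V c u.
  move=> u0 uv v1; rewrite -lee_fin EFinB !fineK ?Vfin ?u0 ?v1 ?(le_trans u0)//;
    last by rewrite (le_trans uv).
  rewrite (total_variationD _ u0 uv) addeAC subee ?Vfin ?u0 ?(le_trans uv)// add0e.
  exact: total_variation_ge.
have VL c : V c 1 - V c 0 <= L.
  rewrite {2}/V total_variationxx subr0 -lee_fin fineK//.
  by apply: le_trans (ltW xL); exact: total_variation_le_path_length.
have cont c e : 0 < e -> exists2 del : R, 0 < del &
    forall s t, 0 <= s <= 1 -> 0 <= t <= 1 -> `|t - s| < del ->
    `|(x t 0 c - x 0 0 c) - (x s 0 c - x 0 0 c)| < e.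
  move=> e0; have [del del0 h] := heine_itv cx e0.
  exists del => // s t s01 t01 st.
  apply: le_lt_trans (h s t s01 t01 st).
  rewrite opprB addrA subrK.
  by have := normr_coord_le (x t - x s) 0 c; rewrite !mxE.
have := @rs_integral_bv_le R (fun r => x r 0 i - x 0 0 i) (fun r => x r 0 j) (V j)
  0 1 ltr01 (cont i) (xV j) L.
move=> /(_ _)/le_trans; apply => //; last by rewrite expr2 ler_wpM2l.
move=> r /andP[r0 r1]; apply: le_trans (xV i 0 r _ r0 r1) _ => //.
apply: le_trans (VL i); rewrite lerD2r -subr_ge0.
exact: le_trans (xV i r 1 r0 r1 _).
Qed.

End cc_lower_bound.

(** * Signatures of polygons *)

Section rs_lipschitz_primitive.
Context (R : realType).
Implicit Types (a b c v : R) (f g H : R -> R).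

Definition lipschitz_between (K a b : R) f : Prop :=
  forall u w, a <= u -> u <= w -> w <= b -> `|f w - f u| <= K * (w - u).

(** An explicit primitive with quadratic error as in [rs_integral_primitive]. Unlike
    the mere existence of the integral, this is easily seen to be stable under
    concatenation. *)
Definition rs_regular f g a b v : Prop :=
  exists K H, [/\ 0 <= K, lipschitz_between K a b f, lipschitz_between K a b g,
    forall u xi w, a <= u -> u <= xi -> xi <= w -> w <= b ->
      `|H w - H u - f xi * (g w - g u)| <= K * (w - u) ^+ 2
    & H b - H a = v].

Lemma rs_regular_integral f g a b v : a < b -> rs_regular f g a b v ->
  rs_integral f g a b = v.
Proof.
by move=> ab [K [H [K0 _ _ h <-]]]; exact: rs_integral_primitive ab K0 h.
Qed.

(** The trapezoid rule is exact here, so it provides the primitive. *)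
Lemma rs_regular_affine f g a b p q :
  (forall t, a <= t <= b -> f t = f a + p * (t - a)) ->
  (forall t, a <= t <= b -> g t = g a + q * (t - a)) ->
  a <= b -> rs_regular f g a b ((f a + f b) / 2 * (g b - g a)).
Proof.
move=> fE gE ab; pose K := `|p| + `|q| + `|p| * `|q|.
have p0 := normr_ge0 p; have q0 := normr_ge0 q.
have pq0 : 0 <= `|p| * `|q| by rewrite mulr_ge0.
have lin (r : R) (h : R -> R) : `|r| <= K ->
    (forall t, a <= t <= b -> h t = h a + r * (t - a)) -> lipschitz_between K a b h.
  move=> rK hE u w au uw wb.
  have au' : a <= u <= b by rewrite au (le_trans uw).
  have aw' : a <= w <= b by rewrite wb andbT (le_trans au).
  rewrite (hE u)// (hE w)// (_ : _ - _ = r * (w - u)); last by ring.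
  rewrite normrM (ger0_norm (_ : 0 <= w - u)) ?subr_ge0//.
  by apply: ler_wpM2r; rewrite // subr_ge0.
exists K, (fun t => (f a + f t) / 2 * (g t - g a)); split.
- by rewrite /K; lra.
- by apply: lin fE; rewrite /K; lra.
- by apply: lin gE; rewrite /K; lra.
- move=> u xi w au uxi xiw wb.
  have au' : a <= u <= b by rewrite au (le_trans uxi)// (le_trans xiw).
  have aw' : a <= w <= b by rewrite wb andbT (le_trans au)// (le_trans uxi).
  have ax' : a <= xi <= b by rewrite (le_trans au)//= (le_trans xiw).
  rewrite (fE u)// (fE w)// (fE xi)// (gE u)// (gE w)//.
  rewrite (_ : _ - _ = p * q * (((w - xi) - (xi - u)) / 2 * (w - u))); last by field.
  rewrite !normrM (ger0_norm (_ : 0 <= w - u)); last by rewrite subr_ge0 (le_trans uxi).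
  have h1 : `|(w - xi) - (xi - u)| * `|2^-1| <= w - u.
    rewrite -normrM ler_norml; apply/andP; split; lra.
  rewrite expr2; apply: ler_pM; rewrite ?mulr_ge0 ?subr_ge0 ?(le_trans uxi)//.
    by rewrite /K; lra.
  by apply: ler_wpM2r; rewrite // subr_ge0 (le_trans uxi).
- by rewrite subrr mulr0 subr0.
Qed.

Lemma lipschitz_between_cat K1 K2 a c b f : 0 <= K1 -> 0 <= K2 ->
  a <= c -> c <= b -> lipschitz_between K1 a c f -> lipschitz_between K2 c b f ->
  lipschitz_between (K1 + K2) a b f.
Proof.
move=> K10 K20 ac cb f1 f2 u w au uw wb.
have wu : 0 <= w - u by rewrite subr_ge0.
have [uc|cu] := leP u c; have [wc|cw] := leP w c.
- apply: le_trans (f1 _ _ au uw wc) _; rewrite mulrDl lerDl mulr_ge0//.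
- have -> : f w - f u = (f w - f c) + (f c - f u) by rewrite addrA subrK.
  apply: le_trans (ler_normD _ _) _.
  have h1 := f1 _ _ au uc (lexx c); have h2 := f2 _ _ (lexx c) (ltW cw) wb.
  have : K1 * (c - u) <= K1 * (w - u) by apply: ler_wpM2l => //; lra.
  have : K2 * (w - c) <= K2 * (w - u) by apply: ler_wpM2l => //; lra.
  by lra.
- by have := lt_le_trans cu (le_trans uw wc); rewrite ltxx.
- apply: le_trans (f2 _ _ (ltW cu) uw wb) _; rewrite mulrDl lerDr mulr_ge0//.
Qed.

(** The two primitives are glued at [c]. Over an interval [u, w] around [c], moving
    the tag to [c] costs a difference of [f] times a difference of [g], which is
    quadratic in [w - u]. *)
Lemma rs_regular_cat f g a c b v1 v2 : a <= c -> c <= b ->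
  rs_regular f g a c v1 -> rs_regular f g c b v2 -> rs_regular f g a b (v1 + v2).
Proof.
move=> ac cb [K1 [H1 [K10 f1 g1 h1 <-]]] [K2 [H2 [K20 f2 g2 h2 <-]]].
have fL := lipschitz_between_cat K10 K20 ac cb f1 f2.
have gL := lipschitz_between_cat K10 K20 ac cb g1 g2.
set L := K1 + K2 in fL gL.
have L0 : 0 <= L by rewrite addr_ge0.
have L20 : 0 <= L * L by rewrite mulr_ge0.
have KL1 : K1 <= L by rewrite /L lerDl.
have KL2 : K2 <= L by rewrite /L lerDr.
pose H t := if t <= c then H1 t else H1 c + (H2 t - H2 c).
have Hr t : c <= t -> H t = H1 c + (H2 t - H2 c).
  rewrite /H le_eqVlt => /predU1P[<-|ct]; first by rewrite lexx subrr addr0.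
  by rewrite leNgt ct.
have Hl t : t <= c -> H t = H1 t by rewrite /H => ->.
exists (L + L * L), H; split.
- by rewrite addr_ge0.
- move=> u w au uw wb; apply: le_trans (fL _ _ au uw wb) _.
  by apply: ler_wpM2r; [rewrite subr_ge0|rewrite lerDl].
- move=> u w au uw wb; apply: le_trans (gL _ _ au uw wb) _.
  by apply: ler_wpM2r; [rewrite subr_ge0|rewrite lerDl].
- move=> u xi w au uxi xiw wb; have uw := le_trans uxi xiw.
  have sq0 : 0 <= (w - u) ^+ 2 by rewrite sqr_ge0.
  have [wc|cw] := leP w c.
    rewrite !Hl ?(le_trans uw)//; apply: le_trans (h1 _ _ _ au uxi xiw wc) _.
    by apply: ler_wpM2r => //; lra.
  have [cu|uc] := leP c u.
    rewrite !Hr ?(le_trans cu)//.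
    have -> : H1 c + (H2 w - H2 c) - (H1 c + (H2 u - H2 c)) = H2 w - H2 u by ring.
    apply: le_trans (h2 _ _ _ cu uxi xiw wb) _.
    by apply: ler_wpM2r => //; lra.
  rewrite (Hl u (ltW uc)) (Hr w (ltW cw)).
  have -> : H1 c + (H2 w - H2 c) - H1 u - f xi * (g w - g u) =
     (H1 c - H1 u - f c * (g c - g u)) + (H2 w - H2 c - f c * (g w - g c)) +
     (f c - f xi) * (g w - g u) by ring.
  apply: le_trans (ler_normD _ _) _; rewrite [leRHS]mulrDl; apply: lerD.
    apply: le_trans (ler_normD _ _) _.
    rewrite /L [leRHS]mulrDl; apply: lerD.
      apply: le_trans (h1 _ _ _ au (ltW uc) (lexx c) (lexx c)) _.
      apply: ler_wpM2l => //; rewrite lerXn2r ?nnegrE ?subr_ge0 ?(ltW uc)//.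
      by rewrite lerD2r ltW.
    apply: le_trans (h2 _ _ _ (lexx c) (lexx c) (ltW cw) wb) _.
    apply: ler_wpM2l => //; rewrite lerXn2r ?nnegrE ?subr_ge0 ?(ltW cw)//.
    by rewrite lerD2l lerN2 ltW.
  rewrite normrM expr2 mulrACA; apply: ler_pM => //; last exact: gL.
  have [xc|cx] := leP xi c.
    apply: le_trans (fL _ _ (le_trans au uxi) xc cb) _.
    by apply: ler_wpM2l => //; lra.
  rewrite distrC; apply: le_trans (fL _ _ ac (ltW cx) (le_trans xiw wb)) _.
  by apply: ler_wpM2l => //; lra.
- by rewrite (Hr b cb) (Hl a ac); ring.
Qed.

Lemma rs_regular_shift f g a b v (e : R) : rs_regular f g a b v ->
  rs_regular (fun t => f t - e) g a b (v - e * (g b - g a)).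
Proof.
move=> [K [H [K0 fL gL h <-]]]; exists K, (fun t => H t - e * g t); split => //.
- move=> u w au uw wb; rewrite (_ : _ - _ = f w - f u); last by ring.
  exact: fL.
- move=> u xi w au uxi xiw wb.
  rewrite (_ : _ - _ = H w - H u - f xi * (g w - g u)); last by ring.
  exact: h.
- by ring.
Qed.

End rs_lipschitz_primitive.

Section polygons.
Context (R : realType) (d : nat).
Implicit Types (x : R -> 'rV[R]_d) (z : nat -> 'rV[R]_d).

(** The number [N] of edges per unit of time is arbitrary, so that this covers the
    dyadic interpolations as well as the paths with prescribed signature which
    bound the Carnot-Caratheodory norm. *)
Definition polygon (N : R) (z : nat -> 'rV[R]_d) (t : R) : 'rV[R]_d :=
  let k := Num.truncn (N * t) in
  z k + (N * (t - k%:R / N)) *: (z k.+1 - z k).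

Lemma dyadic_interpE (x : R -> 'rV[R]_d) m :
  dyadic_interp x m = polygon (2 ^+ m) (fun k => x (k%:R / 2 ^+ m)).
Proof. by []. Qed.

Lemma polygon_vertex (N : R) z k : 0 < N -> polygon N z (k%:R / N) = z k.
Proof.
move=> N0; rewrite /polygon mulrC divfK ?gt_eqF// natrK.
by rewrite subrr mulr0 scale0r addr0.
Qed.

Lemma polygon_edge (N : R) z k t : 0 < N -> k%:R / N <= t <= k.+1%:R / N ->
  polygon N z t = z k + (N * (t - k%:R / N)) *: (z k.+1 - z k).
Proof.
move=> N0 /andP[kt]; rewrite le_eqVlt => /predU1P[->|tk].
  rewrite polygon_vertex// -mulrBl -natrB// subSnn mulrC divfK ?gt_eqF//.
  by rewrite scale1r addrC subrK.
rewrite /polygon (_ : Num.truncn (N * t) = k)//; apply: truncn_def.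
by rewrite mulrC -ler_pdivrMr// kt -ltr_pdivlMr.
Qed.

Lemma polygon_edge_coord (N : R) z k i t : 0 < N -> k%:R / N <= t <= k.+1%:R / N ->
  polygon N z t 0 i = polygon N z (k%:R / N) 0 i +
    N * (z k.+1 0 i - z k 0 i) * (t - k%:R / N).
Proof.
move=> N0 kt; rewrite polygon_vertex// (polygon_edge _ N0 kt) !mxE; ring.
Qed.

Definition trapezoid_sum (u v : nat -> R) (a b : nat) : R :=
  \sum_(a <= k < b) (u k + u k.+1) / 2 * (v k.+1 - v k).

Lemma polygon_rs_regular (N : R) z (i j : 'I_d) a b : 0 < N -> (a <= b)%N ->
  rs_regular (fun t => polygon N z t 0 i) (fun t => polygon N z t 0 j)
    (a%:R / N) (b%:R / N) (trapezoid_sum (fun k => z k 0 i) (fun k => z k 0 j) a b).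
Proof.
move=> N0 /subnK<-; elim: (b - a)%N => [|n ih].
  have := @rs_regular_affine R (fun t => polygon N z t 0 i)
    (fun t => polygon N z t 0 j) (a%:R / N) (a%:R / N) 0 0.
  rewrite subrr mulr0 /trapezoid_sum big_geq// => h; apply: h => //.
  - by move=> t /le_anti <-; rewrite mul0r addr0.
  - by move=> t /le_anti <-; rewrite mul0r addr0.
have le1 k l : (k <= l)%N -> k%:R / N <= l%:R / N.
  by move=> kl; rewrite ler_pM2r ?invr_gt0// ler_nat.
rewrite addSn /trapezoid_sum big_nat_recr ?leq_addl//=.
apply: rs_regular_cat ih _; [exact/le1/leq_addl|exact/le1|].
have := @rs_regular_affine R (fun t => polygon N z t 0 i)
  (fun t => polygon N z t 0 j) ((n + a)%:R / N) ((n + a).+1%:R / N).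
move=> /(_ _ _ (fun t => polygon_edge_coord z i N0) (fun t => polygon_edge_coord z j N0)
  (le1 _ _ (leqnSn _))).
by rewrite !polygon_vertex.
Qed.

Lemma signature2_rs_regular x (s t : R) (A : 'I_d -> 'I_d -> R) : s < t ->
  (forall i j, rs_regular (fun r => x r 0 i) (fun r => x r 0 j) s t (A i j)) ->
  signature2 x s t =
    (1, x t - x s, \matrix_(i, j) (A i j - x s 0 i * (x t 0 j - x s 0 j))).
Proof.
move=> st h; congr (_, _, _); apply/matrixP => i j; rewrite !mxE.
exact/(rs_regular_integral st)/rs_regular_shift.
Qed.

Lemma signature2_polygon (N : R) z a b : 0 < N -> (a < b)%N ->
  signature2 (polygon N z) (a%:R / N) (b%:R / N) =
    (1, z b - z a, \matrix_(i, j)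
      (trapezoid_sum (fun k => z k 0 i) (fun k => z k 0 j) a b
       - z a 0 i * (z b 0 j - z a 0 j))).
Proof.
move=> N0 ab; rewrite (signature2_rs_regular _ (A := fun i j =>
  trapezoid_sum (fun k => z k 0 i) (fun k => z k 0 j) a b)).
- by rewrite !polygon_vertex.
- by rewrite ltr_pM2r ?invr_gt0// ltr_nat.
- by move=> i j; apply: polygon_rs_regular => //; exact: ltnW.
Qed.

Lemma signature2_polygon_edge (N : R) z k s t : 0 < N ->
  k%:R / N <= s -> s < t -> t <= k.+1%:R / N ->
  signature2 (polygon N z) s t =
    (1, (N * (t - s)) *: (z k.+1 - z k),
     2^-1 *: tens ((N * (t - s)) *: (z k.+1 - z k)) ((N * (t - s)) *: (z k.+1 - z k))).
Proof.
move=> N0 ks st tk.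
have sE : polygon N z s = z k + (N * (s - k%:R / N)) *: (z k.+1 - z k).
  by apply: polygon_edge; rewrite // ks (ltW (lt_le_trans st tk)).
have tE : polygon N z t = z k + (N * (t - k%:R / N)) *: (z k.+1 - z k).
  by apply: polygon_edge; rewrite // tk (ltW (le_lt_trans ks st)).
have aff i r : s <= r <= t -> polygon N z r 0 i = polygon N z s 0 i +
    N * (z k.+1 0 i - z k 0 i) * (r - s).
  move=> /andP[sr rt]; rewrite sE (@polygon_edge N z k r) ?(le_trans ks)//=.
    by rewrite !mxE; ring.
  exact: le_trans tk.
rewrite (signature2_rs_regular st (fun i j =>
  rs_regular_affine (aff i) (aff j) (ltW st))).
move: (polygon N z s) (polygon N z t) sE tE => /= ps pt -> ->; congr (_, _, _).
  by apply/rowP => i; rewrite !mxE; ring.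
apply/matrixP => i j; rewrite /tens !mxE big_ord1 !mxE.
rewrite (_ : ord0 = 0 :> 'I_1)//; field; exact: lt0r_neq0.
Qed.

End polygons.

(** * An upper bound for the Carnot-Caratheodory norm *)

Section cc_upper_bound.
Context (R : realType) (d : nat).
Implicit Types (x v a b : 'rV[R]_d) (vs us : seq 'rV[R]_d) (w : 'M[R]_d).

Lemma tensDl x y v : tens (x + y) v = tens x v + tens y v :> 'M[R]_d.
Proof. by rewrite /tens linearD mulmxDl. Qed.

Lemma tensDr x y v : tens v (x + y) = tens v x + tens v y :> 'M[R]_d.
Proof. by rewrite /tens mulmxDr. Qed.

Lemma tensE x y i j : tens x y i j = x 0 i * y 0 j.
Proof. by rewrite /tens mxE big_ord1 mxE. Qed.

Lemma tbracketE x y i j : tbracket x y i j = x 0 i * y 0 j - y 0 i * x 0 j.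
Proof. by rewrite /tbracket !(tensE, mxE). Qed.

(** A word stands for the polygon whose successive edges are its letters. *)
Definition word_sum vs : 'rV[R]_d := \sum_(v <- vs) v.

(** Second level of the product of the exponentials of the letters. *)
Fixpoint word_area vs : 'M[R]_d :=
  if vs is v :: us then 2^-1 *: tens v v + tens v (word_sum us) + word_area us
  else 0.

Lemma word_sum_cat vs us : word_sum (vs ++ us) = word_sum vs + word_sum us.
Proof. by rewrite /word_sum big_cat. Qed.

Lemma word_area_cat vs us :
  word_area (vs ++ us) = word_area vs + tens (word_sum vs) (word_sum us) + word_area us.
Proof.
elim: vs => [|v vs ih] /=.
  by rewrite /word_sum big_nil /tens trmx0 mul0mx !add0r.
rewrite ih word_sum_cat tensDr /word_sum big_cons tensDl -/(word_sum vs) -/(word_sum us).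
by apply/matrixP => i j; rewrite !mxE; ring.
Qed.

Definition word_vertex vs (k : nat) := word_sum (take k vs).

Lemma word_trapezoid vs i j :
  trapezoid_sum (fun k => word_vertex vs k 0 i) (fun k => word_vertex vs k 0 j)
    0 (size vs) = word_area vs i j.
Proof.
elim: vs => [|v us ih]; first by rewrite /trapezoid_sum big_geq//= mxE.
rewrite /trapezoid_sum /= big_nat_recl//.
have vE k : word_vertex (v :: us) k.+1 = v + word_vertex us k.
  by rewrite /word_vertex /word_sum /= big_cons.
have v0 us' : word_vertex us' 0 = 0 by rewrite /word_vertex take0 /word_sum big_nil.
rewrite !mxE -ih vE !v0 addr0.
transitivity ((v 0 i) / 2 * (v 0 j) + \sum_(0 <= k < size us)
   (v 0 i * (word_vertex us k.+1 0 j - word_vertex us k 0 j) +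
   (word_vertex us k 0 i + word_vertex us k.+1 0 i) / 2 *
    (word_vertex us k.+1 0 j - word_vertex us k 0 j))).
  congr (_ + _); first by rewrite !mxE add0r subr0.
  by apply: eq_bigr => k _; rewrite !vE !mxE; field.
rewrite big_split/= -mulr_sumr telescope_sumr// v0 {1}/word_vertex take_size.
rewrite !mxE subr0 !big_ord1 !mxE /trapezoid_sum.
by rewrite (_ : ord0 = 0 :> 'I_1)//; ring.
Qed.

Definition square_loop a b : seq 'rV[R]_d := [:: a; b; - a; - b].

Lemma word_sum_loops (I : Type) (s : seq I) (a b : I -> 'rV[R]_d) :
  word_sum (flatten [seq square_loop (a i) (b i) | i <- s]) = 0.
Proof.
elim: s => [|i s ih]; first by rewrite /word_sum big_nil.
rewrite map_cons -[flatten _]/(square_loop (a i) (b i) ++ flatten _).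
rewrite word_sum_cat ih addr0.
rewrite /word_sum !big_cons big_nil addr0.
by rewrite addrA addrACA !subrr addr0.
Qed.

(** Each loop is closed and encloses the bracket of its sides. *)
Lemma word_area_loops (I : Type) (s : seq I) (a b : I -> 'rV[R]_d) :
  word_area (flatten [seq square_loop (a i) (b i) | i <- s]) =
  \sum_(i <- s) tbracket (a i) (b i).
Proof.
elim: s => [|i s ih]; first by rewrite big_nil.
rewrite map_cons -[flatten _]/(square_loop (a i) (b i) ++ flatten _).
rewrite big_cons -ih word_area_cat word_sum_loops {1}/tens mulmx0 addr0 /=.
congr (_ + _); apply/matrixP => k l.
rewrite /word_sum !big_cons !big_nil /tbracket.
rewrite !(tensE, mxE).
by field.
Qed.

Lemma signature2_word_polygon vs : (0 < size vs)%N ->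
  signature2 (polygon (size vs)%:R (word_vertex vs)) 0 1 =
    (1, word_sum vs, word_area vs).
Proof.
move=> n0; have N0 : 0 < (size vs)%:R :> R by rewrite ltr0n.
have := signature2_polygon (word_vertex vs) N0 n0.
rewrite mul0r divff ?gt_eqF// => ->.
have v0 : word_vertex vs 0 = 0 by rewrite /word_vertex take0 /word_sum big_nil.
rewrite v0 subr0 {1}/word_vertex take_size; congr (_, _, _).
by apply/matrixP => i j; rewrite !mxE mul0r subr0 word_trapezoid.
Qed.

Definition mx_lipschitz (K a b : R) (x : R -> 'rV[R]_d) : Prop :=
  forall u v : R, a <= u -> u <= v -> v <= b -> `|x v - x u| <= K * (v - u).

Lemma mx_lipschitz_cat (K a c b : R) (x : R -> 'rV[R]_d) :
  mx_lipschitz K a c x -> mx_lipschitz K c b x ->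
  mx_lipschitz K a b x.
Proof.
move=> h1 h2 u w au uw wb.
have [wc|cw] := leP w c; first exact: h1.
have [cu|uc] := leP c u; first exact: h2.
have -> : x w - x u = (x w - x c) + (x c - x u) by rewrite addrA subrK.
apply: le_trans (ler_normD _ _) _.
have h3 := h1 _ _ au (ltW uc) (lexx c); have h4 := h2 _ _ (lexx c) (ltW cw) wb.
by lra.
Qed.

Lemma polygon_lipschitz (N r : R) (z : nat -> 'rV[R]_d) n : 0 < N ->
  (forall k, (k < n)%N -> `|z k.+1 - z k| <= r) ->
  mx_lipschitz (N * r) 0 (n%:R / N) (polygon N z).
Proof.
move=> N0; elim: n => [|n ih] zr.
  rewrite mul0r => u w u0 uw w0.
  have -> : u = 0 by apply/le_anti/andP; split => //; exact: le_trans w0.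
  have -> : w = 0 by apply/le_anti/andP; split => //; exact: le_trans uw.
  by rewrite !subrr normr0 mulr0.
apply: mx_lipschitz_cat; first by apply: ih => k kn; apply: zr; exact: ltnW.
move=> u w u0 uw wn.
rewrite (@polygon_edge _ _ N z n u) ?u0 ?(le_trans uw)//.
rewrite (@polygon_edge _ _ N z n w) ?wn ?(le_trans u0)//.
rewrite opprD addrACA subrr add0r -scalerBl -mulrBr opprB addrA subrK normrZ.
rewrite normrM (gtr0_norm N0) ger0_norm ?subr_ge0// [leRHS]mulrAC.
by apply: ler_wpM2l; [rewrite mulr_ge0 ?subr_ge0// ltW|exact: zr].
Qed.

Lemma path_length_lipschitz (K : R) (x : R -> 'rV[R]_d) : 0 <= K -> mx_lipschitz K 0 1 x ->
  (path_length x <= (Num.sqrt d%:R * K)%:E)%E.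
Proof.
move=> K0 xK; apply: ub_ereal_sup => _ [s s01 <-]; rewrite lee_fin.
apply: (@le_trans _ _ (\sum_(0 <= k < size s)
    Num.sqrt d%:R * K * (nth 1 (0 :: s) k.+1 - nth 1 (0 :: s) k))).
  rewrite !big_nat; apply: ler_sum => k /andP[_ ks].
  have /andP[a1 _] := itv_partition_bounds s01 (ltnW ks).
  have /andP[_ b2] := itv_partition_bounds s01 ks.
  apply: le_trans (enorm_le _) _; rewrite mul1n -mulrA.
  apply: ler_wpM2l; first exact: sqrtr_ge0.
  by apply: xK => //; exact/ltW/itv_partition_ltS.
by rewrite -mulr_sumr (partition_telescope idfun s01)/= subr0 mulr1.
Qed.

Lemma mx_lipschitz_continuous (K : R) (x : R -> 'rV[R]_d) : 0 <= K -> mx_lipschitz K 0 1 x ->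
  {within `[0, 1], continuous x}.
Proof.
move=> K0 xK; apply/within_itv_continuousP => u /andP[u0 u1] e e0.
have K1 : 0 < K + 1 by rewrite ltr_wpDl.
exists (e / (K + 1)); first by rewrite divr_gt0.
move=> w /andP[w0 w1] uw.
have h : `|x w - x u| <= K * `|w - u|.
  have [uw'|/ltW wu'] := leP u w.
    by rewrite (ger0_norm (_ : 0 <= w - u)) ?subr_ge0//; exact: xK.
  by rewrite distrC (distrC w) (ger0_norm (_ : 0 <= u - w)) ?subr_ge0//; exact: xK.
apply: le_lt_trans h _; apply: (@le_lt_trans _ _ ((K + 1) * `|w - u|)).
  by apply: ler_wpM2r; rewrite // lerDl.
by rewrite mulrC -ltr_pdivlMr.
Qed.

Lemma cc_norm_word_le vs (r : R) : (0 < size vs)%N -> 0 <= r ->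
  (forall v, v \in vs -> `|v| <= r) ->
  (cc_norm (1%R, word_sum vs, word_area vs) <=
    (Num.sqrt d%:R * ((size vs)%:R * r))%:E)%E.
Proof.
move=> n0 r0 vr; have N0 : 0 < (size vs)%:R :> R by rewrite ltr0n.
have K0 : 0 <= (size vs)%:R * r by rewrite mulr_ge0.
pose x := polygon (size vs)%:R (word_vertex vs).
have xL : mx_lipschitz ((size vs)%:R * r) 0 1 x.
  have := @polygon_lipschitz (size vs)%:R r (word_vertex vs) (size vs) N0.
  rewrite divff ?gt_eqF//; apply => k kn.
  rewrite /word_vertex (take_nth 0 kn) -cats1 word_sum_cat addrAC subrr add0r.
  by rewrite /word_sum big_seq1; apply: vr; exact: mem_nth.
apply: le_trans (path_length_lipschitz K0 xL).
apply: ereal_inf_lbound; exists x => //; split.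
- exact: mx_lipschitz_continuous K0 xL.
- exact: le_lt_trans (path_length_lipschitz K0 xL) (ltry _).
- exact: signature2_word_polygon.
Qed.

Lemma antisymmetric_bracket_sum w : w^T = - w ->
  w = \sum_(ij : 'I_d * 'I_d)
    tbracket ((w ij.1 ij.2 / 2) *: delta_mx 0 ij.1) (delta_mx 0 ij.2).
Proof.
move=> wT; apply/matrixP => k l; rewrite summxE.
have wN i j : w i j = - w j i.
  by have /matrixP/(_ j i) := wT; rewrite !mxE.
rewrite -(pair_bigA _ (fun i j => tbracket ((w i j / 2) *: delta_mx 0 i) (delta_mx 0 j) k l)) /=.
under eq_bigr do under eq_bigr do rewrite tbracketE !mxE !eqxx /=.
transitivity (\sum_(i < d) \sum_(j < d) ((w i j / 2) * ((k == i)%:R * (l == j)%:R)) -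
   \sum_(i < d) \sum_(j < d) ((w i j / 2) * ((k == j)%:R * (l == i)%:R))).
  have pick (a b : 'I_d) : \sum_(i < d) \sum_(j < d)
      ((w i j / 2) * ((a == i)%:R * (b == j)%:R)) = w a b / 2.
    rewrite (bigD1 a)//= [X in _ + X]big1 ?addr0 => [|i ia]; last first.
      by rewrite big1// => j _; rewrite eq_sym (negbTE ia) mul0r mulr0.
    rewrite (bigD1 b)//= big1 ?addr0 => [|i ia]; last first.
      by rewrite [b == i]eq_sym (negbTE ia) !mulr0.
    by rewrite !eqxx !mulr1.
  rewrite pick; under [X in _ - X]eq_bigr do under eq_bigr do rewrite [_%:R * _]mulrC.
  by rewrite pick (wN l k); field.
rewrite -sumrB; apply: eq_bigr => i _; rewrite -sumrB; apply: eq_bigr => j _.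
ring.
Qed.

(** The increment [x] followed by one rectangular loop for each entry of [w] is a
    polygon with [4 d^2 + 1] edges. In the loop of an entry, the sides [r] and
    [w_ij / (2 r)] share the area so that no edge is longer than [r]. *)
Lemma cc_norm_le x w (r : R) : 0 < r -> w^T = - w ->
  `|x| <= r -> `|w| <= r ^+ 2 ->
  (cc_norm (1, x, 2^-1 *: tens x x + w)%R <=
    (Num.sqrt d%:R * (4 * (d * d) + 1)%:R * r)%:E)%E.
Proof.
move=> r0 wT xr wr.
pose a (ij : 'I_d * 'I_d) : 'rV[R]_d := (w ij.1 ij.2 / 2 / r) *: delta_mx 0 ij.1.
pose b (ij : 'I_d * 'I_d) : 'rV[R]_d := r *: delta_mx 0 ij.2.
pose vs := x :: flatten [seq square_loop (a ij) (b ij) | ij <- enum {: 'I_d * 'I_d}].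
have szE : size vs = (4 * (d * d) + 1)%N.
  rewrite /vs /= addn1 size_flatten /shape -map_comp; congr _.+1.
  rewrite (eq_map (_ : _ =1 fun=> 4%N))//.
  rewrite sumnE big_map big_const_seq count_predT -cardE card_prod !card_ord.
  by rewrite iter_addn addn0.
have sumE : word_sum vs = x.
  by rewrite /vs /word_sum big_cons -/(word_sum _) word_sum_loops addr0.
have areaE : word_area vs = 2^-1 *: tens x x + w.
  rewrite /vs /= word_sum_loops {2}/tens mulmx0 addr0 word_area_loops.
  congr (_ + _); rewrite [RHS](antisymmetric_bracket_sum wT) big_enum /=.
  apply: eq_bigr => ij _; apply/matrixP => k l.
  by rewrite /tbracket !(tensE, mxE); field; rewrite gt_eqF.
rewrite -areaE -[x in (_, x, _)]sumE -mulrA -szE.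
apply: cc_norm_word_le; [by []|exact: ltW|].
have delta_le (i : 'I_d) : `|delta_mx 0 i : 'rV[R]_d| <= 1.
  by apply: normr_mx_le => // k l; rewrite mxE; case: (_ && _); rewrite ?normr1 ?normr0.
have a_le ij : `|a ij| <= r.
  rewrite /a normrZ -[leRHS]mulr1; apply: ler_pM => //.
  rewrite !normrM !normfV (gtr0_norm r0) ler_pdivrMr// -expr2.
  apply: le_trans (_ : `|w ij.1 ij.2| <= _).
    by apply: ler_piMr => //; rewrite ger0_norm; lra.
  exact: le_trans (normr_coord_le _ _ _) wr.
have b_le ij : `|b ij| <= r.
  rewrite /b normrZ gtr0_norm// -[leRHS]mulr1; apply: ler_wpM2l => //; exact: ltW.
move=> v; rewrite inE => /predU1P[->//|/flatten_mapP[ij _]].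
by rewrite !inE => /or4P[] /eqP ->; rewrite ?normrN.
Qed.

End cc_upper_bound.

(** * Chaining, trapezoid sums and dyadic times *)

Section dyadic_chaining.
Context (R : realType).
Variables (D : R -> R -> R) (C q : R).
Hypotheses (C0 : 0 <= C) (q0 : 0 <= q) (q1 : q < 1).
Hypothesis D_refl : forall s, D s s = 0.
Hypothesis D_triangle : forall s t u, 0 <= s -> s <= t -> t <= u -> u <= 1 ->
  D s u <= D s t + D t u.
Hypothesis D_dyadic : forall n k, (k < 2 ^ n)%N ->
  D (k%:R / 2 ^+ n) (k.+1%:R / 2 ^+ n) <= C * q ^+ n.

Let pt (n k : nat) : R := k%:R / 2 ^+ n.

Let pt_le n j k : (j <= k)%N -> pt n j <= pt n k.
Proof. by move=> jk; rewrite ler_pM2r ?invr_gt0 ?exprn_gt0// ler_nat. Qed.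

Let pt_ge0 n k : 0 <= pt n k.
Proof. by rewrite divr_ge0 ?exprn_ge0. Qed.

Let pt_le1 n k : (k <= 2 ^ n)%N -> pt n k <= 1.
Proof. by move=> kn; rewrite ler_pdivrMr ?exprn_gt0// mul1r -natrX ler_nat. Qed.

Let pt_double n k : pt n.+1 k.*2 = pt n k.
Proof.
rewrite /pt exprS invfM mulrA -muln2 natrM mulfK//.
Qed.

Let short n j k : (j <= k)%N -> (k <= j.+1)%N -> (k <= 2 ^ n)%N ->
  D (pt n j) (pt n k) <= C * q ^+ n.
Proof.
move=> jk kj kn; have [->|/eqP jk'] := eqVneq j k.
  by rewrite D_refl mulr_ge0// exprn_ge0.
have e : k = j.+1 by move: jk kj jk'; lia.
by rewrite e; apply: D_dyadic; rewrite -e.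
Qed.

(** Rounding [a] up and [b] down to even numerators reduces [n] by one, at the price
    of two intervals of generation [n]; the prices form a geometric series. *)
Lemma chaining_dyadic m n a b : (m <= n)%N -> (a <= b)%N -> (b <= 2 ^ n)%N ->
  (b - a <= 2 ^ (n - m))%N ->
  D (a%:R / 2 ^+ n) (b%:R / 2 ^+ n) <= 2 * C / (1 - q) * q ^+ m.
Proof.
move=> mn ab bn bam.
have geo k : \sum_(0 <= i < k) q ^+ i <= (1 - q)^-1.
  have := @geometric_seriesE R 1 q; rewrite lt_eqF// => /(_ isT).
  move=> /(congr1 (fun f => f k)); rewrite /series /= mul1r.
  under eq_bigr do rewrite mul1r.
  move=> ->; rewrite ler_piMl ?invr_ge0 ?subr_ge0 ?(ltW q1)//.
  by rewrite gerBl exprn_ge0.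
suff H : D (pt n a) (pt n b) <=
    2 * C * q ^+ m * \sum_(0 <= i < (n - m).+1) q ^+ i.
  apply: le_trans H _; rewrite [leRHS]mulrAC; apply: ler_wpM2l; last exact: geo.
  by rewrite !mulr_ge0// exprn_ge0.
move: mn a b ab bn bam => /subnK <-.
elim: (n - m)%N => [|l ih] a b ab bn.
  rewrite addnK add0n in bn *; rewrite big_nat1 expr0 mulr1 => bam.
  apply: le_trans (@short m a b _ _ _) _ => //; first by move: bam; rewrite expn0; lia.
  rewrite -mulrA ler_peMl ?mulr_ge0 ?exprn_ge0//; lra.
rewrite !addnK in ih *; rewrite addSn => bam.
have sumS : 2 * C * q ^+ m * \sum_(0 <= i < l.+2) q ^+ i =
    C * q ^+ (l + m).+1 + (2 * C * q ^+ m * \sum_(0 <= i < l.+1) q ^+ i) +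
    C * q ^+ (l + m).+1.
  by rewrite [in LHS]big_nat_recr//= -addSn exprD; ring.
have [a'b'|b'a'] := leqP (uphalf a) (b./2); last first.
  have -> : a = b by move: ab b'a'; lia.
  rewrite D_refl !mulr_ge0 ?exprn_ge0//.
  by apply: sumr_ge0 => i _; rewrite exprn_ge0.
have a1 : (a <= (uphalf a).*2)%N by lia.
have a2 : ((uphalf a).*2 <= a.+1)%N by lia.
have b1 : ((b./2).*2 <= b)%N by lia.
have b2 : (b <= (b./2).*2.+1)%N by lia.
have a'b'2 : ((uphalf a).*2 <= (b./2).*2)%N by rewrite leq_double.
have bn' : (b./2 <= 2 ^ (l + m))%N by move: bn; rewrite addSn expnS; lia.
have aN : ((uphalf a).*2 <= 2 ^ (l + m).+1)%N by rewrite expnS; lia.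
rewrite sumS.
apply: le_trans (D_triangle (pt_ge0 _ _) (pt_le _ (leq_trans a1 a'b'2))
  (pt_le _ b1) (pt_le1 bn)) _.
apply: lerD; last exact: short.
have b1' := leq_trans b1 bn; rewrite addSn in b1'.
apply: le_trans (D_triangle (pt_ge0 _ _) (pt_le _ a1) (pt_le _ a'b'2) (pt_le1 b1')) _.
apply: lerD; first exact: short.
rewrite !pt_double; apply: ih => //.
have : (2 ^ l.+1 = 2 * 2 ^ l)%N by rewrite expnS.
by move: bam; lia.
Qed.

Lemma chaining_hoelder beta n a b : 0 < beta -> q = 2^-1 `^ beta ->
  (a < b)%N -> (b <= 2 ^ n)%N ->
  D (a%:R / 2 ^+ n) (b%:R / 2 ^+ n) <=
    2 * C / (1 - q) * 2 `^ beta * (b%:R / 2 ^+ n - a%:R / 2 ^+ n) `^ beta.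
Proof.
move=> beta0 qE ab bn.
set u := b%:R / 2 ^+ n - a%:R / 2 ^+ n.
have uE : u = (b - a)%:R / 2 ^+ n by rewrite /u -mulrBl natrB// ltnW.
have u0 : 0 < u by rewrite uE divr_gt0 ?exprn_gt0// ltr0n subn_gt0.
have u1 : u <= 1.
  by rewrite uE; apply: pt_le1; apply: leq_trans bn; exact: leq_subr.
have [m /andP[um1 um2]] := dyadic_bracket u0 u1.
have two0 k : 0 < 2 ^+ k :> R by rewrite exprn_gt0.
have mn : (m <= n)%N.
  rewrite leqNgt; apply/negP => nm.
  have : u <= 2^-1 ^+ n.+1.
    by apply: le_trans um2 _; apply: ler_wiXn2l => //; lra.
  rewrite uE ler_pdivrMr// exprS -mulrA -exprMn mulVf// expr1n mulr1.
  have : 1 <= (b - a)%:R :> R by rewrite ler1n subn_gt0.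
  by lra.
have bam : (b - a <= 2 ^ (n - m))%N.
  move: um2; rewrite uE ler_pdivrMr// -{1}(subnK mn) exprD mulrCA -exprMn.
  by rewrite mulVf// expr1n mulr1 -natrX ler_nat.
apply: le_trans (chaining_dyadic mn (ltnW ab) bn bam) _.
rewrite -[leRHS]mulrA; apply: ler_wpM2l.
  by rewrite mulr_ge0 ?invr_ge0 ?subr_ge0 ?(ltW q1)// mulr_ge0.
rewrite qE -powR_expn ?invr_ge0// -powRM ?(ltW u0)//.
apply: ge0_ler_powR; rewrite ?nnegrE ?exprn_ge0 ?mulr_ge0 ?(ltW u0) ?(ltW beta0) ?invr_ge0//.
by move: um1; rewrite exprS; lra.
Qed.

End dyadic_chaining.

Section decay_of_logarithmic_bounds.
Context (R : realType).

(** Each of the [m + 1] first terms of the geometric series is at least [r^m]. *)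
Lemma succn_exp_le (r : R) m : 0 <= r < 1 -> m.+1%:R * r ^+ m <= (1 - r)^-1.
Proof.
move=> /andP[r0 r1].
have := @geometric_seriesE R 1 r; rewrite lt_eqF// => /(_ isT).
move=> /(congr1 (fun f => f m.+1)); rewrite /series /= mul1r.
under eq_bigr do rewrite mul1r.
move=> E; apply: (@le_trans _ _ ((1 - r ^+ m.+1) / (1 - r))); last first.
  by rewrite ler_piMl ?invr_ge0 ?subr_ge0 ?(ltW r1)// gerBl exprn_ge0.
rewrite -E -[m.+1 in leLHS]subn0 mulr_natl -sumr_const_nat !big_nat.
apply: ler_sum => i /andP[_ im]; apply: ler_wiXn2l => //; exact: ltW.
Qed.

Lemma sqrt_half_exp (m : nat) : Num.sqrt (2^-1 ^+ m) = (2^-1 `^ 2^-1) ^+ m :> R.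
Proof. by rewrite -powR12_sqrt ?exprn_ge0// powR_expn. Qed.

End decay_of_logarithmic_bounds.

Section trapezoid_refinement.
Context (R : realType).
Implicit Types (u v : nat -> R).

(** Integration by parts, which the trapezoid rule satisfies exactly. *)
Lemma trapezoid_sum_sym u v a b : (a <= b)%N ->
  trapezoid_sum u v a b + trapezoid_sum v u a b = u b * v b - u a * v a.
Proof.
move=> ab; rewrite -(telescope_sumr (fun k => u k * v k) ab) -big_split /=.
by apply: eq_bigr => k _; field.
Qed.

(** Bisecting a cell changes its trapezoid by one half of the antisymmetric area
    spanned by its two halves. *)
Lemma trapezoid_sum_refine u v a b :
  trapezoid_sum u v a.*2 b.*2 - trapezoid_sum (fun k => u k.*2) (fun k => v k.*2) a b =
  2^-1 * \sum_(a <= l < b) ((u l.*2.+1 - u l.*2) * (v l.*2.+2 - v l.*2.+1) -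
                            (u l.*2.+2 - u l.*2.+1) * (v l.*2.+1 - v l.*2)).
Proof.
have [ba|ab] := leqP b a.
  by rewrite /trapezoid_sum !big_geq ?leq_double// subrr mulr0.
rewrite /trapezoid_sum mulr_sumr -(subnK (ltnW ab)); elim: (b - a)%N => [|n ih].
  by rewrite add0n !big_geq// subrr.
have na : (a <= n + a)%N by rewrite leq_addl.
have na2 : (a.*2 <= (n + a).*2)%N by rewrite leq_double.
rewrite addSn doubleS [in RHS]big_nat_recr//= -ih.
rewrite [X in _ - X = _]big_nat_recr//=.
rewrite [X in X - _ = _]big_nat_recr/=; last exact: leq_trans na2 (leqnSn _).
rewrite [X in X + _ - _ = _]big_nat_recr//=.
by rewrite [(n + a).+1.*2]doubleS; field.
Qed.

End trapezoid_refinement.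

Section dyadic_density.
Context (R : realType).

Definition dyadic_floor (n : nat) (s : R) : R := (Num.truncn (2 ^+ n * s))%:R / 2 ^+ n.

Lemma dyadic_floor_le n s : 0 <= s -> dyadic_floor n s <= s.
Proof.
move=> s0; have h : 0 <= 2 ^+ n * s by rewrite mulr_ge0// exprn_ge0.
by rewrite /dyadic_floor ler_pdivrMr ?exprn_gt0// [leRHS]mulrC truncn_le.
Qed.

Lemma dyadic_floor_gt n s : 0 <= s -> s - dyadic_floor n s < 2^-1 ^+ n.
Proof.
move=> s0; have h : 0 <= 2 ^+ n * s by rewrite mulr_ge0// exprn_ge0.
rewrite /dyadic_floor ltrBlDr exprVn -[X in X + _]mul1r -mulrDl ltr_pdivlMr ?exprn_gt0//.
by rewrite mulrC nat1r truncnS_gt.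
Qed.

Lemma truncn_dyadic_le n (s : R) : s <= 1 -> (Num.truncn (2 ^+ n * s) <= 2 ^ n)%N.
Proof.
move=> s1; rewrite truncn_le_nat -[(2 ^ n).+1%:R]natr1 natrX.
have : 2 ^+ n * s <= 2 ^+ n by rewrite ler_piMr// exprn_ge0.
by move=> h; rewrite (le_lt_trans h)// ltrDl.
Qed.

Lemma dyadic_floor_cvg s : 0 <= s -> dyadic_floor n s @[n --> \oo] --> s.
Proof.
move=> s0; apply/cvgrPdist_lt => e e0.
have [N _ hN] := near_infty_natSinv_expn_lt (PosNum e0).
exists N => // n /= Nn.
have := hN n Nn; rewrite div1r -exprVn.
apply: lt_trans; rewrite ger0_norm ?dyadic_floor_gt//.
by rewrite subr_ge0 dyadic_floor_le.
Qed.

Lemma within_cvg_seq (f : R -> R) (u : nat -> R) (s : R) :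
  {within `[0, 1], continuous f} -> 0 <= s <= 1 -> (forall n, 0 <= u n <= 1) ->
  u n @[n --> \oo] --> s -> f (u n) @[n --> \oo] --> f s.
Proof.
move=> /within_itv_continuousP fc s01 u01 us; apply/cvgrPdist_lt => e e0.
have [del del0 h] := fc s s01 e e0.
move/cvgrPdist_lt: us => /(_ del del0); apply: filterS => n un.
by rewrite distrC; apply: h => //; rewrite distrC.
Qed.

Lemma dyadic_floor01 n s : 0 <= s <= 1 -> 0 <= dyadic_floor n s <= 1.
Proof.
move=> /andP[s0 s1]; rewrite divr_ge0 ?exprn_ge0//=.
exact: le_trans (dyadic_floor_le n s0) s1.
Qed.

Lemma eq_on_dyadics (f : R -> R) (c : R) : {within `[0, 1], continuous f} ->
  (forall n k, (k <= 2 ^ n)%N -> f (k%:R / 2 ^+ n) = c) ->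
  forall s : R, 0 <= s <= 1 -> f s = c.
Proof.
move=> fc fd s s01; have /andP[s0 s1] := s01.
have h := within_cvg_seq fc s01 (fun n => @dyadic_floor01 n s s01) (dyadic_floor_cvg s0).
have h2 : f (dyadic_floor n s) @[n --> \oo] --> c.
  by apply: cvg_near_cst; apply: nearW => n; rewrite fd ?truncn_dyadic_le.
exact: (cvg_unique _ h h2).
Qed.

End dyadic_density.

(** * Regularity of the enhanced path *)

Section sample_path.
Context (R : realType) (d : nat).
Variables (x : R -> 'rV[R]_d) (Y : R -> 'M[R]_d).
Hypothesis Y0 : Y 0 = 0.
Hypothesis x0 : x 0 = 0.
Hypothesis xc : {within `[0, 1], continuous x}.
Hypothesis Yc : forall a b, {within `[0, 1], continuous (fun t => Y t a b)}.
Hypothesis dx_bound : exists2 C : R, 0 <= C & forall m k a, (k < 2 ^ m)%N ->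
  `|dyadic_incr x m k a| <= C * m.+1%:R * Num.sqrt (2^-1 ^+ m).
Hypothesis area_bound : exists2 C : R, 0 <= C & forall m j i a b, (j <= m)%N ->
  (i < 2 ^ j)%N -> `|\sum_(i * 2 ^ (m - j) <= l < i.+1 * 2 ^ (m - j))
    cell_area x m l a b| <= C * m.+1%:R * Num.sqrt (2^-1 ^+ (m + j)).

Definition dyadic_trapezoid (m j i : nat) (a b : 'I_d) : R :=
  trapezoid_sum (fun k => x (k%:R / 2 ^+ m) 0 a) (fun k => x (k%:R / 2 ^+ m) 0 b)
    (i * 2 ^ (m - j)) (i.+1 * 2 ^ (m - j)).

(** Only a limit point is asked for, as convergence in probability provides it;
    convergence follows from [area_bound]. *)
Hypothesis Y_approx : forall j i a b, (i < 2 ^ j)%N -> forall e : R, 0 < e ->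
  forall M, exists m, [/\ (M <= m)%N, (j <= m)%N &
    `|dyadic_trapezoid m j i a b -
      (Y (i.+1%:R / 2 ^+ j) a b - Y (i%:R / 2 ^+ j) a b)| < e].

Variable beta : R.
Hypothesis beta0 : 0 < beta.
Hypothesis beta_lt : beta < 2^-1.

(** In [2^(-m/2) = q^m r^m] the factor [r^m = rho^m rho^m] is to spare: one [rho^m]
    absorbs the factor [m + 1] and the other one remains as a decay in [m]. *)
Let q : R := 2^-1 `^ beta.
Let r : R := 2^-1 `^ (2^-1 - beta).
Let rho : R := 2^-1 `^ ((2^-1 - beta) / 2).

Let q01 : 0 < q < 1. Proof. exact: half_powR_lt1. Qed.
Let q0 : 0 < q. Proof. by have /andP[] := q01. Qed.
Let q1 : q < 1. Proof. by have /andP[] := q01. Qed.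
Let r01 : 0 < r < 1. Proof. by apply: half_powR_lt1; rewrite subr_gt0. Qed.
Let r0 : 0 < r. Proof. by have /andP[] := r01. Qed.
Let r1 : r < 1. Proof. by have /andP[] := r01. Qed.
Let rho01 : 0 < rho < 1.
Proof. by apply: half_powR_lt1; rewrite divr_gt0// subr_gt0. Qed.
Let rho0 : 0 < rho. Proof. by have /andP[] := rho01. Qed.
Let rho1 : rho < 1. Proof. by have /andP[] := rho01. Qed.

Let half_qr : 2^-1 `^ 2^-1 = q * r.
Proof. by rewrite /q /r -powRD ?subrKC// implybE orbC invr_eq0 pnatr_eq0. Qed.

Let r_rho : r = rho * rho.
Proof. by rewrite /r /rho -powRD -?splitr// implybE orbC invr_eq0 pnatr_eq0. Qed.

Let pt (m k : nat) : R := k%:R / 2 ^+ m.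

Let pt01 m k : (k <= 2 ^ m)%N -> 0 <= pt m k <= 1.
Proof.
move=> km; rewrite divr_ge0//= ?exprn_ge0// ler_pdivrMr ?exprn_gt0// mul1r.
by rewrite -natrX ler_nat.
Qed.

Let pt_mul m n k : pt (m + n) (k * 2 ^ m) = pt n k.
Proof.
rewrite /pt natrM natrX exprD [X in X / _]mulrC -mulf_div divff ?mul1r//.
Qed.

Lemma dyadic_increment_decay : exists2 C : R, 0 <= C & forall m k, (k < 2 ^ m)%N ->
  `|x (k.+1%:R / 2 ^+ m) - x (k%:R / 2 ^+ m)| <= C * q ^+ m.
Proof.
have [C C0 hC] := dx_bound.
exists (C * (1 - r)^-1); first by rewrite mulr_ge0// invr_ge0 subr_ge0 ltW.
move=> m k km; apply: normr_mx_le => [|i a].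
  by rewrite !mulr_ge0 ?invr_ge0 ?subr_ge0 ?exprn_ge0 ?(ltW q0) ?(ltW r1).
rewrite (ord1 i) !mxE; apply: le_trans (hC m k a km) _.
rewrite sqrt_half_exp half_qr exprMn.
have := @succn_exp_le R r m; rewrite (ltW r0) r1 => /(_ isT) h.
rewrite (_ : _ * (q ^+ m * r ^+ m) = C * (m.+1%:R * r ^+ m) * q ^+ m); last by ring.
by apply: ler_wpM2r; [rewrite exprn_ge0// ltW|apply: ler_wpM2l].
Qed.

(** The second level over the [i]-th dyadic interval of generation [j] of the
    lift of the [m]-th dyadic interpolation. *)
Definition interp_area (m j i : nat) (a b : 'I_d) : R :=
  dyadic_trapezoid m j i a b - x (i%:R / 2 ^+ j) 0 a *
    (x (i.+1%:R / 2 ^+ j) 0 b - x (i%:R / 2 ^+ j) 0 b).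

(** The second level of the increment of [(1, x, Y)] over [s, t]. *)
Definition area_incr (s t : R) : 'M[R]_d := Y t - Y s - tens (x s) (x t - x s).

Let interp_area_step m j i a b : (j <= m)%N ->
  interp_area m.+1 j i a b - interp_area m j i a b =
  2^-1 * \sum_(i * 2 ^ (m - j) <= l < i.+1 * 2 ^ (m - j)) cell_area x m l a b.
Proof.
move=> jm; have dbl k : (k * 2 ^ (m.+1 - j) = (k * 2 ^ (m - j)).*2)%N.
  by rewrite subSn// expnS -mul2n mulnCA.
have ptS k : x (k.*2%:R / 2 ^+ m.+1) = x (k%:R / 2 ^+ m).
  by have := pt_mul 1 m k; rewrite /pt add1n expn1 muln2 => ->.
have := trapezoid_sum_refine (fun k => x (k%:R / 2 ^+ m.+1) 0 a)
  (fun k => x (k%:R / 2 ^+ m.+1) 0 b) (i * 2 ^ (m - j)) (i.+1 * 2 ^ (m - j)).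
rewrite -!dbl (_ : (fun k => x (k.*2%:R / 2 ^+ m.+1) 0 a) =
    fun k => x (k%:R / 2 ^+ m) 0 a); last by apply/funext => k; rewrite ptS.
rewrite (_ : (fun k => x (k.*2%:R / 2 ^+ m.+1) 0 b) =
    fun k => x (k%:R / 2 ^+ m) 0 b); last by apply/funext => k; rewrite ptS.
move=> <-; rewrite /interp_area /dyadic_trapezoid; ring.
Qed.

Let interp_area_cauchy : exists2 C : R, 0 <= C & forall m n j i a b, (j <= m)%N ->
  (i < 2 ^ j)%N ->
  `|interp_area (n + m) j i a b - interp_area m j i a b| <= C * q ^+ (2 * j) * rho ^+ m.
Proof.
have [C C0 hC] := area_bound.
have irho : 0 <= (1 - rho)^-1 by rewrite invr_ge0 subr_ge0 ltW.
pose K := C * (1 - rho)^-1.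
have K0 : 0 <= K by rewrite mulr_ge0.
have step m j i a b : (j <= m)%N -> (i < 2 ^ j)%N ->
    `|interp_area m.+1 j i a b - interp_area m j i a b| <= K * q ^+ (2 * j) * rho ^+ m.
  move=> jm ij; rewrite interp_area_step// normrM.
  apply: (@le_trans _ _ (1 * (C * m.+1%:R * Num.sqrt (2^-1 ^+ (m + j))))).
    by apply: ler_pM => //; [rewrite ger0_norm; lra|exact: hC].
  rewrite mul1r sqrt_half_exp half_qr exprMn (exprD q m j) (exprD r m j).
  have := @succn_exp_le R rho m; rewrite (ltW rho0) rho1 => /(_ isT) h.
  have rm : r ^+ m = rho ^+ m * rho ^+ m by rewrite r_rho exprMn.
  have rj : 0 <= r ^+ j <= 1 by rewrite exprn_ge0 ?exprn_ile1 ?(ltW r0) ?(ltW r1).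
  have qm : 0 <= q ^+ m <= q ^+ j.
    by rewrite exprn_ge0 ?(ltW q0)//=; apply: ler_wiXn2l => //; exact: ltW.
  have qj : 0 <= q ^+ j by rewrite exprn_ge0// ltW.
  have rhom : 0 <= rho ^+ m by rewrite exprn_ge0// ltW.
  have -> : C * m.+1%:R * (q ^+ m * q ^+ j * (r ^+ m * r ^+ j)) =
      (C * (m.+1%:R * rho ^+ m)) * ((q ^+ m * q ^+ j) * rho ^+ m) * r ^+ j.
    by rewrite rm; ring.
  have -> : K * q ^+ (2 * j) * rho ^+ m = K * ((q ^+ j * q ^+ j) * rho ^+ m) * 1.
    by rewrite mul2n -addnn exprD; ring.
  case/andP: rj => rj0 rj1; case/andP: qm => qm0 qm1.
  apply: ler_pM => //; first by rewrite !mulr_ge0.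
  apply: ler_pM; rewrite ?mulr_ge0//; first exact: ler_wpM2l.
  by apply: ler_wpM2r => //; apply: ler_wpM2r.
exists (K * (1 - rho)^-1); first by rewrite mulr_ge0.
move=> m n j i a b jm ij.
have H : `|interp_area (n + m) j i a b - interp_area m j i a b| <=
    K * q ^+ (2 * j) * rho ^+ m * \sum_(0 <= k < n) rho ^+ k.
  elim: n => [|n ih]; first by rewrite add0n subrr normr0 big_geq// mulr0.
  rewrite big_nat_recr//= mulrDr.
  rewrite (_ : interp_area (n.+1 + m) j i a b - _ =
    (interp_area (n + m) j i a b - interp_area m j i a b) +
    (interp_area (n + m).+1 j i a b - interp_area (n + m) j i a b)); last first.
    by rewrite addSn; ring.
  apply: le_trans (ler_normD _ _) _; apply: lerD => //.
  apply: le_trans (step _ _ _ _ _ _ ij) _; first by rewrite (leq_trans jm)// leq_addl.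
  by rewrite exprD mulrA mulrAC.
apply: le_trans H _.
rewrite (_ : K * (1 - rho)^-1 * _ * _ = K * q ^+ (2 * j) * rho ^+ m * (1 - rho)^-1); last by ring.
apply: ler_wpM2l; first by rewrite !mulr_ge0 ?exprn_ge0 ?(ltW q0) ?(ltW rho0).
have := @geometric_seriesE R 1 rho; rewrite lt_eqF// => /(_ isT).
move=> /(congr1 (fun f => f n)); rewrite /series /= mul1r.
under eq_bigr do rewrite mul1r.
by move=> ->; rewrite ler_piMl// gerBl exprn_ge0// ltW.
Qed.

Lemma interp_area_decay : exists2 C : R, 0 <= C & forall m j i a b, (j <= m)%N ->
  (i < 2 ^ j)%N ->
  `|area_incr (i%:R / 2 ^+ j) (i.+1%:R / 2 ^+ j) a b - interp_area m j i a b|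
    <= C * q ^+ (2 * j) * rho ^+ m.
Proof.
have [C C0 hC] := interp_area_cauchy.
exists C => // m j i a b jm ij; apply/ler_addgt0Pr => e e0.
have [m' [mm' jm' he]] := Y_approx a b ij e0 m.
have h := hC m (m' - m)%N j i a b jm ij; rewrite (subnK mm') in h.
have -> : area_incr (i%:R / 2 ^+ j) (i.+1%:R / 2 ^+ j) a b - interp_area m j i a b =
    (interp_area m' j i a b - interp_area m j i a b) -
    (dyadic_trapezoid m' j i a b -
      (Y (i.+1%:R / 2 ^+ j) a b - Y (i%:R / 2 ^+ j) a b)).
  by rewrite /area_incr /interp_area !(tensE, mxE); ring.
by apply: le_trans (ler_normB _ _) _; apply: lerD => //; exact: ltW.
Qed.

Let interp_area_diag j i a b :
  interp_area j j i a b = (x (i.+1%:R / 2 ^+ j) 0 a - x (i%:R / 2 ^+ j) 0 a) *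
    (x (i.+1%:R / 2 ^+ j) 0 b - x (i%:R / 2 ^+ j) 0 b) / 2.
Proof.
rewrite /interp_area /dyadic_trapezoid subnn expn0 !muln1 /trapezoid_sum big_nat1.
by field.
Qed.

Lemma area_incr_decay : exists2 C : R, 0 <= C & forall j i, (i < 2 ^ j)%N ->
  `|area_incr (i%:R / 2 ^+ j) (i.+1%:R / 2 ^+ j)| <= C * q ^+ (2 * j).
Proof.
have [C1 C10 h1] := dyadic_increment_decay.
have [C2 C20 h2] := interp_area_decay.
have C0 : 0 <= C1 ^+ 2 + C2 by rewrite addr_ge0// sqr_ge0.
exists (C1 ^+ 2 + C2) => // j i ij.
have qj : 0 <= q ^+ (2 * j) by rewrite exprn_ge0// ltW.
apply: normr_mx_le => [|a b]; first by rewrite mulr_ge0.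
rewrite -[X in `|X|](subrK (interp_area j j i a b)) addrC.
apply: le_trans (ler_normD _ _) _; rewrite mulrDl; apply: lerD; last first.
  apply: le_trans (h2 j j i a b (leqnn _) ij) _.
  by rewrite ler_piMr ?mulr_ge0// exprn_ile1// ltW.
have dx c := le_trans (normr_coord_le (x (i.+1%:R / 2 ^+ j) - x (i%:R / 2 ^+ j)) 0 c)
  (h1 j i ij).
have := dx a; have := dx b; rewrite !mxE => hb ha.
rewrite interp_area_diag !normrM.
apply: (@le_trans _ _ (C1 * q ^+ j * (C1 * q ^+ j) * 1)).
  apply: ler_pM; rewrite ?mulr_ge0//; last by rewrite ger0_norm; lra.
  by apply: ler_pM.
by rewrite mulr1 mulrACA -expr2 -exprD addnn mul2n.
Qed.

Let eq0_of_decay (v K : R) n : (forall m, (n <= m)%N -> `|v| <= K * rho ^+ m) -> v = 0.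
Proof.
move=> h; apply/normr0_eq0/le_anti; rewrite normr_ge0 andbT.
have : (geometric K rho) @ \oo --> 0.
  by apply: cvg_geometric; rewrite ger0_norm// ltW.
move=> /cvgr_to_ge; apply; exists n => // m /= nm; exact: h.
Qed.

Let xac a : {within `[0, 1], continuous (fun t => x t 0 a)}.
Proof.
apply/within_itv_continuousP => s s01 e e0.
have [del del0 h] := (within_itv_continuousP 0 1 x).1 xc s s01 e e0.
exists del => // t t01 ts; apply: le_lt_trans (h t t01 ts).
by have := normr_coord_le (x t - x s) 0 a; rewrite !mxE.
Qed.

(** The approximating areas satisfy integration by parts; at dyadic times the
    identity follows by letting [m] tend to infinity, and elsewhere by
    continuity. *)
Lemma second_level_symmetric t a b : 0 <= t <= 1 ->
  Y t a b + Y t b a = x t 0 a * x t 0 b.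
Proof.
have [C C0 hC] := interp_area_decay.
pose Z t := Y t a b + Y t b a - x t 0 a * x t 0 b.
have Zc : {within `[0, 1], continuous Z}.
  move=> s; apply: cvgB; [apply: cvgD; exact: Yc|apply: cvgM; exact: xac].
have Z0 n k : (k <= 2 ^ n)%N -> Z (k%:R / 2 ^+ n) = 0.
  elim: k => [_|k ih kn]; first by rewrite mul0r /Z Y0 x0 !mxE mul0r addr0 subr0.
  rewrite -[LHS]subr0 -[X in _ - X](ih (ltnW kn)).
  apply: (@eq0_of_decay _ (2 * (C * q ^+ (2 * n))) n) => m nm.
  set s := k%:R / 2 ^+ n; set u := k.+1%:R / 2 ^+ n.
  have sym : interp_area m n k a b + interp_area m n k b a =
      (x u 0 a - x s 0 a) * (x u 0 b - x s 0 b).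
    rewrite /interp_area /dyadic_trapezoid addrACA trapezoid_sum_sym; last first.
      by rewrite leq_mul2r leqnSn orbT.
    have E i : x ((i * 2 ^ (m - n))%:R / 2 ^+ m) = x (i%:R / 2 ^+ n).
      by have := pt_mul (m - n) n i; rewrite /pt subnK// => ->.
    by rewrite !E -/s -/u; ring.
  have -> : Z u - Z s = (area_incr s u a b - interp_area m n k a b) +
      (area_incr s u b a - interp_area m n k b a).
    rewrite addrACA -opprD sym /area_incr /Z !(tensE, mxE); ring.
  apply: le_trans (ler_normD _ _) _.
  by rewrite -mulrA mulr_natl mulr2n; apply: lerD; apply: hC.
move=> t01; apply/eqP; rewrite -subr_eq0; apply/eqP.
exact: (eq_on_dyadics Zc Z0 t01).
Qed.

(** A homogeneous size of the increment over [s, t]. The factor 2 makes it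
    subadditive: by the relation of Chen, the second levels of two consecutive
    increments add up to within the product of their first levels. *)
Let Dhom (s t : R) : R := Num.max `|x t - x s| (Num.sqrt (2 * `|area_incr s t|)).

Let area_incr_chen s t u :
  area_incr s u = area_incr s t + area_incr t u + tens (x t - x s) (x u - x t).
Proof. by apply/matrixP => a b; rewrite /area_incr !(tensE, mxE); ring. Qed.

Let Dhom_area s t : 2 * `|area_incr s t| <= Dhom s t ^+ 2.
Proof.
rewrite -[leLHS]sqr_sqrtr ?mulr_ge0// lerXn2r ?nnegrE ?sqrtr_ge0//.
  by rewrite /Dhom le_max sqrtr_ge0 orbT.
by rewrite /Dhom le_max lexx orbT.
Qed.

Let Dhom_ge0 s t : 0 <= Dhom s t.
Proof. by rewrite /Dhom le_max normr_ge0. Qed.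

Let Dhom_triangle s t u : Dhom s u <= Dhom s t + Dhom t u.
Proof.
have d1 : `|x t - x s| <= Dhom s t by rewrite /Dhom le_max lexx.
have d2 : `|x u - x t| <= Dhom t u by rewrite /Dhom le_max lexx.
rewrite {1}/Dhom ge_max; apply/andP; split.
  have -> : x u - x s = (x t - x s) + (x u - x t) by rewrite [RHS]addrC addrA subrK.
  by apply: le_trans (ler_normD _ _) _; apply: lerD.
rewrite -[leRHS]ger0_norm ?addr_ge0// -sqrtr_sqr ler_wsqrtr//.
have h1 := Dhom_area s t; have h2 := Dhom_area t u.
have h3 : `|tens (x t - x s) (x u - x t)| <= Dhom s t * Dhom t u.
  by apply: le_trans (normr_tens_le _ _) _; apply: ler_pM.
have h4 : `|area_incr s u| <= `|area_incr s t| + `|area_incr t u| +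
    `|tens (x t - x s) (x u - x t)|.
  rewrite (area_incr_chen s t u); apply: le_trans (ler_normD _ _) _.
  by rewrite lerD2r ler_normD.
by rewrite sqrrD; lra.
Qed.

Let Dhom_dyadic : exists2 C : R, 0 <= C & forall n k, (k < 2 ^ n)%N ->
  Dhom (k%:R / 2 ^+ n) (k.+1%:R / 2 ^+ n) <= C * q ^+ n.
Proof.
have [C1 C10 h1] := dyadic_increment_decay.
have [C2 C20 h2] := area_incr_decay.
have qn n : 0 <= q ^+ n by rewrite exprn_ge0// ltW.
exists (C1 + Num.sqrt (2 * C2)); first by rewrite addr_ge0// sqrtr_ge0.
move=> n k kn; rewrite /Dhom ge_max; apply/andP; split.
  apply: le_trans (h1 n k kn) _; apply: ler_wpM2r => //.
  by rewrite lerDl sqrtr_ge0.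
apply: (@le_trans _ _ (Num.sqrt (2 * C2) * q ^+ n)); last first.
  by apply: ler_wpM2r => //; rewrite lerDr.
rewrite -[X in _ <= _ * X]ger0_norm// -sqrtr_sqr -sqrtrM ?mulr_ge0//.
apply: ler_wsqrtr; rewrite -mulrA; apply: ler_wpM2l => //.
by apply: le_trans (h2 n k kn) _; rewrite -exprM mulnC.
Qed.

(** Chaining gives the estimate for [Dhom] at dyadic times; those converging to [s]
    and [t] are rounded down at the same generation. *)
Lemma sample_path_hoelder : exists2 K : R, 0 <= K &
  forall s t, 0 <= s -> s < t -> t <= 1 ->
    `|x t - x s| <= K * (t - s) `^ beta /\
    `|area_incr s t| <= (K * (t - s) `^ beta) ^+ 2.
Proof.
have [C C0 hC] := Dhom_dyadic.
pose K := 2 * C / (1 - q) * 2 `^ beta.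
have K0 : 0 <= K.
  by rewrite !mulr_ge0 ?powR_ge0 ?invr_ge0 ?subr_ge0 ?(ltW q1).
exists (K * 2 `^ beta); first by rewrite mulr_ge0 ?powR_ge0.
move=> s t s0 st t1.
have s01 : 0 <= s <= 1 by rewrite s0 (ltW (lt_le_trans st t1)).
have t0 : 0 <= t by exact: le_trans (ltW st).
have t01 : 0 <= t <= 1 by rewrite t1 t0.
pose u n := dyadic_floor n s; pose v n := dyadic_floor n t.
have u01 n : 0 <= u n <= 1 by exact: dyadic_floor01.
have v01 n : 0 <= v n <= 1 by exact: dyadic_floor01.
have us : u n @[n --> \oo] --> s by exact: dyadic_floor_cvg.
have vt : v n @[n --> \oo] --> t by exact: dyadic_floor_cvg.
rewrite -mulrA -powRM ?subr_ge0 ?(ltW st)//; set L := K * _.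
have L0 : 0 <= L by rewrite mulr_ge0// powR_ge0.
have DL : \forall n \near \oo, Dhom (u n) (v n) <= L.
  have : (v n - u n) @[n --> \oo] --> t - s by exact: cvgB.
  move=> /cvgr_lt /(_ (2 * (t - s))); have tt : t - s < 2 * (t - s) by lra.
  move=> /(_ tt); apply: filterS => n uv.
  have : (Num.truncn (2 ^+ n * s) <= Num.truncn (2 ^+ n * t))%N.
    by apply: le_truncn; rewrite ler_pM2l ?exprn_gt0// ltW.
  rewrite leq_eqVlt => /predU1P[e|lt_st].
    rewrite (_ : v n = u n); last by rewrite /u /v /dyadic_floor e.
    rewrite /Dhom subrr normr0 (_ : area_incr _ _ = 0) ?normr0 ?mulr0 ?sqrtr0 ?maxxx//.
    by apply/matrixP => a b; rewrite /area_incr !(tensE, mxE); ring.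
  have := @chaining_hoelder R Dhom C q C0 (ltW q0) q1 _ _ hC beta n _ _ beta0 erefl lt_st.
  rewrite truncn_dyadic_le// => H; apply: le_trans (H _ _ isT) _.
  - move=> w; rewrite /Dhom subrr normr0 (_ : area_incr _ _ = 0) ?normr0 ?mulr0 ?sqrtr0 ?maxxx//.
    by apply/matrixP => a b; rewrite /area_incr !(tensE, mxE); ring.
  - by move=> w1 w2 w3 _ _ _ _; exact: Dhom_triangle.
  - apply: ler_wpM2l => //; apply: ge0_ler_powR; rewrite ?nnegrE ?(ltW beta0)//; last exact: ltW.
      by rewrite subr_ge0 ler_pM2r ?invr_gt0 ?exprn_gt0// ler_nat ltnW.
    by lra.
have xv c : x (v n) 0 c @[n --> \oo] --> x t 0 c := within_cvg_seq (@xac c) t01 v01 vt.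
have xu c : x (u n) 0 c @[n --> \oo] --> x s 0 c := within_cvg_seq (@xac c) s01 u01 us.
have Yv a b : Y (v n) a b @[n --> \oo] --> Y t a b := within_cvg_seq (@Yc a b) t01 v01 vt.
have Yu a b : Y (u n) a b @[n --> \oo] --> Y s a b := within_cvg_seq (@Yc a b) s01 u01 us.
split.
  apply: normr_mx_le => // i a; rewrite (ord1 i) !mxE.
  have : `|x (v n) 0 a - x (u n) 0 a| @[n --> \oo] --> `|x t 0 a - x s 0 a|.
    by apply: cvg_norm; apply: cvgB; [exact: xv|exact: xu].
  move=> /cvgr_to_le; apply; apply: filterS DL => n; apply: le_trans.
  apply: le_trans (_ : `|x (v n) - x (u n)| <= _); last by rewrite /Dhom le_max lexx.
  by have := normr_coord_le (x (v n) - x (u n)) 0 a; rewrite !mxE.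
apply: normr_mx_le => [|a b]; first exact: sqr_ge0.
have : `|area_incr (u n) (v n) a b| @[n --> \oo] --> `|area_incr s t a b|.
  have E w z : area_incr w z a b = Y z a b - Y w a b - x w 0 a * (x z 0 b - x w 0 b).
    by rewrite /area_incr !(tensE, mxE).
  rewrite E; under eq_fun do rewrite E.
  apply: cvg_norm; apply: cvgB; first by apply: cvgB; [exact: Yv|exact: Yu].
  by apply: cvgM; [exact: xu|apply: cvgB; [exact: xv|exact: xu]].
move=> /cvgr_to_le; apply; apply: filterS DL => n DnL.
apply: le_trans (normr_coord_le _ _ _) _.
apply: (@le_trans _ _ (Dhom (u n) (v n) ^+ 2)).
  by apply: le_trans (Dhom_area _ _); rewrite ler_peMl//; lra.
by rewrite lerXn2r ?nnegrE.
Qed.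

End sample_path.

(** * The enhanced path is a zero of the functional *)

Section tensor_increments.
Context (R : realType) (d : nat).
Implicit Types (X : R -> tensor2 R d).

Lemma incrE X s t : pi0 (X s) = 1 -> pi0 (X t) = 1 ->
  incr X s t = (1, pi1 (X t) - pi1 (X s),
    pi2 (X t) - pi2 (X s) - tens (pi1 (X s)) (pi1 (X t) - pi1 (X s))).
Proof.
rewrite /incr; case: (X s) => [[a0 a1] a2]; case: (X t) => [[b0 b1] b2].
rewrite /tmul /tinv /tadd /tsub /tadd /tscale /tone /tmul /pi0 /pi1 /pi2 /= => -> ->.
congr (_, _, _); first by ring.
  by apply/rowP => i; rewrite !mxE; ring.
by apply/matrixP => i j; rewrite !(tensE, mxE); ring.
Qed.

Lemma level_norm1_tsub (g h : tensor2 R d) :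
  level_norm 1 (tsub g h) = enorm (pi1 g - pi1 h).
Proof. by rewrite /level_norm /tsub /tadd /tscale /pi1 /= scaleN1r. Qed.

Lemma level_norm2_tsub (g h : tensor2 R d) :
  level_norm 2 (tsub g h) = enorm (pi2 g - pi2 h).
Proof. by rewrite /level_norm /tsub /tadd /tscale /pi2 /= scaleN1r. Qed.

Lemma level_norm_ge0 k (g : tensor2 R d) : 0 <= level_norm k g.
Proof. by case: k => [|[|[|k]]] //=; rewrite ?normr_ge0 ?enorm_ge0. Qed.

End tensor_increments.

Section dyadic_signatures.
Context (R : realType) (d : nat).
Variable x : R -> 'rV[R]_d.

Lemma signature2_interp_coarse m j i : (j <= m)%N ->
  signature2 (dyadic_interp x m) (i%:R / 2 ^+ j) (i.+1%:R / 2 ^+ j) =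
  (1, x (i.+1%:R / 2 ^+ j) - x (i%:R / 2 ^+ j),
   \matrix_(a, b) interp_area x m j i a b).
Proof.
move=> jm; have N0 : 0 < 2 ^+ m :> R by rewrite exprn_gt0.
have ptE k : (k * 2 ^ (m - j))%:R / 2 ^+ m = k%:R / 2 ^+ j :> R.
  rewrite natrM natrX -{2}(subnK jm) exprD [X in X / _]mulrC -mulf_div divff ?mul1r//.
have lt : (i * 2 ^ (m - j) < i.+1 * 2 ^ (m - j))%N by rewrite ltn_pmul2r ?expn_gt0.
have := signature2_polygon (fun k => x (k%:R / 2 ^+ m)) N0 lt.
by rewrite -dyadic_interpE !ptE.
Qed.

(** The interval lies inside one edge of the interpolation, whose signature is the
    exponential of a vector. *)
Lemma signature2_interp_fine m j i : (m <= j)%N -> (i < 2 ^ j)%N ->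
  exists2 k, (k < 2 ^ m)%N &
    signature2 (dyadic_interp x m) (i%:R / 2 ^+ j) (i.+1%:R / 2 ^+ j) =
      (1, 2^-1 ^+ (j - m) *: (x (k.+1%:R / 2 ^+ m) - x (k%:R / 2 ^+ m)),
       2^-1 *: tens (2^-1 ^+ (j - m) *: (x (k.+1%:R / 2 ^+ m) - x (k%:R / 2 ^+ m)))
                    (2^-1 ^+ (j - m) *: (x (k.+1%:R / 2 ^+ m) - x (k%:R / 2 ^+ m)))).
Proof.
move=> mj ij; have N0 : 0 < 2 ^+ m :> R by rewrite exprn_gt0.
have J0 : 0 < 2 ^+ j :> R by rewrite exprn_gt0.
set c := (2 ^ (j - m))%N; have c0 : (0 < c)%N by rewrite expn_gt0.
have jE : (2 ^ j = 2 ^ m * c)%N by rewrite /c -expnD subnKC.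
exists (i %/ c)%N; first by rewrite ltn_divLR// -jE.
have ptE k : (k * c)%:R / 2 ^+ j = k%:R / 2 ^+ m :> R.
  rewrite natrM /c natrX -{2}(subnK mj) exprD [X in X / _]mulrC -mulf_div divff ?mul1r//.
have := @signature2_polygon_edge R d (2 ^+ m) (fun k => x (k%:R / 2 ^+ m)) (i %/ c)
  (i%:R / 2 ^+ j) (i.+1%:R / 2 ^+ j) N0.
rewrite -!ptE !ler_pM2r ?invr_gt0// ltr_pM2r ?invr_gt0// !ler_nat ltr_nat.
rewrite leq_trunc_div ltnSn => /(_ isT isT).
rewrite -dyadic_interpE => ->; last by rewrite ltn_ceil.
have -> : 2 ^+ m * (i.+1%:R / 2 ^+ j - i%:R / 2 ^+ j) = 2^-1 ^+ (j - m) :> R.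
  rewrite -mulrBl -natrB// subSnn mul1r exprVn.
  by rewrite -{1}(subnK mj) exprD invfM mulrCA divff ?mulr1// gt_eqF.
by rewrite !ptE.
Qed.

End dyadic_signatures.

Section discrete_sobolev_decay.
Context (R : realType) (d : nat).
Variables (alpha p gam : R).
Hypotheses (p0 : 0 < p) (alpha_gam : alpha < gam).

Let g : R := 2^-1 `^ gam.
Let g0 : 0 <= g. Proof. exact: powR_ge0. Qed.

(** Generation [j] contributes [2^(j (alpha p - 1))] times [2^j] terms of size
    [C^(p/k) 2^(- j gam p)]: the series is geometric of ratio
    [2^(- (gam - alpha) p)]. *)
Lemma rho_level_le (k : nat) (X Z : R -> R -> tensor2 R d) (C : R) : (0 < k)%N ->
  0 <= C ->
  (forall j i, (i < 2 ^ j)%N ->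
    level_norm k (tsub (X (i%:R / 2 ^+ j) (i.+1%:R / 2 ^+ j))
                       (Z (i%:R / 2 ^+ j) (i.+1%:R / 2 ^+ j))) <= C * (g ^+ j) ^+ k) ->
  (rho_level alpha p k X Z <=
    (C * (1 - 2^-1 `^ ((gam - alpha) * p))^-1 `^ (k%:R / p))%:E)%E.
Proof.
move=> k0 C0 h.
have kR : 0 < k%:R :> R by rewrite ltr0n.
have pk : 0 < p / k%:R by rewrite divr_gt0.
pose r : R := 2^-1 `^ ((gam - alpha) * p).
have /andP[r0 r1] : 0 < r < 1 by apply: half_powR_lt1; rewrite mulr_gt0// subr_gt0.
have gp : 2 `^ (alpha * p - 1) * 2 * g `^ p = r.
  have two : 2 = 2^-1 `^ (-1) :> R by rewrite powR_inv1 ?invr_ge0// invrK.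
  have nz (a b : R) : (a + b == 0) ==> (2^-1 != 0 :> R) by rewrite implybE orbC invr_eq0 pnatr_eq0.
  have twoX a : 2 `^ a = 2^-1 `^ (- a) :> R by rewrite {1}two -powRrM mulN1r.
  rewrite twoX [X in _ * X * _]two /g -powRrM -(powRD (nz _ _)) -(powRD (nz _ _)) /r.
  by congr (_ `^ _); ring.
have term j : 2 `^ (j%:R * (alpha * p - 1)) * \sum_(1 <= i < (2 ^ j).+1)
    level_norm k (tsub (X (i.-1%:R / 2 ^+ j) (i%:R / 2 ^+ j))
                       (Z (i.-1%:R / 2 ^+ j) (i%:R / 2 ^+ j))) `^ (p / k%:R)
    <= C `^ (p / k%:R) * r ^+ j.
  rewrite -gp !exprMn -(powR_expn p j g0).
  rewrite [2 `^ (j%:R * _)](_ : _ = (2 `^ (alpha * p - 1)) ^+ j); last first.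
    by rewrite mulrC powRrM powR_mulrn ?powR_ge0.
  set c := (2 `^ (alpha * p - 1)) ^+ j.
  rewrite (_ : C `^ _ * _ = c * (2 ^+ j * (C `^ (p / k%:R) * (g ^+ j) `^ p))); last by ring.
  apply: ler_wpM2l; first by rewrite exprn_ge0// powR_ge0.
  apply: (@le_trans _ _ (\sum_(1 <= i < (2 ^ j).+1) (C `^ (p / k%:R) * (g ^+ j) `^ p))).
    rewrite !big_nat; apply: ler_sum => -[//|i] /andP[_ ij] /=.
    apply: (@le_trans _ _ ((C * (g ^+ j) ^+ k) `^ (p / k%:R))).
      apply: ge0_ler_powR; rewrite ?nnegrE ?(ltW pk) ?level_norm_ge0//.
        by rewrite mulr_ge0// !exprn_ge0.
      exact: h.
    rewrite powRM ?exprn_ge0// -[(g ^+ j) ^+ k]powR_mulrn ?exprn_ge0//.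
    by rewrite -powRrM mulrCA divff ?mulr1// gt_eqF.
  by rewrite sumr_const_nat subSS subn0 -[_ *+ (2 ^ j)]mulr_natl natrX.
rewrite /rho_level.
apply: (@le_trans _ _ (((C `^ (p / k%:R) / (1 - r))%:E) `^ (k%:R / p))%E).
  have t0 j : 0 <= 2 `^ (j%:R * (alpha * p - 1)) * \sum_(1 <= i < (2 ^ j).+1)
    level_norm k (tsub (X (i.-1%:R / 2 ^+ j) (i%:R / 2 ^+ j))
                       (Z (i.-1%:R / 2 ^+ j) (i%:R / 2 ^+ j))) `^ (p / k%:R).
    by rewrite mulr_ge0 ?powR_ge0//; apply: sumr_ge0 => i _; exact: powR_ge0.
  apply: gt0_ler_poweR; rewrite ?divr_ge0 ?(ltW p0)//.
  - by rewrite in_itv/= leey andbT; apply: nneseries_ge0 => j _ _; rewrite lee_fin.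
  - by rewrite in_itv/= leey andbT lee_fin divr_ge0 ?powR_ge0// subr_ge0 ltW.
  - apply: le_trans (geometric_nneseries_le _ _); rewrite ?powR_ge0 ?(ltW r0)//.
    by apply: lee_nneseries => j _; rewrite lee_fin.
rewrite poweR_EFin lee_fin powRM ?powR_ge0 ?invr_ge0 ?subr_ge0 ?(ltW r1)//.
rewrite -powRrM mulrA divfK ?(gt_eqF kR)// divff ?gt_eqF// powRr1//.
Qed.

End discrete_sobolev_decay.

Section lift_functional_of_enhanced_path.
Context (R : realType) (d : nat).
Variables (x : R -> 'rV[R]_d) (Y : R -> 'M[R]_d) (beta rho : R).
Hypotheses (beta0 : 0 < beta) (beta1 : beta <= 1) (rho01 : 0 <= rho < 1).
Let q : R := 2^-1 `^ beta.
Hypothesis dx_decay : exists2 C : R, 0 <= C & forall m k, (k < 2 ^ m)%N ->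
  `|x (k.+1%:R / 2 ^+ m) - x (k%:R / 2 ^+ m)| <= C * q ^+ m.
Hypothesis approx_decay : exists2 C : R, 0 <= C & forall m j i a b, (j <= m)%N ->
  (i < 2 ^ j)%N ->
  `|area_incr x Y (i%:R / 2 ^+ j) (i.+1%:R / 2 ^+ j) a b - interp_area x m j i a b|
    <= C * q ^+ (2 * j) * rho ^+ m.
Hypothesis area_decay : exists2 C : R, 0 <= C & forall j i, (i < 2 ^ j)%N ->
  `|area_incr x Y (i%:R / 2 ^+ j) (i.+1%:R / 2 ^+ j)| <= C * q ^+ (2 * j).

Let Bs (t : R) : tensor2 R d := (1, x t, Y t).

Let incr_Bs s t : incr Bs s t = (1, x t - x s, area_incr x Y s t).
Proof. exact: incrE. Qed.

Variable gam : R.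
Hypotheses (gam_beta : gam < beta).
Let g : R := 2^-1 `^ gam.
Let tau : R := 2^-1 `^ (beta - gam).
Let theta : R := Num.max tau rho.

Let half_powRD (u v : R) : 2^-1 `^ (u + v) = 2^-1 `^ u * 2^-1 `^ v.
Proof. by rewrite powRD// implybE orbC invr_eq0 pnatr_eq0. Qed.

Let q_g_tau : q = g * tau.
Proof. by rewrite /q /g /tau -half_powRD subrKC. Qed.

Let q0 : 0 <= q. Proof. exact: powR_ge0. Qed.
Let g0 : 0 <= g. Proof. exact: powR_ge0. Qed.
Let tau01 : 0 < tau < 1. Proof. by apply: half_powR_lt1; rewrite subr_gt0. Qed.
Let tau0 : 0 <= tau. Proof. exact: powR_ge0. Qed.
Let tau1 : tau <= 1. Proof. by have /andP[_ /ltW] := tau01. Qed.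
Let theta0 : 0 <= theta. Proof. by rewrite /theta le_max tau0. Qed.
Let theta1 : theta < 1.
Proof. by rewrite /theta gt_max; have /andP[_ ->] := tau01; have /andP[_ ->] := rho01. Qed.
Let rho0 : 0 <= rho. Proof. by have /andP[] := rho01. Qed.

Let half_le_q : 2^-1 <= q.
Proof.
rewrite -[leLHS]powRr1 ?invr_ge0//; apply: ger_powR => //.
by rewrite invr_gt0 ltr0n/=; lra.
Qed.

Let q_le_g : q <= g.
Proof. by rewrite q_g_tau ler_piMr. Qed.

Let fine_decay j m : (m <= j)%N -> q ^+ j <= g ^+ j * theta ^+ m.
Proof.
move=> mj; rewrite q_g_tau exprMn; apply: ler_wpM2l; first exact: exprn_ge0.
apply: le_trans (_ : tau ^+ m <= _); first exact: ler_wiXn2l.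
by apply: lerXn2r; rewrite ?nnegrE// /theta le_max lexx.
Qed.

Let fine_decay2 j m : (m <= j)%N -> q ^+ (2 * j) <= (g ^+ j) ^+ 2 * theta ^+ m.
Proof.
move=> mj; rewrite mulnC exprM expr2 (expr2 (g ^+ j)) -mulrA.
apply: ler_pM; rewrite ?exprn_ge0//; last exact: fine_decay.
by apply: lerXn2r; rewrite ?nnegrE.
Qed.

Let pi1E (a : R) (b : 'rV[R]_d) (c : 'M[R]_d) : pi1 (a, b, c) = b.
Proof. by []. Qed.
Let pi2E (a : R) (b : 'rV[R]_d) (c : 'M[R]_d) : pi2 (a, b, c) = c.
Proof. by []. Qed.

(** For [j <= m] the first levels agree, and the second ones are compared by
    [approx_decay]. For [j > m] both increments are small by themselves: the part
    [tau^j] of [q^j = g^j tau^j] is then at most [theta^m]. *)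
Let increment_difference_decay : exists2 C : R, 0 <= C & forall m j i, (i < 2 ^ j)%N ->
  let s := i%:R / 2 ^+ j in let t := i.+1%:R / 2 ^+ j in
  `|pi1 (incr Bs s t) - pi1 (signature2 (dyadic_interp x m) s t)|
     <= C * theta ^+ m * g ^+ j /\
  `|pi2 (incr Bs s t) - pi2 (signature2 (dyadic_interp x m) s t)|
     <= C * theta ^+ m * (g ^+ j) ^+ 2.
Proof.
have [C1 C10 h1] := dx_decay.
have [C2 C20 h2] := approx_decay.
have [C3 C30 h3] := area_decay.
have gj j : 0 <= g ^+ j by exact: exprn_ge0.
have th m : 0 <= theta ^+ m by exact: exprn_ge0.
have C11 : 0 <= C1 ^+ 2 by exact: sqr_ge0.
pose C := C1 + C1 + C1 ^+ 2 + C2 + C3.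
have C0 : 0 <= C by rewrite !addr_ge0.
exists C => // m j i ij s t; rewrite incr_Bs {}/s {}/t.
have [jm|mj] := leqP j m.
  rewrite signature2_interp_coarse// !(pi1E, pi2E) subrr normr0; split.
    by rewrite !mulr_ge0.
  apply: normr_mx_le => [|a b]; first by rewrite !mulr_ge0// exprn_ge0.
  rewrite !mxE; apply: (@le_trans _ _ (C2 * q ^+ (2 * j) * rho ^+ m)).
    by have := h2 m j i a b jm ij; rewrite /area_incr !mxE.
  rewrite mulrAC; apply: ler_pM; rewrite ?mulr_ge0 ?exprn_ge0//.
    apply: ler_pM; rewrite ?exprn_ge0//; first by rewrite /C; lra.
    by apply: lerXn2r; rewrite ?nnegrE// /theta le_max lexx orbT.
  by rewrite mulnC exprM; apply: lerXn2r; rewrite ?nnegrE ?exprn_ge0//; apply: lerXn2r.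
have [k km ->] := signature2_interp_fine x (ltnW mj) ij.
rewrite !(pi1E, pi2E); set v := 2^-1 ^+ (j - m) *: _.
have v_le : `|v| <= C1 * q ^+ j.
  rewrite /v normrZ ger0_norm ?exprn_ge0 ?invr_ge0//.
  apply: (@le_trans _ _ (q ^+ (j - m) * (C1 * q ^+ m))).
    apply: ler_pM; rewrite ?exprn_ge0 ?invr_ge0//; last exact: h1.
    by apply: lerXn2r; rewrite ?nnegrE ?invr_ge0.
  by rewrite mulrCA -exprD subnK// ltnW.
have fd := fine_decay (ltnW mj); have fd2 := fine_decay2 (ltnW mj).
have gt0 : 0 <= g ^+ j * theta ^+ m by rewrite mulr_ge0.
have gt20 : 0 <= (g ^+ j) ^+ 2 * theta ^+ m by rewrite mulr_ge0// exprn_ge0.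
split.
  apply: le_trans (ler_normB _ _) _.
  apply: (@le_trans _ _ (C1 * q ^+ j + C1 * q ^+ j)); first by apply: lerD => //; exact: h1.
  rewrite -mulrDl -mulrA [theta ^+ m * _]mulrC; apply: ler_pM; rewrite ?addr_ge0 ?exprn_ge0//.
  by rewrite /C; lra.
apply: le_trans (ler_normB _ _) _.
apply: (@le_trans _ _ (C3 * q ^+ (2 * j) + C1 ^+ 2 * q ^+ (2 * j))).
  apply: lerD; first exact: h3.
  rewrite normrZ ger0_norm ?invr_ge0//.
  apply: (@le_trans _ _ (1 * (`|v| * `|v|))).
    by apply: ler_pM => //; [lra|exact: normr_tens_le].
  rewrite mul1r mulnC exprM -exprMn expr2; apply: ler_pM => //.
rewrite -mulrDl -mulrA [theta ^+ m * _]mulrC; apply: ler_pM; rewrite ?addr_ge0 ?exprn_ge0//.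
by rewrite /C; lra.
Qed.

Lemma rho_hat_decay (alpha p : R) : 0 < p -> alpha < gam ->
  exists2 C : R, 0 <= C & forall m,
    (rho_hat alpha p (incr Bs) (signature2 (dyadic_interp x m)) <=
      (C * theta ^+ m)%:E)%E.
Proof.
move=> p0 ag; have [C C0 hC] := increment_difference_decay.
pose c1 : R := Num.sqrt (1 * d)%:R; pose c2 : R := Num.sqrt (d * d)%:R.
have c10 : 0 <= c1 := sqrtr_ge0 _; have c20 : 0 <= c2 := sqrtr_ge0 _.
pose K k : R := (1 - 2^-1 `^ ((gam - alpha) * p))^-1 `^ (k%:R / p).
have K0 k : 0 <= K k by exact: powR_ge0.
exists (c1 * C * K 1%N + c2 * C * K 2%N); first by rewrite addr_ge0// !mulr_ge0.
move=> m; have th : 0 <= theta ^+ m by exact: exprn_ge0.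
rewrite /rho_hat big_nat_recl// big_nat1 mulrDl EFinD; apply: leeD.
  apply: le_trans (@rho_level_le _ _ alpha p gam p0 ag 1%N _ _ (c1 * C * theta ^+ m) _ _ _) _ => //.
  - by rewrite !mulr_ge0.
  - move=> j i ij; rewrite level_norm1_tsub expr1; apply: le_trans (enorm_le _) _.
    by rewrite -2!mulrA; apply: ler_wpM2l => //; rewrite mulrA; have [] := hC m j i ij.
  - by rewrite lee_fin mulrAC.
apply: le_trans (@rho_level_le _ _ alpha p gam p0 ag 2%N _ _ (c2 * C * theta ^+ m) _ _ _) _ => //.
- by rewrite !mulr_ge0.
- move=> j i ij; rewrite level_norm2_tsub; apply: le_trans (enorm_le _) _.
  by rewrite -2!mulrA; apply: ler_wpM2l => //; rewrite mulrA; have [] := hC m j i ij.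
- by rewrite lee_fin mulrAC.
Qed.

Lemma rho_hat_ge0 (alpha p : R) X Z : (0 <= @rho_hat R d alpha p X Z)%E.
Proof. by apply: sume_ge0 => k _; exact: poweR_ge0. Qed.

Lemma lift_functional_enhanced_path (alpha p : R) : 0 < p -> alpha < gam ->
  lift_functional alpha p x Bs = 0%E.
Proof.
move=> p0 ag; have [C C0 hC] := rho_hat_decay p0 ag.
pose u m := rho_hat alpha p (incr Bs) (signature2 (dyadic_interp x m)).
have u0 : u @ \oo --> 0%E.
  apply: (@squeeze_cvge _ _ _ _ (cst 0%E) _ (fun m => (C * theta ^+ m)%:E)).
  - by apply: nearW => m /=; rewrite rho_hat_ge0 hC.
  - exact: cvg_cst.
  - apply: cvg_EFin; first exact: nearW.
    by apply: cvg_geometric; rewrite ger0_norm.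
rewrite /lift_functional -/u is_cvg_limn_esupE; last by apply/cvg_ex; exists 0%E.
exact/cvg_lim.
Qed.

End lift_functional_of_enhanced_path.

(** * The enhanced path is admissible *)

Section admissible_enhanced_path.
Context (R : realType) (d : nat).

Lemma cc_norm_ge0 (g : tensor2 R d) : (0 <= cc_norm g)%E.
Proof.
apply: le_ereal_inf_tmp => _ [x _ <-].
apply: le_trans (ereal_sup_ubound _); last first.
  by exists [:: 1] => //; apply: itv_partition1; exact: ltr01.
by rewrite lee_fin; apply: sumr_ge0 => k _; exact: enorm_ge0.
Qed.

(** An antisymmetric matrix is the sum of the brackets of the basis vectors, weighted
    by half of its entries. *)
Lemma lie2_antisymmetric (w : 'M[R]_d) : w^T = - w -> lie2 w.
Proof.
move=> wT; rewrite (antisymmetric_bracket_sum wT).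
pose I := ('I_d * 'I_d)%type.
exists #|{: I}|, (fun k => (w (enum_val k).1 (enum_val k).2 / 2) *: delta_mx 0 (enum_val k).1),
  (fun k => delta_mx 0 (enum_val k).2).
by rewrite [RHS](reindex enum_rank)/=; [apply: eq_bigr => ij _; rewrite enum_rankK|
  exact: onW_bij (@enum_rank_bij _)].
Qed.

(** The symmetric part of the second level of [exp (v + w)] is the one of
    [exp v], and what remains is antisymmetric. *)
Lemma G2_of_symmetric_part (v : 'rV[R]_d) (A : 'M[R]_d) :
  A + A^T = tens v v -> G2 ((1, v, A) : tensor2 R d).
Proof.
move=> AT; exists v, (A - 2^-1 *: tens v v); split.
  apply: lie2_antisymmetric; apply/matrixP => i j.
  have /matrixP/(_ i j) := AT; rewrite !(tensE, mxE) => h.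
  by rewrite -[A j i](addKr (A i j)) h; field.
rewrite /texp /tadd /tscale /tmul /tone /pi0 /pi1 /pi2 /=; congr (_, _, _).
- by ring.
- by apply/rowP => i; rewrite !mxE; ring.
- by apply/matrixP => i j; rewrite !(tensE, mxE); ring.
Qed.

Lemma G2_pi0 (g : tensor2 R d) : G2 g -> pi0 g = 1.
Proof.
by move=> [v [w [_ ->]]]; rewrite /texp /tadd /tscale /tmul /tone /pi0 /=; ring.
Qed.

Variables (x : R -> 'rV[R]_d) (Y : R -> 'M[R]_d) (alpha p beta K : R).
Hypotheses (beta0 : 0 < beta) (p0 : 0 < p) (alpha_beta : alpha < beta) (K0 : 0 <= K).
Hypothesis Y_sym : forall t a b, 0 <= t <= 1 -> Y t a b + Y t b a = x t 0 a * x t 0 b.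
Hypothesis hoelder : forall s t, 0 <= s -> s < t -> t <= 1 ->
    `|x t - x s| <= K * (t - s) `^ beta /\
    `|area_incr x Y s t| <= (K * (t - s) `^ beta) ^+ 2.

Let Bs (t : R) : tensor2 R d := (1, x t, Y t).

(** The second level of the logarithm of the increment. *)
Let w s t := area_incr x Y s t - 2^-1 *: tens (x t - x s) (x t - x s).

Let wT s t : 0 <= s <= 1 -> 0 <= t <= 1 -> (w s t)^T = - w s t.
Proof.
move=> s01 t01; apply/matrixP => a b.
have hs := Y_sym a b s01; have ht := Y_sym a b t01.
rewrite /w /area_incr !(tensE, mxE) -[Y t b a](addKr (Y t a b)) ht.
by rewrite -[Y s b a](addKr (Y s a b)) hs; field.
Qed.

Let wN s t : w t s = - w s t.
Proof. by apply/matrixP => a b; rewrite /w /area_incr !(tensE, mxE); field. Qed.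

Let c : R := Num.sqrt d%:R * (4 * (d * d) + 1)%:R.
Let c0 : 0 <= c. Proof. by rewrite mulr_ge0 ?sqrtr_ge0. Qed.

Let cc_incr_le s t r : 0 <= s <= 1 -> 0 <= t <= 1 -> 0 < r ->
  `|x t - x s| <= r -> `|w s t| <= r ^+ 2 -> (cc_dist (Bs s) (Bs t) <= (c * r)%:E)%E.
Proof.
move=> s01 t01 r0 xr wr; rewrite /cc_dist -[tmul _ _]/(incr Bs s t) incrE//.
rewrite /pi1 /pi2 /= -/(area_incr x Y s t).
have -> : area_incr x Y s t = 2^-1 *: tens (x t - x s) (x t - x s) + w s t.
  by rewrite /w addrC subrK.
exact: cc_norm_le r0 (wT s01 t01) xr wr.
Qed.

(** The radius [r] bounds [|x t - x s|] and [|w s t|^(1/2)]; the summand 1 in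
    [K + 1] keeps it positive. *)
Lemma cc_dist_enhanced_path s t : 0 <= s <= 1 -> 0 <= t <= 1 ->
  (cc_dist (Bs s) (Bs t) <= (c * (2 * (K + 1)) * `|t - s| `^ beta)%:E)%E.
Proof.
have lt_case s' t' : 0 <= s' -> s' < t' -> t' <= 1 ->
    let r := 2 * (K + 1) * (t' - s') `^ beta in
    [/\ 0 < r, `|x t' - x s'| <= r & `|w s' t'| <= r ^+ 2].
  move=> s0 st t1 r; have [hx hA] := hoelder s0 st t1.
  have u0 : 0 < (t' - s') `^ beta by rewrite powR_gt0// subr_gt0.
  set u := (t' - s') `^ beta in u0 hx hA r *.
  have Ku : 0 <= K * u by rewrite mulr_ge0// ltW.
  have rE : r = K * u + K * u + 2 * u by rewrite /r; ring.
  have r0 : 0 < r by rewrite rE ltr_wpDl// ?addr_ge0// mulr_gt0.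
  split => //; first by apply: le_trans hx _; rewrite rE; lra.
  have h1 : `|w s' t'| <= (K * u) ^+ 2 + (K * u) ^+ 2.
    apply: le_trans (ler_normB _ _) _; apply: lerD => //.
    rewrite mx_normZ ger0_norm ?invr_ge0// -[leRHS]mul1r.
    apply: ler_pM => //; first by lra.
    by apply: le_trans (normr_tens_le _ _) _; rewrite expr2; apply: ler_pM.
  apply: le_trans h1 _; rewrite rE.
  have : 0 <= K * u * u by rewrite mulr_ge0// ltW.
  by have := sqr_ge0 (K * u); have := sqr_ge0 u; nra.
move=> s01 t01; have [st|ts|<-] := ltgtP s t.
- have [r0 h1 h2] := lt_case s t (andP s01).1 st (andP t01).2.
  rewrite gtr0_norm ?subr_gt0// -mulrA; exact: cc_incr_le.
- have [r0 h1 h2] := lt_case t s (andP t01).1 ts (andP s01).2.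
  rewrite ltr0_norm ?subr_lt0// opprB -mulrA; apply: cc_incr_le => //.
    by rewrite distrC.
  by rewrite wN normrN.
(* The norm of the unit is at most [c r] for all [r > 0]. *)
- rewrite subrr normr0 powR0 ?(gt_eqF beta0)// mulr0.
  apply/lee_addgt0Pr => e e0; rewrite add0e.
  have c1 : 0 < c + 1 by rewrite ltr_wpDl.
  have r0 : 0 < e / (c + 1) by rewrite divr_gt0.
  apply: le_trans (cc_incr_le s01 s01 r0 _ _) _.
  + by rewrite subrr normr0 ltW.
  + suff -> : w s s = 0 by rewrite normr0 sqr_ge0.
    by apply/matrixP => a b; rewrite /w /area_incr !(tensE, mxE); ring.
  + by rewrite lee_fin mulrCA ger_pMr// ler_pdivrMr// mul1r lerDl.
Qed.

Lemma admissible_enhanced_path : admissible alpha p x Bs.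
Proof.
pose C := c * (2 * (K + 1)).
have C0 : 0 <= C by rewrite !mulr_ge0// addr_ge0.
split; last by [].
split.
- move=> t t01; apply: G2_of_symmetric_part; apply/matrixP => a b.
  by rewrite !(tensE, mxE); exact: Y_sym.
- move=> t t01 e e0.
  have C1 : 0 < C + 1 by rewrite ltr_wpDl.
  have eC : 0 < e / (C + 1) by rewrite divr_gt0.
  exists ((e / (C + 1)) `^ beta^-1); first exact: powR_gt0.
  move=> s s01 st; apply: le_lt_trans (cc_dist_enhanced_path s01 t01) _.
  rewrite lte_fin; apply: (@le_lt_trans _ _ ((C + 1) * `|t - s| `^ beta)).
    by apply: ler_wpM2r; rewrite ?powR_ge0// lerDl.
  rewrite mulrC -ltr_pdivlMr//.
  have := gt0_ltr_powR beta0; move=> /(_ `|s - t| ((e / (C + 1)) `^ beta^-1)).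
  rewrite !nnegrE normr_ge0 powR_ge0 => /(_ isT isT st).
  by rewrite distrC -powRrM mulVf ?(gt_eqF beta0)// powRr1// ltW.
- apply: (@hoelder_sobolev_finite R (tensor2 R d) (@cc_dist R d) Bs C beta) => //.
  + by move=> g h; exact: cc_norm_ge0.
  + by move=> s t s01 t01; exact: cc_dist_enhanced_path.
Qed.

End admissible_enhanced_path.

(** * Zeros of the functional are unique *)

Section uniqueness_of_minimizer.
Context (R : realType) (d : nat).
Variables (x : R -> 'rV[R]_d) (alpha p : R).
Hypothesis p0 : 0 < p.

(** The right-hand side contains the left-hand side as a single term. *)
Lemma rho_hat_level2_ge (j i : nat) (X Z : R -> R -> tensor2 R d) : (i < 2 ^ j)%N ->
  ((2 `^ (j%:R * (alpha * p - 1)) `^ (2%:R / p) *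
    level_norm 2 (tsub (X (i%:R / 2 ^+ j) (i.+1%:R / 2 ^+ j))
                       (Z (i%:R / 2 ^+ j) (i.+1%:R / 2 ^+ j))))%:E
   <= rho_hat alpha p X Z)%E.
Proof.
move=> ij; set v := level_norm 2 _.
have v0 : 0 <= v by exact: level_norm_ge0.
have p2 : 0 <= 2%:R / p by rewrite divr_ge0// ltW.
apply: (@le_trans _ _ (rho_level alpha p 2 X Z)); last first.
  by rewrite /rho_hat big_nat_recl// big_nat1 leeDr// poweR_ge0.
have -> : v = (v `^ (p / 2%:R)) `^ (2%:R / p).
  rewrite -powRrM mulrA divfK ?divff ?powRr1 ?gt_eqF//.
rewrite -powRM ?powR_ge0// -poweR_EFin.
pose t j := 2 `^ (j%:R * (alpha * p - 1)) * \sum_(1 <= i < (2 ^ j).+1)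
    level_norm 2 (tsub (X (i.-1%:R / 2 ^+ j) (i%:R / 2 ^+ j))
                       (Z (i.-1%:R / 2 ^+ j) (i%:R / 2 ^+ j))) `^ (p / 2%:R).
have t0 k : 0 <= t k.
  by rewrite mulr_ge0 ?powR_ge0//; apply: sumr_ge0 => l _; exact: powR_ge0.
apply: gt0_ler_poweR => //.
- by rewrite in_itv/= leey andbT lee_fin mulr_ge0 ?powR_ge0.
- by rewrite in_itv/= leey andbT; apply: nneseries_ge0 => k _ _; rewrite lee_fin; exact: t0.
apply: (@le_trans _ _ (t j)%:E).
  rewrite lee_fin; apply: ler_wpM2l; first exact: powR_ge0.
  rewrite (bigD1_seq i.+1)/= ?mem_index_iota ?iota_uniq ?ltnS//.
  by rewrite lerDl; apply: sumr_ge0 => l _; exact: powR_ge0.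
apply: (@le_trans _ _ (\sum_(0 <= k < j.+1) (t k)%:E)%E).
  by rewrite big_nat_recr//= leeDr// sume_ge0// => k _; rewrite lee_fin.
by apply: nneseries_lim_ge => k _ _; rewrite lee_fin; exact: t0.
Qed.

Lemma lift_functional_le0_level2 (X : R -> tensor2 R d) :
  (lift_functional alpha p x X <= 0)%E ->
  forall j i a b (e : R), (i < 2 ^ j)%N -> 0 < e ->
  \forall m \near \oo,
    `|pi2 (incr X (i%:R / 2 ^+ j) (i.+1%:R / 2 ^+ j)) a b -
      pi2 (signature2 (dyadic_interp x m) (i%:R / 2 ^+ j) (i.+1%:R / 2 ^+ j)) a b| < e.
Proof.
move=> FX j i a b e ij e0.
pose u m := rho_hat alpha p (incr X) (signature2 (dyadic_interp x m)).
have u0 : u @ \oo --> 0%E.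
  by apply: limn_esup_le_cvg => // m; exact: rho_hat_ge0.
pose kap : R := 2 `^ (j%:R * (alpha * p - 1)) `^ (2%:R / p).
have kap0 : 0 < kap by rewrite !powR_gt0.
have : \forall m \near \oo, (u m < (kap * e)%:E)%E.
  apply: (u0 [set y | (y < (kap * e)%:E)%E]); apply: open_nbhs_nbhs; split.
    exact: open_ereal_lt_ereal.
  by rewrite /= lte_fin mulr_gt0.
apply: filterS => m um.
have := le_lt_trans (rho_hat_level2_ge (incr X) (signature2 (dyadic_interp x m)) ij) um.
rewrite lte_fin ltr_pM2l// level_norm2_tsub; apply: le_lt_trans.
set A := pi2 _; set C := pi2 _.
by have := normr_coord_le_enorm (A - C) a b; rewrite !mxE.
Qed.

(** By [cc_norm_lt_coord] the second level of the increment over [s, t] is bounded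
    by the square of the distance, which tends to 0, and it differs from the
    increment of the second level by a continuous function of [x]. *)
Lemma admissible_pi2_continuous (X : R -> tensor2 R d) a b :
  {within `[0, 1], continuous x} -> admissible alpha p x X ->
  {within `[0, 1], continuous (fun t => pi2 (X t) a b)}.
Proof.
move=> xc [[XG Xc _] Xx].
have X1 t : 0 <= t <= 1 -> pi0 (X t) = 1 by move=> t01; exact/G2_pi0/XG.
have xac c : {within `[0, 1], continuous (fun t => x t 0 c)}.
  apply/within_itv_continuousP => s s01 e e0.
  have [del del0 h] := (within_itv_continuousP 0 1 x).1 xc s s01 e e0.
  exists del => // t t01 ts; apply: le_lt_trans (h t t01 ts).
  by have := normr_coord_le (x t - x s) 0 c; rewrite !mxE.
apply/within_itv_continuousP => t t01 e e0.
pose phi s := x s 0 a * (x t 0 b - x s 0 b).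
have phic : {within `[0, 1], continuous phi}.
  by move=> s; apply: cvgM; [exact: xac|apply: cvgB; [exact: cvg_cst|exact: xac]].
have e2 : 0 < e / 2 by rewrite divr_gt0.
have [d1 d10 h1] := (within_itv_continuousP 0 1 phi).1 phic t t01 _ e2.
have L0 : 0 < Num.min 1 (e / 2) by rewrite lt_min ltr01.
have [d2 d20 h2] := Xc t t01 _ L0.
exists (Num.min d1 d2); first by rewrite lt_min d10.
move=> s s01; rewrite lt_min => /andP[sd1 sd2].
have := h2 s s01 sd2; rewrite /cc_dist -[tmul _ _]/(incr X s t).
move=> /(@cc_norm_lt_coord _ _ _ _ a b); rewrite (incrE (X1 s s01) (X1 t t01)).
rewrite {1}/pi2 /= !Xx// => hA.
have := h1 s s01 sd1; rewrite {2}/phi subrr mulr0 subr0 => hphi.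
have L2 : Num.min 1 (e / 2) ^+ 2 <= e / 2.
  rewrite expr2; apply: le_trans (_ : 1 * Num.min 1 (e / 2) <= _).
    by apply: ler_wpM2r; [exact: ltW|rewrite ge_min lexx].
  by rewrite mul1r ge_min lexx orbT.
rewrite distrC [ltRHS]splitr.
have -> : pi2 (X t) a b - pi2 (X s) a b =
   (pi2 (X t) - pi2 (X s) - tens (x s) (x t - x s)) a b + phi s.
  by rewrite /phi !(tensE, mxE); ring.
apply: le_lt_trans (ler_normD _ _) _; apply: ler_ltD => //.
exact: le_trans hA L2.
Qed.

Variable Y : R -> 'M[R]_d.
Hypothesis xc : {within `[0, 1], continuous x}.
Hypothesis Yc : forall a b, {within `[0, 1], continuous (fun t => Y t a b)}.
Let Bs (t : R) : tensor2 R d := (1, x t, Y t).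
Hypothesis FBs : lift_functional alpha p x Bs = 0%E.
Hypothesis ABs : admissible alpha p x Bs.

Lemma lift_functional_ge0 (X : R -> tensor2 R d) : (0 <= lift_functional alpha p x X)%E.
Proof.
rewrite /lift_functional limn_esup_lim; apply: lime_ge; first exact: is_cvg_esups.
apply: nearW => m; apply: le_trans (rho_hat_ge0 _ _ _ _) _; last first.
  by apply: ereal_sup_ubound; exists m => //=.
Qed.

(** If [X] is a minimizer, the second levels of its dyadic increments and of those of
    [Bs] are limits of the same sequence. Hence the second levels of [X] and [Bs]
    differ by a constant, at dyadic times and then everywhere. *)
Lemma lift_functional_unique_minimizer :
  minimizer (admissible alpha p x) (lift_functional alpha p x) Bs /\
  forall X, minimizer (admissible alpha p x) (lift_functional alpha p x) X ->
    eq_rough X Bs.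
Proof.
split; first by split; [exact: ABs|move=> X _; rewrite FBs; exact: lift_functional_ge0].
move=> X [AX Xmin].
have FX : (lift_functional alpha p x X <= 0)%E by rewrite -FBs; exact: Xmin.
have [[XG _ _] Xx] := AX.
have X1 t : 0 <= t <= 1 -> pi0 (X t) = 1 by move=> t01; exact/G2_pi0/XG.
have pt01 n k : (k <= 2 ^ n)%N -> 0 <= (k%:R / 2 ^+ n : R) <= 1.
  move=> kn; rewrite divr_ge0//= ?exprn_ge0// ler_pdivrMr ?exprn_gt0// mul1r.
  by rewrite -natrX ler_nat.
have FBs0 : (lift_functional alpha p x Bs <= 0)%E by rewrite FBs.
have same a b : forall t, 0 <= t <= 1 ->
    pi2 (X t) a b - Y t a b = pi2 (X 0) a b - Y 0 a b.
  apply: (@eq_on_dyadics R (fun t => pi2 (X t) a b - Y t a b)).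
    have Xc := @admissible_pi2_continuous X a b xc AX.
    by move=> t; apply: cvgB; [exact: Xc|exact: Yc].
  move=> n; elim=> [_|k ih kn]; first by rewrite mul0r.
  rewrite -(ih (ltnW kn)).
  have [s01 u01] := (pt01 n k (ltnW kn), pt01 n k.+1 kn).
  have : pi2 (incr X (k%:R / 2 ^+ n) (k.+1%:R / 2 ^+ n)) a b =
      pi2 (incr Bs (k%:R / 2 ^+ n) (k.+1%:R / 2 ^+ n)) a b.
    apply/eqP; rewrite -subr_eq0 -normr_le0; apply/ler_addgt0Pr => e e0.
    rewrite add0r; have e2 : 0 < e / 2 by rewrite divr_gt0.
    have h1 := lift_functional_le0_level2 FX a b kn e2.
    have h2 := lift_functional_le0_level2 FBs0 a b kn e2.
    have [m [/= m1 m2]] := filter_ex (filterI h1 h2).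
    move: m1 m2; set v := pi2 (signature2 _ _ _) a b => m1 m2.
    rewrite (_ : _ - _ = (pi2 (incr X (k%:R / 2 ^+ n) (k.+1%:R / 2 ^+ n)) a b - v) -
      (pi2 (incr Bs (k%:R / 2 ^+ n) (k.+1%:R / 2 ^+ n)) a b - v)); last by ring.
    by apply: le_trans (ler_normB _ _) _; rewrite [leRHS]splitr lerD// ltW.
  rewrite (incrE (X1 _ s01) (X1 _ u01)) (incrE (X := Bs))// !Xx//.
  rewrite {1}/pi2 [in RHS]/pi2 /= !mxE => h.
  by apply/eqP; rewrite -subr_eq0; apply/eqP; move: h; lra.
move=> s t s01 t01; rewrite (incrE (X1 _ s01) (X1 _ t01)) (incrE (X := Bs))// !Xx//.
congr (_, _, _); apply/matrixP => a b; rewrite /pi2 /pi1 /=.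
have hs := same a b s s01; have ht := same a b t t01.
rewrite !(tensE, mxE); move: hs ht; rewrite /pi2; lra.
Qed.

End uniqueness_of_minimizer.

(** * Dyadic approximation of Stratonovich integrals *)

Section stratonovich_dyadic_approximation.
Context (R : realType) (disp : measure_display) (T : measurableType disp).
Variable P : probability T R.

Lemma ae_forall_countable (I : countType) (Q : I -> T -> Prop) :
  (forall i, {ae P, forall w, Q i w}) -> {ae P, forall w, forall i, Q i w}.
Proof.
move=> hQ; have : {ae P, forall w, forall n : nat,
    if unpickle n is Some i then Q i w else True}.
  apply/ae_foralln => n; case: (unpickle n) => [i|]; first exact: hQ.
  exact: filterT.
by apply: filterS => w h i; have := h (pickle i); rewrite pickleK.
Qed.

Let mge (f : T -> R) (e : R) : measurable_fun setT f ->
  measurable [set w | e <= `|f w|].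
Proof.
move=> mf; have mn : measurable_fun setT (fun w => `|f w|) by exact: measurableT_comp.
rewrite (_ : [set _ | _] = setT `&` (fun w => `|f w|) @^-1` `[e, +oo[).
  exact: mn.
by apply/seteqP; split => w /=; rewrite in_itv/= andbT => // -[].
Qed.

(** The event that [|D m| >= e] for all [m >= M] has probability at most that of
    [|D m| >= e] for each such [m], hence 0; there are countably many pairs
    [(e, M)] to consider. *)
Lemma ae_frequently_small (D : nat -> T -> R) :
  (forall m, measurable_fun setT (D m)) ->
  (forall e, 0 < e -> P [set w | e <= `|D m w|] @[m --> \oo] --> 0%E) ->
  {ae P, forall w, forall e, 0 < e -> forall M, exists2 m, (M <= m)%N & `|D m w| < e}.
Proof.
move=> mD hD.
suff : {ae P, forall w, forall kM : nat * nat,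
    exists2 m, (kM.2 <= m)%N & `|D m w| < kM.1.+1%:R^-1}.
  apply: filterS => w h e e0 M.
  have := archi_boundP (ltW (divr_gt0 (@ltr01 R) e0)).
  set k := Num.bound _ => hk.
  have [m Mm Dm] := h (k, M); exists m => //; apply: lt_trans Dm _.
  rewrite invf_plt ?posrE// -[e^-1]mul1r (lt_le_trans hk)// ler_nat//.
apply: ae_forall_countable => -[k M] /=.
pose e : R := k.+1%:R^-1; have e0 : 0 < e by rewrite invr_gt0.
pose F := \bigcap_(m in [set m | (M <= m)%N]) [set w | e <= `|D m w|].
have mF : measurable F by apply: bigcap_measurable => [|m _]; [by exists M => /=|exact: mge].
exists F; split => //.
  apply/eqP; rewrite eq_le measure_ge0 andbT.
  have := hD e e0; move=> /cvge_to_ge; apply.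
  exists M => // m /= Mm; apply: le_measure; rewrite ?inE//; first exact: mge.
  by move=> w /(_ m Mm).
move=> w /= nw m Mm; rewrite /= leNgt; apply/negP => h; apply: nw.
by exists m.
Qed.

Lemma cvg_in_probability_sub (D E : nat -> T -> R) :
  (forall m, measurable_fun setT (D m)) -> (forall m, measurable_fun setT (E m)) ->
  (forall e, 0 < e -> P [set w | e <= `|D m w|] @[m --> \oo] --> 0%E) ->
  (forall e, 0 < e -> P [set w | e <= `|E m w|] @[m --> \oo] --> 0%E) ->
  forall e, 0 < e -> P [set w | e <= `|D m w - E m w|] @[m --> \oo] --> 0%E.
Proof.
move=> mD mE hD hE e e0; have e2 : 0 < e / 2 by rewrite divr_gt0.
apply: (@squeeze_cvge _ _ _ _ (cst 0%E) _
  (fun m => (P [set w | (e / 2 <= `|D m w|)%R] + P [set w | (e / 2 <= `|E m w|)%R])%E)).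
- apply: nearW => m /=; rewrite measure_ge0 /=.
  apply: le_trans (measureU2 _ _ _); [|exact: mge|exact: mge].
  apply: le_measure; rewrite ?inE.
  + by apply: mge; exact: measurable_funB.
  + by apply: measurableU; exact: mge.
  move=> w /= h; have [h1|h1] := leP (e / 2) `|D m w|; first by left.
  right; rewrite leNgt; apply/negP => h2.
  have := ler_normB (D m w) (E m w); lra.
- exact: cvg_cst.
- by rewrite -[X in _ --> X]adde0; apply: cvgeD => //; [exact: hD|exact: hE].
Qed.

Variables X Y J : R -> T -> R.
Hypothesis mX : forall t, 0 <= t <= 1 -> measurable_fun setT (X t).
Hypothesis mY : forall t, 0 <= t <= 1 -> measurable_fun setT (Y t).
Hypothesis hJ : stratonovich_integral P X Y J.

Let trap (m a b : nat) (w : T) : R := trapezoid_sum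
  (fun k => X (k%:R / 2 ^+ m) w) (fun k => Y (k%:R / 2 ^+ m) w) a b.

Let pt01 m k : (k <= 2 ^ m)%N -> 0 <= (k%:R / 2 ^+ m : R) <= 1.
Proof.
move=> km; rewrite divr_ge0//= ?exprn_ge0// ler_pdivrMr ?exprn_gt0// mul1r.
by rewrite -natrX ler_nat.
Qed.

Let mtrap m b : (b <= 2 ^ m)%N -> measurable_fun setT (trap m 0 b).
Proof.
move=> bm; rewrite /trap /trapezoid_sum; under eq_fun do rewrite big_mkord.
apply: measurable_sum => k.
have kb : (k.+1 <= 2 ^ m)%N by exact: leq_trans bm.
have [k1 k2] := (pt01 (ltnW kb), pt01 kb).
apply: measurable_funM; last by apply: measurable_funB; exact: mY.
by apply: measurable_funM => //; apply: measurable_funD; exact: mX.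
Qed.

Let trap_strat m k w : trap m 0 k w =
  stratonovich_sum (X ^~ w) (Y ^~ w) 0 (k%:R / 2 ^+ m)
    (mkseq (fun l => 0 + (2 ^+ m)^-1 * l.+1%:R) k).
Proof.
have h0 : 0 < (2 ^+ m)^-1 :> R by rewrite invr_gt0 exprn_gt0.
have [_ nthE] := uniform_partition 0 k h0.
rewrite /trap /trapezoid_sum /stratonovich_sum size_mkseq !big_nat.
apply: eq_bigr => l /andP[_ lk].
by rewrite !nthE ?(ltnW lk)// !add0r ![_^-1 * _]mulrC.
Qed.

(** Trapezoid sums along the grid of generation [m + n] are Stratonovich sums for a
    partition of mesh [2^(-(m + n))]. *)
Lemma stratonovich_dyadic_cvg (n k : nat) (e : R) : (k <= 2 ^ n)%N -> 0 < e ->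
  P [set w | e <= `|trap (m + n) 0 (k * 2 ^ m) w - J (k%:R / 2 ^+ n) w|]
    @[m --> \oo] --> 0%E.
Proof.
move=> kn e0; have [_ _ h] := hJ.
have {}h := h _ (pt01 kn) e e0.
move=> A /h [del del0 hA].
have : \forall m \near \oo, (2^-1 : R) ^+ m < del.
  have : (2^-1 : R) ^+ m @[m --> \oo] --> 0 by apply: cvg_expr; rewrite ger0_norm; lra.
  by move=> /cvgr_lt; apply.
apply: filterS => m hm /=.
have h0 : 0 < (2 ^+ (m + n))^-1 :> R by rewrite invr_gt0 exprn_gt0.
have [abs nthE] := uniform_partition 0 (k * 2 ^ m) h0.
have E : 0 + (2 ^+ (m + n))^-1 * (k * 2 ^ m)%:R = k%:R / 2 ^+ n :> R.
  by rewrite add0r natrM natrX exprD invfM [RHS]mulrC; field; rewrite !expf_neq0.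
have E' : (k * 2 ^ m)%:R / 2 ^+ (m + n) = k%:R / 2 ^+ n :> R by rewrite -E add0r mulrC.
rewrite E in abs.
under eq_set do rewrite trap_strat E'.
apply: (hA _ abs) => l; rewrite size_mkseq => lk; rewrite !nthE ?(ltnW lk)//.
rewrite opprD addrACA subrr add0r -mulrBr -natrB// subSnn mulr1.
rewrite exprD invfM; apply: le_lt_trans hm.
by rewrite exprVn ler_piMr ?invr_ge0 ?exprn_ge0// invf_le1 ?exprn_gt0// exprn_ege1//; lra.
Qed.

(** At time 0 all the sums are empty. *)
Lemma ae_stratonovich_start : {ae P, forall w, J 0 w = 0}.
Proof.
have z1 : 0 <= (0 : R) <= 1 by rewrite lexx ler01.
have [mJ _ _] := hJ.
have mN : measurable_fun setT (fun w => - J 0 w).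
  by apply: measurableT_comp => //; exact: mJ.
have h := @ae_frequently_small (fun=> fun w => - J 0 w) (fun=> mN); apply: filterS (h _) => [w hw|e e0].
  apply/eqP; rewrite -normr_le0; apply/ler_addgt0Pr => e e0; rewrite add0r.
  by have [m _] := hw e e0 0%N; rewrite normrN => /ltW.
have := @stratonovich_dyadic_cvg 0 0 e isT e0.
rewrite mul0r.
under eq_fun do under eq_set do rewrite mul0n /trap /trapezoid_sum big_geq// sub0r.
exact.
Qed.

(** Over a dyadic interval the sum is the difference of two sums starting at 0. *)
Lemma ae_stratonovich_dyadic_approx : {ae P, forall w, forall j i, (i < 2 ^ j)%N ->
  forall e : R, 0 < e -> forall M, exists m, [/\ (M <= m)%N, (j <= m)%N &
    `|trap m (i * 2 ^ (m - j)) (i.+1 * 2 ^ (m - j)) w -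
      (J (i.+1%:R / 2 ^+ j) w - J (i%:R / 2 ^+ j) w)| < e]}.
Proof.
have [mJ _ _] := hJ.
suff : {ae P, forall w, forall ji : nat * nat, (ji.2 < 2 ^ ji.1)%N ->
  forall e : R, 0 < e -> forall M, exists2 m, (M <= m)%N &
    `|(trap (m + ji.1) 0 (ji.2.+1 * 2 ^ m) w - J (ji.2.+1%:R / 2 ^+ ji.1) w) -
      (trap (m + ji.1) 0 (ji.2 * 2 ^ m) w - J (ji.2%:R / 2 ^+ ji.1) w)| < e}.
  apply: filterS => w h j i ij e e0 M.
  have [m Mm hm] := h (j, i) ij e e0 M; exists (m + j)%N; split.
  - by rewrite (leq_trans Mm)// leq_addr.
  - exact: leq_addl.
  rewrite addnK; apply: le_lt_trans hm; rewrite /=.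
  have -> : trap (m + j) 0 (i.+1 * 2 ^ m) w = trap (m + j) 0 (i * 2 ^ m) w +
      trap (m + j) (i * 2 ^ m) (i.+1 * 2 ^ m) w.
    by rewrite /trap /trapezoid_sum -big_cat_nat//= leq_mul2r leqnSn orbT.
  by rewrite le_eqVlt; apply/orP; left; apply/eqP; congr `|_|; ring.
apply: ae_forall_countable => -[j i] /=.
have [ij|] := boolP (i < 2 ^ j)%N; last by move=> _; apply: nearW => w /=.
have md k : (k <= 2 ^ j)%N -> forall m, measurable_fun setT
    (fun w => trap (m + j) 0 (k * 2 ^ m) w - J (k%:R / 2 ^+ j) w).
  move=> kj m; apply: measurable_funB; last by apply: mJ; exact: pt01.
  by apply: mtrap; rewrite expnD mulnC leq_mul2l kj orbT.
have h := @ae_frequently_small _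
  (fun m => measurable_funB (md _ ij m) (md _ (ltnW ij) m)) _.
apply: filterS (h _) => [w hw _|]; first exact: hw.
apply: cvg_in_probability_sub; [exact: md|by apply: md; exact: ltnW|..] => e e0.
  exact: stratonovich_dyadic_cvg.
by apply: stratonovich_dyadic_cvg => //; exact: ltnW.
Qed.

End stratonovich_dyadic_approximation.

(** * Brownian sample paths *)

Section sample_path_unique_minimizer.
Context (R : realType) (d : nat).
Variables (x : R -> 'rV[R]_d) (Y : R -> 'M[R]_d) (alpha p : R).
Hypotheses (alpha0 : 0 < alpha) (alpha_lt : alpha < 2^-1) (p0 : 0 < p).
Hypotheses (Y0 : Y 0 = 0) (x0 : x 0 = 0).
Hypothesis xc : {within `[0, 1], continuous x}.
Hypothesis Yc : forall a b, {within `[0, 1], continuous (fun t => Y t a b)}.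
Hypothesis dx_bound : exists2 C : R, 0 <= C & forall m k a, (k < 2 ^ m)%N ->
  `|dyadic_incr x m k a| <= C * m.+1%:R * Num.sqrt (2^-1 ^+ m).
Hypothesis area_bound : exists2 C : R, 0 <= C & forall m j i a b, (j <= m)%N ->
  (i < 2 ^ j)%N -> `|\sum_(i * 2 ^ (m - j) <= l < i.+1 * 2 ^ (m - j))
    cell_area x m l a b| <= C * m.+1%:R * Num.sqrt (2^-1 ^+ (m + j)).
Hypothesis Y_approx : forall j i a b, (i < 2 ^ j)%N -> forall e : R, 0 < e ->
  forall M, exists m, [/\ (M <= m)%N, (j <= m)%N &
    `|dyadic_trapezoid x m j i a b -
      (Y (i.+1%:R / 2 ^+ j) a b - Y (i%:R / 2 ^+ j) a b)| < e].

Let Bs (t : R) : tensor2 R d := (1, x t, Y t).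

Lemma sample_path_unique_minimizer :
  minimizer (admissible alpha p x) (lift_functional alpha p x) Bs /\
  forall X, minimizer (admissible alpha p x) (lift_functional alpha p x) X ->
    eq_rough X Bs.
Proof.
have [a0 a1] := (alpha0, alpha_lt).
(* Any [alpha < gam < beta < 1/2] would do; these are equally spaced. *)
pose gam := (2 * alpha + 2^-1) / 3; pose beta := (alpha + 2 * 2^-1) / 3.
have alpha_gam : alpha < gam by rewrite /gam; lra.
have gam_beta : gam < beta by rewrite /gam /beta; lra.
have beta_lt : beta < 2^-1 by rewrite /beta; lra.
have beta0 : 0 < beta by rewrite /beta; lra.
have rho01 : 0 < (2^-1 : R) `^ ((2^-1 - beta) / 2) < 1.
  by apply: half_powR_lt1; rewrite divr_gt0// subr_gt0.
have rho01' : 0 <= (2^-1 : R) `^ ((2^-1 - beta) / 2) < 1.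
  by case/andP: rho01 => /ltW -> ->.
have dx := dyadic_increment_decay dx_bound beta0 beta_lt.
have ap := interp_area_decay area_bound Y_approx beta0 beta_lt.
have ar := area_incr_decay dx_bound area_bound Y_approx beta0 beta_lt.
have [K K0 hK] := sample_path_hoelder xc Yc dx_bound area_bound Y_approx beta0 beta_lt.
have sym := second_level_symmetric Y0 x0 xc Yc area_bound Y_approx beta0 beta_lt.
apply: lift_functional_unique_minimizer => //.
  apply: (lift_functional_enhanced_path _ rho01' dx ap ar gam_beta p0 alpha_gam) => //.
  by lra.
apply: (admissible_enhanced_path beta0 p0 _ K0 sym hK); lra.
Qed.

End sample_path_unique_minimizer.

Theorem theorem3p11 (R : realType) (alpha p : R)
  (halpha : 1 / 3 < alpha < 1 / 2) (hp : 1 < p) (halphap : 1 / p < alpha)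
  (disp : measure_display) (Omega : measurableType disp)
  (P : probability Omega R)
  (d : nat) (B : R -> Omega -> 'rV[R]_d) (hB : brownian_motion P B)
  (BB : R -> Omega -> 'M[R]_d)
  (hBB : forall i j : 'I_d,
     stratonovich_integral P (fun t w => B t w 0 i) (fun t w => B t w 0 j)
       (fun t w => BB t w i j)) :
  {ae P, forall w : Omega,
    let Bs : R -> tensor2 R d := fun t => (1, B t w, BB t w) in
    let A := admissible alpha p (B ^~ w) in
    let F := lift_functional alpha p (B ^~ w) in
    minimizer A F Bs /\ forall X, minimizer A F X -> eq_rough X Bs}.
Proof.
have mB i t : 0 <= t <= 1 -> measurable_fun [set: Omega] (fun w => B t w 0 i).
  exact: measurable_brownian hB t i.
have BB0 : {ae P, forall w, forall ij : 'I_d * 'I_d, BB 0 w ij.1 ij.2 = 0}.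
  by apply: ae_forall_countable => -[i j]; exact: ae_stratonovich_start (hBB i j).
have BBc : {ae P, forall w, forall ij : 'I_d * 'I_d,
    {within `[0, 1], continuous (fun t => BB t w ij.1 ij.2)}}.
  by apply: ae_forall_countable => -[i j]; have [] := hBB i j.
have BBa : {ae P, forall w, forall ab : 'I_d * 'I_d, forall j i, (i < 2 ^ j)%N ->
  forall e : R, 0 < e -> forall M, exists m, [/\ (M <= m)%N, (j <= m)%N &
    `|dyadic_trapezoid (B ^~ w) m j i ab.1 ab.2 -
      (BB (i.+1%:R / 2 ^+ j) w ab.1 ab.2 - BB (i%:R / 2 ^+ j) w ab.1 ab.2)| < e]}.
  apply: ae_forall_countable => -[a b].
  exact: ae_stratonovich_dyadic_approx (mB a) (mB b) (hBB a b).
have [_ B0 Bc _ _] := hB.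
have /andP[a3 a2h] := halpha.
have a0 : 0 < alpha by lra.
have a2 : alpha < 2^-1 by lra.
have p0 : 0 < p by lra.
near=> w.
apply: sample_path_unique_minimizer => //.
- apply/matrixP => a b; rewrite mxE.
  suff : forall ij : 'I_d * 'I_d, BB 0 w ij.1 ij.2 = 0 by move=> /(_ (a, b)).
  by near: w.
- by near: w.
- by near: w.
- move=> a b.
  suff : forall ij : 'I_d * 'I_d, {within `[0, 1], continuous (fun t => BB t w ij.1 ij.2)}.
    by move=> /(_ (a, b)).
  by near: w.
- by near: w; exact: ae_dyadic_incr_bound hB.
- by near: w; exact: ae_dyadic_area_bound hB.
- move=> j i a b; move: j i.
  suff : forall ab : 'I_d * 'I_d, forall j i, (i < 2 ^ j)%N ->
    forall e : R, 0 < e -> forall M, exists m, [/\ (M <= m)%N, (j <= m)%N &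
    `|dyadic_trapezoid (B ^~ w) m j i ab.1 ab.2 -
      (BB (i.+1%:R / 2 ^+ j) w ab.1 ab.2 - BB (i%:R / 2 ^+ j) w ab.1 ab.2)| < e].
    by move=> /(_ (a, b)).
  by near: w.
Unshelve. all: by end_near.
Qed.
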